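(* Consider a (two-sided) uniformly weak two-user ergodic fading Gaussian interference channel with average power constraints $\overline{P}_1,\overline{P}_2$ for which every fading state $\mathbf{h}$ satisfies $$|h_{1,1}|>|h_{2,1}|\quad\text{and}\quad|h_{2,2}|>|h_{1,2}|.$$ Then the sum-capacity is upper bounded as $$R_1+R_2\le\max_{\underline{P}(\mathbf{H})\in\mathcal{P}}\min\left(S^{(w,1)}(\underline{P}(\mathbf{H})),\ S^{(w,2)}(\underline{P}(\mathbf{H}))\right),$$ where $$S^{(w,1)}(\underline{P}(\mathbf{H}))=\mathbb{E}\left[C\left(\frac{|H_{1,1}|^2P_1(\mathbf{H})}{1+|H_{1,2}|^2P_2(\mathbf{H})}\right)+C\left(|H_{2,2}|^2P_2(\mathbf{H})\right)\right],$$ $$S^{(w,2)}(\underline{P}(\mathbf{H}))=\mathbb{E}\left[C\left(\frac{|H_{2,2}|^2P_2(\mathbf{H})}{1+|H_{2,1}|^2P_1(\mathbf{H})}\right)+C\left(|H_{1,1}|^2P_1(\mathbf{H})\right)\right].$$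
   Context: Notation: $C(x)=\log_2(1+x)$. Channel: at each time $i$ transmitter $k\in\{1,2\}$ sends $X_{k,i}\in\mathbb{C}$ and receiver $m\in\{1,2\}$ receives $Y_{m,i}=H_{m,1,i}X_{1,i}+H_{m,2,i}X_{2,i}+Z_{m,i}$, with $Z_{m,i}$ zero-mean unit-variance circularly symmetric complex Gaussian noise, i.i.d. over time and independent of the fading and the messages. The matrices $\mathbf{H}_i=(H_{m,k,i})_{m,k}$ form a stationary ergodic process of random complex $2\times2$ matrices (arbitrary marginal law, entries not necessarily independent), independent of the messages; $\mathbf{H}=(H_{m,k})$ denotes a matrix with the marginal law and $\mathbf{h}=(h_{m,k})$ a realization. The fading is known instantaneously at all transmitters and receivers. Codes: transmitter $k$ has a message $W_k$ uniform on $\{1,\dots,2^{B_k}\}$, the two messages being independent; the rate is $R_k=B_k/n$ for block length $n$. $X_{k,i}$ is a function of $W_k$ and $\mathbf{H}_1,\dots,\mathbf{H}_i$, subject to $\sum_{i=1}^n|X_{k,i}|^2\le n\overline{P}_k$. Receiver $k$ observes $Y_k^n$ and $\mathbf{H}^n$ and must decode $W_k$ ($k=1,2$). A rate pair is achievable if there are codes of these rates with average error probability tending to $0$ as $n\to\infty$; the capacity region is the closure of the set of achievable pairs, and the sum-capacity is the supremum of $R_1+R_2$ over it. Power policies: $\mathcal{P}$ is the set of (measurable) maps $\underline{P}=(P_1,P_2)$ from fading states $\mathbf{h}$ to $[0,\infty)^2$ with $\mathbb{E}[P_k(\mathbf{H})]\le\overline{P}_k$, $k=1,2$. *)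

(* Defs.v *)
From HB Require Import structures.
From mathcomp Require Import all_boot all_order all_algebra finmap.
From mathcomp Require Import all_classical all_reals all_analysis.
From mathcomp.real_closed Require Export complex.

Set Implicit Arguments.
Unset Strict Implicit.
Unset Printing Implicit Defensive.

Import Order.TTheory GRing.Theory Num.Theory.
Import numFieldNormedType.Exports.

Local Open Scope classical_set_scope.
Local Open Scope ring_scope.

(* Users, receivers and transmitters are indexed by 'I_2, so that user 1 is 0
   and user 2 is 1; a fading state is a matrix h whose row is the receiver and
   whose column is the transmitter, i.e. h_{m,k} is h m k.  Times i = 1, 2, ...
   are shifted to i = 0, 1, ... *)

HB.instance Definition _ (R : realType) := isPointed.Build R[i] 0.

(* Borel sigma-algebra of C = R x R. *)
HB.instance Definition _ (R : realType) := Measurable.copy R[i]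
  (g_sigma_algebra_preimageType
    (fun z : R[i] => (complex.Re z, complex.Im z))).

(* Borel sigma-algebra of the complex 2 x 2 matrices, i.e. of C^4. *)
HB.instance Definition _ (R : realType) := Measurable.copy 'M[R[i]]_2
  (g_sigma_algebra_preimageType (fun A : 'M[R[i]]_2 =>
     ((A 0 0, A 0 1), (A 1 0, A 1 1)))).

Definition normc {R : realType} (z : R[i]) : R := ComplexField.Normc.normc z.

Definition Cfun {R : realType} (x : R) : R := ln (1 + x) / ln 2.

Section Processes.
Context {R : realType} {d : measure_display} {T : measurableType d}.
Variable P : probability T R.

(* The product (cylinder) sigma-algebra on the sequence space S^N. *)
Definition path_measurable {d' : measure_display} (S : measurableType d') :
    set (set (nat -> S)) :=
  <<s \bigcup_i preimage_set_system setT (fun x : nat -> S => x i) measurable >>.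

Definition stationary {d' : measure_display} {S : measurableType d'}
    (X : nat -> {RV P >-> S}) : Prop :=
  forall A, path_measurable A ->
    P [set t | A (fun i => X i.+1 t)] = P [set t | A (fun i => X i t)].

Definition ergodic {d' : measure_display} {S : measurableType d'}
    (X : nat -> {RV P >-> S}) : Prop :=
  forall A, path_measurable A ->
    [set x : nat -> S | A (fun i => x i.+1)] = A ->
    P [set t | A (fun i => X i t)] = 0%E \/ P [set t | A (fun i => X i t)] = 1%E.

Definition mutually_independent {d' : measure_display} {S : measurableType d'}
    (X : nat -> {RV P >-> S}) : Prop :=
  forall (J : {fset nat}) (A : nat -> set S), (forall j, measurable (A j)) ->
    P (\bigcap_(j in [set` J]) X j @^-1` A j) =
    (\big[*%E/1%E]_(j <- J) P (X j @^-1` A j))%E.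

Definition independent_processes {d1 d2 : measure_display}
    {S1 : measurableType d1} {S2 : measurableType d2}
    (X : nat -> {RV P >-> S1}) (Y : nat -> {RV P >-> S2}) : Prop :=
  forall A B, path_measurable A -> path_measurable B ->
    P ([set t | A (fun i => X i t)] `&` [set t | B (fun i => Y i t)]) =
    (P [set t | A (fun i => X i t)] * P [set t | B (fun i => Y i t)])%E.

(* Zero-mean unit-variance circularly symmetric complex Gaussian: real and
   imaginary parts are independent N(0, 1/2) variables. *)
Definition standard_complex_gaussian (Z : {RV P >-> R[i]}) : Prop :=
  forall A B : set R, measurable A -> measurable B ->
    P [set t | A (complex.Re (Z t)) /\ B (complex.Im (Z t))] =
    (normal_prob 0 (Num.sqrt 2^-1) A * normal_prob 0 (Num.sqrt 2^-1) B)%E.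

End Processes.

Section Codes.
Variable R : realType.

(* A code of block length n with 2 ^ B k messages for user k.  The symbol sent
   at time i is a function of the message and of the states at times 0, ..., i
   only. *)
Record code (n : nat) (B : 'I_2 -> nat) := Code {
  enc : forall (k : 'I_2) (i : 'I_n),
    'I_(2 ^ B k) -> i.+1.-tuple 'M[R[i]]_2 -> R[i];
  dec : forall k : 'I_2,
    n.-tuple 'M[R[i]]_2 -> n.-tuple R[i] -> 'I_(2 ^ B k);
  enc_measurable : forall k i w, measurable_fun setT (@enc k i w);
  dec_measurable : forall k w,
    measurable [set x : n.-tuple 'M[R[i]]_2 * n.-tuple R[i] |
                @dec k x.1 x.2 = w] }.

Arguments enc {n B} c k i w _.
Arguments dec {n B} c k _ _.

Definition messages (B : 'I_2 -> nat) := {dffun forall k : 'I_2, 'I_(2 ^ B k)}.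

Definition codeword {n B} (c : code n B) (k : 'I_2) (w : 'I_(2 ^ B k))
    (h : nat -> 'M[R[i]]_2) (i : 'I_n) : R[i] :=
  enc c k i w [tuple h j | j < i.+1].

Definition power_constraint {n B} (Pbar : 'I_2 -> R) (c : code n B) : Prop :=
  forall (k : 'I_2) (w : 'I_(2 ^ B k)) (h : nat -> 'M[R[i]]_2),
    \sum_(i < n) normc (codeword c w h i) ^+ 2 <= n%:R * Pbar k.

End Codes.

Section Channel.
Context {R : realType} {d : measure_display} {T : measurableType d}.
Variable P : probability T R.
Variable H : nat -> {RV P >-> 'M[R[i]]_2}.
Variable Z : 'I_2 -> nat -> {RV P >-> R[i]}.
Variable Pbar : 'I_2 -> R.

Definition fading_path (t : T) : nat -> 'M[R[i]]_2 := fun i => H i t.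

Definition output {n B} (c : code R n B) (w : messages B) (m : 'I_2)
    (t : T) (i : 'I_n) : R[i] :=
  H i t m 0 * codeword c (w 0) (fading_path t) i
  + H i t m 1 * codeword c (w 1) (fading_path t) i
  + Z m i t.

Definition decoded {n B} (c : code R n B) (w : messages B) (k : 'I_2)
    (t : T) : 'I_(2 ^ B k) :=
  dec c k [tuple H j t | j < n] [tuple output c w k t j | j < n].

Definition error_event {n B} (c : code R n B) (w : messages B) : set T :=
  [set t | exists k : 'I_2, decoded c w k t <> w k].

(* The messages are independent, uniform and independent of (H, Z): the
   error probability is the uniform average, over the message pairs, of the
   error probability given the pair. *)
Definition avg_error {n B} (c : code R n B) : \bar R :=
  ((#|messages B|%:R^-1)%:E * \sum_(w : messages B) P (error_event c w))%E.

(* r k = lim B_k / n; since 2 ^ B_k is an integer power of two, the rates of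
   the codes are only required to converge to r. *)
Definition achievable (r : R * R) : Prop :=
  exists (B : nat -> 'I_2 -> nat) (c : forall n, code R n (B n)),
    [/\ forall n, power_constraint Pbar (c n),
        (B n 0)%:R / n%:R @[n --> \oo] --> r.1,
        (B n 1)%:R / n%:R @[n --> \oo] --> r.2 &
        avg_error (c n) @[n --> \oo] --> 0%E].

Definition capacity_region : set (R * R) := closure [set r | achievable r].

Definition sum_capacity : \bar R :=
  ereal_sup [set (r.1 + r.2)%:E | r in capacity_region].

(* H 0 has the common marginal law of the stationary process H. *)
Definition power_policy (p : 'I_2 -> 'M[R[i]]_2 -> R) : Prop :=
  forall k, [/\ measurable_fun setT (p k),
                forall h, 0 <= p k h &
                ('E_P[p k \o H 0%N] <= (Pbar k)%:E)%E].

Definition S_w1 (p : 'I_2 -> 'M[R[i]]_2 -> R) : \bar R :=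
  'E_P[(fun h : 'M[R[i]]_2 =>
          Cfun (normc (h 0 0) ^+ 2 * p 0 h / (1 + normc (h 0 1) ^+ 2 * p 1 h))
          + Cfun (normc (h 1 1) ^+ 2 * p 1 h)) \o H 0%N].

Definition S_w2 (p : 'I_2 -> 'M[R[i]]_2 -> R) : \bar R :=
  'E_P[(fun h : 'M[R[i]]_2 =>
          Cfun (normc (h 1 1) ^+ 2 * p 1 h / (1 + normc (h 1 0) ^+ 2 * p 0 h))
          + Cfun (normc (h 0 0) ^+ 2 * p 0 h)) \o H 0%N].

End Channel.

Definition uniformly_weak {R : realType} (h : 'M[R[i]]_2) : Prop :=
  normc (h 0 0) > normc (h 1 0) /\ normc (h 1 1) > normc (h 0 1).

(* Main.v *)
(** Receiver 2 is given the message [W_1]. For fixed channels the law of the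
    outputs is compared with that of Gaussian signals of the same powers by two
    likelihood-ratio weights of mean at most 2, which gain a factor [2 ^ B_k] when
    user [k] is decoded; up to these factors their product is the exponential of a
    quadratic form of mean minus the first sum rate. As the signal of user 2 is
    weaker at receiver 1, its true law drops out of the product. The inequality
    [1 + x <= exp x] then gives [p_1 B_1 + p_2 B_2 <= 2 / ln 2 + sum of the rates],
    with [p_k] the probabilities of correct decoding, and symmetrically for the
    second sum rate.

    The powers in this bound depend on the whole past of the fading. Conditioning
    on the current state and averaging over time turns them into a power policy;
    this does not decrease the rates, since under weak interference they are
    concave in the powers and the process is stationary.

    A best policy exists because near-optimal policies that also nearly minimise
    the mean of [exp (- P_1) + exp (- P_2)] are Cauchy, by strict convexity, hence
    converge almost surely along a subsequence, and because the rates, which grow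
    sublinearly in the powers, are upper semicontinuous by Fatou's lemma. *)
Require Import Defs.
From HB Require Import structures.
From mathcomp Require Import all_boot all_order all_algebra finmap.
From mathcomp Require Import all_classical all_reals all_analysis.
From mathcomp.real_closed Require Import complex.
From mathcomp Require Import measurable_realfun ring lra.
Import Order.TTheory GRing.Theory Num.Theory.
Import numFieldNormedType.Exports.
Local Open Scope classical_set_scope.
Local Open Scope ring_scope.

(** No moment of the fading is assumed, so mean rates may be infinite. For this reason no entropy or
    mutual information is formed: only nonnegative functions are integrated, and in each inequality
    the terms are moved to the side where they are positive.

    Rewarding a correct guess among [N] messages by the factor [N] multiplies the mean of a weight
    by at most [(2 * N - 1) / N], hence the bound 2. The constant [2 / ln 2] is the sum of the two
    means, less the two units lost in [ln x <= x - 1], converted to bits; it vanishes on division by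
    the block length.

    The law of user 2's signal at receiver 1 is unknown; it divides one weight and multiplies the
    other, and cancels only if both weights are evaluated on one probability space. Each decoding
    probability involves a single receiver, so the two noises may be coupled at will, and they are
    coupled so that receiver 1 sees a degraded version of the output of receiver 2.

    One policy has to serve both sum rates, since the minimum stands inside the maximum. The
    averaging over time provides this, as it does not depend on the rate considered. *)

Lemma integral_cst_probability d (T : measurableType d) (R : realType)
  (P : probability T R) (r : \bar R) : (\int[P]_x r = r)%E.
Proof.
transitivity (r * P setT)%E; first exact: (integral_cst P measurableT r).
by rewrite probability_setT mule1.
Qed.

(** * Gaussian measures *)

Section density.
Local Open Scope ereal_scope.
Context d (T : measurableType d) (R : realType).
Variables (nu : {finite_measure set T -> \bar R})
          (mu : {sigma_finite_measure set T -> \bar R}) (r : T -> \bar R).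
Hypotheses (mr : measurable_fun [set: T] r) (r0 : forall x, 0 <= r x)
  (nuE : forall A, measurable A -> nu A = \int[mu]_(x in A) r x).

(** The density [r] and the Radon-Nikodym derivative have the same integral over every measurable
    set, so they agree almost everywhere and the change of variables known for the derivative
    carries over to [r]. *)
Lemma ge0_integral_density (f : T -> \bar R) :
  measurable_fun setT f -> (forall x, 0 <= f x) ->
  \int[nu]_x f x = \int[mu]_x (f x * r x).
Proof.
move=> mf f0.
have numu : nu `<< mu.
  apply/null_content_dominatesP => A mA muA; rewrite nuE//.
  by apply: null_set_integral => //; exact: measurable_funTS.
have mRN : measurable_fun [set: T] (Radon_Nikodym_SigmaFinite.f nu mu).
  by apply: measurable_int; exact: Radon_Nikodym_SigmaFinite.f_integrable.
rewrite -(Radon_Nikodym_SigmaFinite.change_of_variables numu)//.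
apply: ae_eq_integral => //; try exact: emeasurable_funM.
apply: ae_eqe_mul2l.
apply: integral_ae_eq => //.
  exact: Radon_Nikodym_SigmaFinite.f_integrable.
by move=> A _ mA; rewrite -Radon_Nikodym_SigmaFinite.f_integral// nuE.
Qed.

End density.

Section real_gaussian.
Context {R : realType}.
Notation lambda := (@lebesgue_measure R).

(** The image of Lebesgue measure under the affine map, scaled by [s], agrees with Lebesgue measure
    on half-open intervals, hence everywhere. *)
Lemma lebesgue_integral_affine (m s : R) (f : R -> \bar R) : 0 < s ->
  measurable_fun setT f -> (forall x, 0 <= f x)%E ->
  (\int[lambda]_x f x = s%:E * \int[lambda]_x f (m + s * x)%R)%E.
Proof.
move=> s0 mf f0.
pose phi : measurableTypeR R -> measurableTypeR R := fun x => m + s * x.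
have mphi : measurable_fun setT phi.
  by apply: measurable_funD => //; exact: measurable_funM.
pose nu : {measure set (measurableTypeR R) -> \bar R} :=
  mscale (NngNum (ltW s0)) (pushforward lambda phi).
rewrite (eq_measure_integral (nu mphi)); last first.
  move=> A mA _; apply: lebesgue_measure_unique => // _ [[a b]] _ <-.
  rewrite /nu /= /mscale/= /pushforward.
  have -> : phi @^-1` `]a, b]%classic = `](a - m) / s, (b - m) / s]%classic.
    apply/seteqP; split => x/=; rewrite !in_itv/= /phi => /andP[h1 h2].
      by rewrite ltr_pdivrMr// ler_pdivlMr//; apply/andP; split; lra.
    move: h1 h2; rewrite ltr_pdivrMr// ler_pdivlMr// => h1 h2.
    by apply/andP; split; lra.
  rewrite !lebesgue_measure_itv/= !lte_fin ltr_pM2r ?invr_gt0// ltrD2r.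
  case: ifPn => _; last by rewrite mule0.
  rewrite -!EFinD -EFinM; congr EFin; field; exact: lt0r_neq0.
by rewrite ge0_integral_mscale//= ge0_integral_pushforward.
Qed.

Let sigma0 : R := Num.sqrt 2^-1.

Let sigma0_neq0 : sigma0 != 0.
Proof. by rewrite gt_eqF// sqrtr_gt0 invr_gt0. Qed.

(** The variance 1/2 makes the density proportional to [expR (- x ^+ 2)] and gives the complex noise
    unit variance. *)
Definition gauss1 : probability (measurableTypeR R) R := normal_prob 0 sigma0.

Let gauss1_pdfE (x : R) :
  normal_pdf 0 sigma0 x = normal_peak sigma0 * expR (- x ^+ 2).
Proof.
rewrite normal_pdfE// /normal_fun subr0 sqr_sqrtr ?invr_ge0//.
by rewrite -mulr_natr mulVf// divr1.
Qed.

Let ge0_integral_gauss1 (f : R -> \bar R) :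
  measurable_fun setT f -> (forall x, 0 <= f x)%E ->
  (\int[gauss1]_x f x =
   \int[lambda]_x (f x * (normal_peak sigma0 * expR (- x ^+ 2))%:E))%E.
Proof.
move=> mf f0.
rewrite (@ge0_integral_density _ _ _ _ lambda
  (fun x => (normal_pdf 0 sigma0 x)%:E))//.
  by under eq_integral do rewrite gauss1_pdfE.
by apply/measurable_EFinP; exact: measurable_normal_pdf.
Qed.

(** The density is relative to the Gaussian law itself instead of Lebesgue measure: the noise is the
    reference for every likelihood below. *)
Lemma gauss1_affine (m s : R) (f : R -> \bar R) : 0 < s ->
  measurable_fun setT f -> (forall x, 0 <= f x)%E ->
  (\int[gauss1]_x f (m + s * x)%R =
   \int[gauss1]_x (f x * (s^-1 * expR (x ^+ 2 - ((x - m) / s) ^+ 2))%:E))%E.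
Proof.
move=> s0 mf f0.
have me (g : R -> R) : measurable_fun setT g ->
    measurable_fun setT (fun x => (s^-1 * expR (g x))%:E).
  move=> mg; apply/measurable_EFinP; apply: measurable_funM => //.
  exact: measurableT_comp.
have msq (g : R -> R) : measurable_fun setT g ->
    measurable_fun setT (fun x => g x ^+ 2).
  by move=> mg; exact: measurable_funX.
have mdiv : measurable_fun setT (fun x : R => (x - m) / s).
  by apply: measurable_funM => //; exact: measurable_funB.
have maff : measurable_fun setT (fun x : R => m + s * x).
  by apply: measurable_funD => //; exact: measurable_funM.
have mexp : measurable_fun setT
    (fun x : R => normal_peak sigma0 * expR (- x ^+ 2)).
  apply: measurable_funM => //; apply: measurableT_comp => //.
  by apply: measurableT_comp => //; exact: msq.
have c0 x : 0 <= normal_peak sigma0 * expR (- x ^+ 2).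
  by rewrite mulr_ge0 ?normal_peak_ge0 ?expR_ge0.
rewrite [RHS]ge0_integral_gauss1; last 2 first.
- apply: emeasurable_funM => //; apply: me; apply: measurable_funB; exact: msq.
- by move=> x; rewrite mule_ge0// lee_fin mulr_ge0 ?expR_ge0 ?invr_ge0 ?ltW.
rewrite [LHS]ge0_integral_gauss1; last 2 first.
- exact: (measurableT_comp mf).
- by move=> x; exact: f0.
rewrite [RHS](lebesgue_integral_affine m s)//; last 2 first.
- apply: emeasurable_funM; last exact/measurable_EFinP.
  by apply: emeasurable_funM => //; apply: me; apply: measurable_funB; exact: msq.
- move=> x; rewrite mule_ge0 ?lee_fin// mule_ge0// lee_fin.
  by rewrite mulr_ge0 ?expR_ge0 ?invr_ge0 ?ltW.
rewrite -ge0_integralZl//=; last 3 first.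
- apply: emeasurable_funM; last exact/measurable_EFinP/(measurableT_comp mexp).
  apply: emeasurable_funM; first exact: (measurableT_comp mf).
  apply: (measurableT_comp (me (fun x => x ^+ 2 - ((x - m) / s) ^+ 2) _)) => //.
  by apply: measurable_funB; exact: msq.
- move=> x _; rewrite mule_ge0 ?lee_fin// mule_ge0// lee_fin.
  by rewrite mulr_ge0 ?expR_ge0 ?invr_ge0 ?ltW.
- by rewrite lee_fin ltW.
apply: eq_integral => x _.
rewrite muleCA -muleA; congr (_ * _)%E; rewrite -!EFinM; congr EFin.
have -> : (m + s * x - m) / s = x by field; exact: lt0r_neq0.
rewrite expRD (expRN ((m + s * x) ^+ 2)).
field; rewrite !gt_eqF ?expR_gt0//.
Qed.

Lemma gauss1_opp (f : R -> \bar R) :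
  measurable_fun setT f -> (forall x, 0 <= f x)%E ->
  (\int[gauss1]_x f (- x)%R = \int[gauss1]_x f x)%E.
Proof.
move=> mf f0.
have mexp : measurable_fun setT
    (fun x : R => normal_peak sigma0 * expR (- x ^+ 2)).
  apply: measurable_funM => //; apply: measurableT_comp => //.
  by apply: measurableT_comp => //; exact: measurable_funX.
have c0 x : 0 <= normal_peak sigma0 * expR (- x ^+ 2).
  by rewrite mulr_ge0 ?normal_peak_ge0 ?expR_ge0.
have mopp : measurable_fun setT (-%R : measurableTypeR R -> measurableTypeR R).
  exact: oppr_measurable.
rewrite !ge0_integral_gauss1//; last exact: (measurableT_comp mf).
pose nu : {measure set (measurableTypeR R) -> \bar R} :=
  pushforward lambda (-%R : measurableTypeR R -> measurableTypeR R).
rewrite [RHS](eq_measure_integral (nu mopp)).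
  rewrite (ge0_integral_pushforward mopp).
  - by apply: eq_integral => x _; rewrite /= sqrrN.
  - exact: measurableT.
  - by apply: emeasurable_funM; [exact: mf|exact/measurable_EFinP].
  - by move=> x _; apply: mule_ge0; [exact: f0|rewrite lee_fin; exact: c0].
by move=> A mA _; exact/esym/lebesgue_measureN.
Qed.

End real_gaussian.

(** * The complex Gaussian law and its second moments *)

Section complex_gaussian.
Context {R : realType}.
Notation C := (R[i]).

(** The squared modulus without its square root, so that identities follow by [ring] on the
    coordinates. *)
Definition nsq (z : C) : R := complex.Re z ^+ 2 + complex.Im z ^+ 2.

Lemma normc_sqr (z : C) : normc z ^+ 2 = nsq z.
Proof.
by case: z => x y; rewrite /normc /= sqr_sqrtr// addr_ge0// sqr_ge0.
Qed.

Lemma nsq_ge0 z : 0 <= nsq z.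
Proof. by rewrite addr_ge0// sqr_ge0. Qed.

Lemma nsqM z w : nsq (z * w) = nsq z * nsq w.
Proof. by case: z w => [a b] [c e]; rewrite /nsq /=; ring. Qed.

Lemma nsq_parallelogram z w : nsq (z + w) + nsq (z - w) = 2 * nsq z + 2 * nsq w.
Proof. by case: z w => [a b] [c e]; rewrite /nsq /=; ring. Qed.

Lemma measurable_fun_ReIm d (T : measurableType d) (f : T -> C) :
  measurable_fun setT f <->
  measurable_fun setT (fun t => complex.Re (f t)) /\
  measurable_fun setT (fun t => complex.Im (f t)).
Proof.
pose g (z : C) := (complex.Re z, complex.Im z).
have mg : measurable_fun setT (g : C -> measurableTypeR R * measurableTypeR R).
  by move=> _ A mA; rewrite setTI; exists A => //; rewrite setTI.
split=> [mf|[mRe mIm]].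
  split.
  - exact: (measurableT_comp measurable_fst (measurableT_comp mg mf)).
  - exact: (measurableT_comp measurable_snd (measurableT_comp mg mf)).
move=> _ _ [A mA <-]; rewrite !setTI.
have mgf : measurable_fun setT (g \o f) by exact: measurable_fun_pair.
by have := mgf measurableT _ mA; rewrite setTI.
Qed.

Lemma measurable_Re : measurable_fun setT (@complex.Re R : C -> R).
Proof. by have /measurable_fun_ReIm[] := @measurable_id _ C setT. Qed.

Lemma measurable_Im : measurable_fun setT (@complex.Im R : C -> R).
Proof. by have /measurable_fun_ReIm[] := @measurable_id _ C setT. Qed.

Section ops.
Context d (T : measurableType d).
Implicit Types f g : T -> C.

Lemma measurable_Cadd f g : measurable_fun setT f -> measurable_fun setT g ->
  measurable_fun setT (fun t => f t + g t).
Proof.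
move=> /measurable_fun_ReIm[fr fi] /measurable_fun_ReIm[gr gi].
apply/measurable_fun_ReIm; split.
  rewrite (_ : (fun t => _) = fun t => complex.Re (f t) + complex.Re (g t)).
    exact: measurable_funD.
  by apply/funext => t; case: (f t) (g t) => [? ?] [].
rewrite (_ : (fun t => _) = fun t => complex.Im (f t) + complex.Im (g t)).
  exact: measurable_funD.
by apply/funext => t; case: (f t) (g t) => [? ?] [].
Qed.

Lemma measurable_Cmul f g : measurable_fun setT f -> measurable_fun setT g ->
  measurable_fun setT (fun t => f t * g t).
Proof.
move=> /measurable_fun_ReIm[fr fi] /measurable_fun_ReIm[gr gi].
apply/measurable_fun_ReIm; split.
  rewrite (_ : (fun t => _) = fun t => complex.Re (f t) * complex.Re (g t)
      - complex.Im (f t) * complex.Im (g t)).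
    by apply: measurable_funB; exact: measurable_funM.
  by apply/funext => t; case: (f t) (g t) => [? ?] [].
rewrite (_ : (fun t => _) = fun t => complex.Re (f t) * complex.Im (g t)
    + complex.Im (f t) * complex.Re (g t)).
  by apply: measurable_funD; exact: measurable_funM.
by apply/funext => t; case: (f t) (g t) => [? ?] [? ?]/=; ring.
Qed.

Lemma measurable_nsq f : measurable_fun setT f ->
  measurable_fun setT (fun t => nsq (f t)).
Proof.
move=> /measurable_fun_ReIm[fr fi].
by apply: measurable_funD; exact: measurable_funX.
Qed.

End ops.

Let pair_complex (p : measurableTypeR R * measurableTypeR R) : C :=
  (p.1 +i* p.2)%C.

Let measurable_pair_complex : measurable_fun setT pair_complex.
Proof.
by apply/measurable_fun_ReIm; split; [exact: measurable_fst|exact: measurable_snd].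
Qed.

HB.instance Definition _ := isMeasurableFun.Build _ _ _ _ _
  measurable_pair_complex.

Definition gaussC : probability C R :=
  distribution (gauss1 \x gauss1)%E pair_complex.

Lemma ge0_integral_gaussC (f : C -> \bar R) :
  measurable_fun setT f -> (forall z, 0 <= f z)%E ->
  (\int[gaussC]_z f z = \int[gauss1]_x \int[gauss1]_y f (x +i* y)%C)%E.
Proof.
move=> mf f0; rewrite ge0_integral_distribution// fubini_tonelli1//.
- exact: measurableT_comp.
- by move=> x; exact: f0.
Qed.

(** Density, with respect to [gaussC], of the law of [m + s z] for a standard [z]. *)
Definition rho (m : C) (s : R) (z : C) : R :=
  (s ^+ 2)^-1 * expR (nsq z - nsq (z - m) / s ^+ 2).

Lemma rho_gt0 m s z : 0 < s -> 0 < rho m s z.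
Proof. by move=> s0; rewrite mulr_gt0 ?expR_gt0// invr_gt0 exprn_gt0. Qed.

Lemma rho_ge0 m s z : 0 <= rho m s z.
Proof. by rewrite mulr_ge0 ?expR_ge0// invr_ge0 sqr_ge0. Qed.

Lemma measurable_rho d (T : measurableType d) (m z : T -> C) s :
  measurable_fun setT m -> measurable_fun setT z ->
  measurable_fun setT (fun t => rho (m t) s (z t)).
Proof.
move=> mm mz; apply: measurable_funM => //; apply: measurableT_comp => //.
apply: measurable_funB; first exact: measurable_nsq.
apply: measurable_funM => //; apply: measurable_nsq.
apply: measurable_Cadd => //; apply/measurable_fun_ReIm.
have [mr mi] := (measurable_fun_ReIm _ _ m).1 mm.
split.
  rewrite (_ : (fun t => _) = fun t => - complex.Re (m t)).
    exact: measurableT_comp.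
  by apply/funext => t; case: (m t).
rewrite (_ : (fun t => _) = fun t => - complex.Im (m t)).
  exact: measurableT_comp.
by apply/funext => t; case: (m t).
Qed.

Lemma gaussC_affine (m : C) (s : R) (f : C -> \bar R) : 0 < s ->
  measurable_fun setT f -> (forall z, 0 <= f z)%E ->
  (\int[gaussC]_z f (m + (s%:C)%C * z)%R = \int[gaussC]_z (f z * (rho m s z)%:E))%E.
Proof.
move=> s0 mf f0.
have mfr : measurable_fun setT (fun z => f z * (rho m s z)%:E)%E.
  apply: emeasurable_funM => //; apply/measurable_EFinP.
  exact: measurable_rho.
have fr0 z : (0 <= f z * (rho m s z)%:E)%E.
  by rewrite mule_ge0// lee_fin rho_ge0.
have maff : measurable_fun setT (fun z : C => m + (s%:C)%C * z).
  by apply: measurable_Cadd => //; exact: measurable_Cmul.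
rewrite [RHS]ge0_integral_gaussC// [LHS]ge0_integral_gaussC; last 2 first.
- exact: (measurableT_comp mf).
- by [].
case: m => a b in mfr fr0 maff *.
pose k c (y : R) := s^-1 * expR (y ^+ 2 - ((y - c) / s) ^+ 2).
have mk c : measurable_fun setT (fun y => (k c y)%:E).
  apply/measurable_EFinP; apply: measurable_funM => //.
  apply: measurableT_comp => //; apply: measurable_funB => //.
  apply: measurable_funX; apply: measurable_funM => //; exact: measurable_funB.
have k0 c y : (0 <= (k c y)%:E)%E by rewrite lee_fin mulr_ge0 ?expR_ge0 ?invr_ge0 ?ltW.
have mxy : measurable_fun setT
    (fun p : measurableTypeR R * measurableTypeR R => f (p.1 +i* p.2)%C).
  exact: (measurableT_comp mf).
pose F x := (\int[gauss1]_y (f (x +i* y)%C * (k b y)%:E))%E.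
have mfk : measurable_fun setT (fun p : measurableTypeR R * measurableTypeR R =>
    f (p.1 +i* p.2)%C * (k b p.2)%:E)%E.
  apply: emeasurable_funM => //.
  exact: (measurableT_comp (mk b) measurable_snd).
have mF : measurable_fun setT F.
  by apply: (measurable_fun_fubini_tonelli_F (m2 := gauss1) _ mfk) => p;
    rewrite mule_ge0.
have F0 x : (0 <= F x)%E by apply: integral_ge0 => y _; rewrite mule_ge0.
transitivity (\int[gauss1]_x F (a + s * x)%R)%E.
  apply: eq_integral => x _; rewrite /F.
  rewrite -(gauss1_affine b s (fun y => f ((a + s * x)%R +i* y)%C))//; last first.
    exact: (measurableT_comp mxy (pair1_measurable _)).
  apply: eq_integral => y _; congr f; apply/eqP.
  by rewrite eq_complex /=; apply/andP; split; apply/eqP; ring.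
etransitivity; first exact: (gauss1_affine a s F s0 mF F0).
apply: eq_integral => x _.
rewrite /F -ge0_integralZr; last 4 first.
- exact: measurableT.
- exact: (measurableT_comp mfk (pair1_measurable _)).
- by move=> y _; rewrite mule_ge0.
- exact: k0 a x.
apply: eq_integral => y _; rewrite -muleA; congr (_ * _)%E.
rewrite -EFinM; congr EFin; rewrite /k /rho /nsq/=.
rewrite mulrACA -expRD -expr2 exprVn; congr (_ * expR _).
by field; exact: lt0r_neq0.
Qed.

Lemma integral_rho m s : 0 < s -> (\int[gaussC]_z (rho m s z)%:E = 1)%E.
Proof.
move=> s0; under eq_integral do rewrite -[X in X%:E]mul1r EFinM.
rewrite -(gaussC_affine m s (cst 1%E))//.
exact: integral_cst_probability.
Qed.

(** The density of scale [Num.sqrt u] has mass 1, and bounding its exponential from below shows that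
    the second moment is at most [u] for every [u > 1] and at least [u] for every [u < 1]. *)
Lemma integral_nsq_gaussC : (\int[gaussC]_z (nsq z)%:E = 1)%E.
Proof.
have nsq0 (z : C) : (0 <= (nsq z)%:E)%E by rewrite lee_fin nsq_ge0.
have mnsq : measurable_fun setT (fun z : C => (nsq z)%:E).
  by apply/measurable_EFinP; exact: measurable_nsq.
(* [t * nsq z <= expR (t * nsq z) - 1] for [t = 1 - 1/s^2] of either sign *)
have rho0 u z : 0 < u -> 1 + (1 - u^-1) * nsq z <= u * rho 0 (Num.sqrt u) z.
  move=> u0; rewrite /rho subr0 sqr_sqrtr ?(ltW u0)//.
  rewrite mulrA divff ?mul1r; last exact: lt0r_neq0.
  apply: le_trans (expR_ge1Dx _); rewrite mulrBl mul1r [nsq z / _]mulrC//.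
have int_rho u : 0 < u -> (\int[gaussC]_z (u * rho 0 (Num.sqrt u) z)%:E = u%:E)%E.
  move=> u0; under eq_integral do rewrite EFinM.
  rewrite ge0_integralZl//= ?integral_rho ?mule1 ?sqrtr_gt0//.
  - by apply/measurable_EFinP; exact: measurable_rho.
  - by move=> z _; rewrite lee_fin rho_ge0.
  - by rewrite lee_fin ltW.
set E := (\int[gaussC]_z _)%E.
have E0 : (0 <= E)%E by exact: integral_ge0.
have mu_rho u : measurable_fun setT (fun z => (u * rho 0 (Num.sqrt u) z)%:E).
  apply/measurable_EFinP; apply: measurable_funM => //; exact: measurable_rho.
have upper u : 1 < u -> (1 + (1 - u^-1)%:E * E <= u%:E)%E.
  move=> u1; have u0 : 0 < u by rewrite (lt_trans ltr01).
  have t0 : 0 <= 1 - u^-1 by rewrite subr_ge0 invf_le1 ?ltW.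
  rewrite -(int_rho _ u0) -ge0_integralZl//.
  rewrite -[X in (X + _)%E](integral_cst_probability _ _ _ gaussC).
  rewrite -ge0_integralD//; last 2 first.
  - by move=> z _; rewrite mule_ge0// lee_fin.
  - exact: measurable_funeM.
  apply: ge0_le_integral => //.
  - by move=> z _; rewrite -EFinM -EFinD lee_fin addr_ge0// mulr_ge0// nsq_ge0.
  - by apply: emeasurable_funD => //; exact: measurable_funeM.
  - by move=> z _; rewrite /= -EFinM -EFinD lee_fin rho0.
have lower u : 0 < u < 1 -> (1 <= u%:E + (u^-1 - 1)%:E * E)%E.
  move=> /andP[u0 u1].
  have t0 : 0 <= u^-1 - 1 by rewrite subr_ge0 invf_ge1 ?ltW.
  rewrite -[leLHS](integral_cst_probability _ _ _ gaussC).
  rewrite -(int_rho _ u0) -ge0_integralZl// -ge0_integralD//; last 3 first.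
  - by move=> z _; rewrite lee_fin mulr_ge0 ?rho_ge0 ?ltW.
  - by move=> z _; rewrite mule_ge0// lee_fin.
  - exact: measurable_funeM.
  apply: ge0_le_integral => //.
  - by apply: emeasurable_funD => //; exact: measurable_funeM.
  - move=> z _; rewrite /= -EFinM -EFinD lee_fin.
    by have := rho0 _ z u0; rewrite !mulrBl !mul1r; lra.
(* The bound at [u = 2] excludes an infinite second moment. *)
have Efin : E \is a fin_num.
  rewrite ge0_fin_numE//; move: (upper 2 (ltr1n _ 2)) E0; clear.
  case: E => [e _ _|+ _|//]; first exact: ltry.
  by rewrite gt0_muley// lte_fin subr_gt0 invf_lt1// ltr1n.
move: upper lower E0; rewrite -(fineK Efin); set e := fine E.
move=> upper lower e0; congr EFin; apply/eqP; rewrite eq_le; apply/andP; split.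
  (* This [u] lies strictly between 1 and [e], whereas [upper] gives [e <= u]. *)
  rewrite leNgt; apply/negP => e1; pose u := (1 + e) / 2.
  have u1 : 1 < u by rewrite /u; lra.
  have u0 : 0 < u by rewrite /u; lra.
  have := upper u u1; rewrite -EFinM -EFinD lee_fin.
  have -> : 1 + (1 - u^-1) * e = 1 + (u - 1) * (e / u).
    by field; exact: lt0r_neq0.
  suff : (u - 1) * 1 < (u - 1) * (e / u) by lra.
  rewrite ltr_pM2l ?subr_gt0// ltr_pdivlMr// mul1r /u; lra.
rewrite leNgt; apply/negP => e1; pose u := (1 + e) / 2.
have u1 : u < 1 by rewrite /u; lra.
have u0 : 0 < u by move: e0; rewrite /u lee_fin; lra.
have u01 : 0 < u < 1 by rewrite u0 u1.
have := lower u u01; rewrite -EFinM -EFinD lee_fin.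
have -> : u + (u^-1 - 1) * e = u + (1 - u) * (e / u).
  by field; exact: lt0r_neq0.
suff : (1 - u) * (e / u) < (1 - u) * 1 by lra.
rewrite ltr_pM2l ?subr_gt0// ltr_pdivrMr// mul1r /u; lra.
Qed.

Lemma gaussC_opp (f : C -> \bar R) :
  measurable_fun setT f -> (forall z, 0 <= f z)%E ->
  (\int[gaussC]_z f (- z)%R = \int[gaussC]_z f z)%E.
Proof.
move=> mf f0.
have mxy : measurable_fun setT
    (fun p : measurableTypeR R * measurableTypeR R => f (p.1 +i* p.2)%C).
  exact: (measurableT_comp mf).
have mopp : measurable_fun setT (fun z : C => - z).
  by apply/measurable_fun_ReIm; split; [
    rewrite (_ : (fun t => _) = fun t => - complex.Re t);
      [apply: measurableT_comp => //; exact: measurable_Re|apply/funext => -[]]|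
    rewrite (_ : (fun t => _) = fun t => - complex.Im t);
      [apply: measurableT_comp => //; exact: measurable_Im|apply/funext => -[]]].
rewrite [RHS]ge0_integral_gaussC// [LHS]ge0_integral_gaussC; last 2 first.
- exact: (measurableT_comp mf).
- by [].
rewrite -[RHS]gauss1_opp; last 2 first.
- by apply: (measurable_fun_fubini_tonelli_F (m2 := gauss1) _ mxy) => p.
- by move=> x; apply: integral_ge0.
apply: eq_integral => x _; rewrite -[RHS]gauss1_opp//.
exact: (measurableT_comp mxy (pair1_measurable _)).
Qed.

(** Adding the integrals over [z] and [- z], which are equal, brings in the parallelogram law; the
    cross term, which has no sign, is never integrated. *)
Lemma integral_nsq_affine (a b : C) :
  (\int[gaussC]_z (nsq (a + b * z))%:E = (nsq a + nsq b)%:E)%E.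
Proof.
have m1 : measurable_fun setT (fun z : C => (nsq (a + b * z))%:E).
  apply/measurable_EFinP; apply: measurable_nsq; apply: measurable_Cadd => //.
  exact: measurable_Cmul.
have m2 : measurable_fun setT (fun z : C => (nsq (a + b * (- z)))%:E).
  rewrite (_ : (fun z => _) = fun z => (nsq (a + (- b) * z))%:E); last first.
    by apply/funext => z; rewrite mulNr mulrN.
  apply/measurable_EFinP; apply: measurable_nsq; apply: measurable_Cadd => //.
  exact: measurable_Cmul.
have m3 : measurable_fun setT (fun z : C => (nsq z)%:E).
  by apply/measurable_EFinP; exact: measurable_nsq.
have nsq0 (z : C) : (0 <= (nsq z)%:E)%E by rewrite lee_fin nsq_ge0.
set I := (\int[gaussC]_z _)%E.
have : (I + I = (2 * (nsq a + nsq b))%:E)%E.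
  rewrite {2}/I -gaussC_opp// -ge0_integralD//.
  under eq_integral => z _.
    rewrite mulrN -EFinD.
    rewrite (_ : _ + _ = 2 * nsq a + (2 * nsq b) * nsq z); last first.
      by rewrite nsq_parallelogram nsqM mulrA.
    rewrite EFinD EFinM [in X in (_ + X)%E]EFinM; over.
  rewrite ge0_integralD//; last 3 first.
  - by move=> z _; rewrite -EFinM lee_fin mulr_ge0// nsq_ge0.
  - by move=> z _; rewrite -EFinM lee_fin !mulr_ge0// nsq_ge0.
  - exact: measurable_funeM.
  rewrite integral_cst_probability ge0_integralZl//; last first.
    by rewrite lee_fin mulr_ge0// nsq_ge0.
  rewrite integral_nsq_gaussC mule1 -EFinM.
  by rewrite -EFinD; congr EFin; lra.
have : (0 <= I)%E by exact: integral_ge0.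
case: I => [r _|//|//]; rewrite -EFinD => -[h]; congr EFin; lra.
Qed.

End complex_gaussian.

(** * Product powers of a probability, on tuples *)

Section product_power.
Context d (X : measurableType d) (R : realType) (nu : probability X R).

Let cons_pair n (p : X * n.-tuple X) : n.+1.-tuple X :=
  [the n.+1.-tuple X of p.1 :: p.2].

Let measurable_cons_pair n : measurable_fun setT (@cons_pair n).
Proof. exact: measurable_cons. Qed.

HB.instance Definition _ n := isMeasurableFun.Build _ _ _ _ _
  (@measurable_cons_pair n).

Fixpoint pow_prob n : probability (n.-tuple X) R :=
  if n is m.+1 then distribution (nu \x pow_prob m)%E (@cons_pair m)
  else \d_[tuple].

Lemma ge0_integral_pow_probS n (f : n.+1.-tuple X -> \bar R) :
  measurable_fun setT f -> (forall z, 0 <= f z)%E ->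
  (\int[pow_prob n.+1]_z f z =
   \int[nu]_x \int[pow_prob n]_z f [the n.+1.-tuple X of x :: z])%E.
Proof.
move=> mf f0; rewrite ge0_integral_distribution// fubini_tonelli1//.
- exact: measurableT_comp.
- by move=> z; exact: f0.
Qed.

Lemma measurable_mktuple n d' (T : measurableType d') (f : 'I_n -> T -> X) :
  (forall i, measurable_fun setT (f i)) ->
  measurable_fun setT (fun t => [tuple f i t | i < n]).
Proof.
move=> mf; apply/measurable_fun_tnthP => i /=.
rewrite (_ : _ \o _ = f i)//; apply/funext => t /=.
by rewrite tnth_mktuple.
Qed.

Lemma measurable_prod_tnth n (r : 'I_n -> X -> R) :
  (forall i, measurable_fun setT (r i)) ->
  measurable_fun setT (fun z : n.-tuple X => \prod_i r i (tnth z i)).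
Proof.
move=> mr; apply: measurable_prod => i _.
by apply: (measurableT_comp (mr i)); exact: measurable_tnth.
Qed.

(** Tonelli, one coordinate at a time. The maps used later are [m i + s i * z], with densities
    [rho (m i) (s i)]. *)
Lemma pow_prob_change n (phi : 'I_n -> X -> X) (r : 'I_n -> X -> R) :
  (forall i, measurable_fun setT (phi i)) ->
  (forall i, measurable_fun setT (r i)) -> (forall i x, 0 <= r i x) ->
  (forall i f, measurable_fun setT f -> (forall x, 0 <= f x)%E ->
    (\int[nu]_x f (phi i x) = \int[nu]_x (f x * (r i x)%:E))%E) ->
  forall f, measurable_fun setT f -> (forall z, 0 <= f z)%E ->
  (\int[pow_prob n]_z f [tuple phi i (tnth z i) | i < n] =
   \int[pow_prob n]_z (f z * (\prod_i r i (tnth z i))%:E))%E.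
Proof.
move=> mphi mr r0 phir; elim: n phi r mphi mr r0 phir => [|n ih] phi r mphi mr r0 phir f mf f0.
  apply: eq_integral => z _; rewrite big_ord0 mule1; congr f.
  by apply: eq_from_tnth => -[].
have mcons : measurable_fun setT (fun p : X * n.-tuple X => f (@cons_pair n p)).
  exact: measurableT_comp.
have mtup : measurable_fun setT
    (fun z : n.+1.-tuple X => [tuple phi i (tnth z i) | i < n.+1]).
  apply: measurable_mktuple => i; apply: (measurableT_comp (mphi i)).
  exact: measurable_tnth.
have mfr : measurable_fun setT
    (fun z : n.+1.-tuple X => f z * (\prod_i r i (tnth z i))%:E)%E.
  by apply: emeasurable_funM => //; apply/measurable_EFinP; exact: measurable_prod_tnth.
rewrite [LHS]ge0_integral_pow_probS; last 2 first.
- exact: (measurableT_comp mf).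
- by [].
rewrite [RHS]ge0_integral_pow_probS; last 2 first.
- exact: mfr.
- by move=> z; rewrite mule_ge0// lee_fin prodr_ge0.
have tupE x (z : n.-tuple X) :
    [tuple phi i (tnth [the n.+1.-tuple X of x :: z] i) | i < n.+1] =
    [the n.+1.-tuple X of phi ord0 x :: [tuple phi (lift ord0 i) (tnth z i) | i < n]].
  apply: eq_from_tnth => i; rewrite tnth_mktuple.
  by case: (unliftP ord0 i) => [j|] ->; rewrite ?tnthS ?tnth_mktuple// !tnth0.
have msec y : measurable_fun setT
    (fun z : n.-tuple X => f [the n.+1.-tuple X of y :: z]).
  by apply: (measurableT_comp mf); exact: measurable_cons.
pose F x := (\int[pow_prob n]_z (f [the n.+1.-tuple X of x :: z] *
   (\prod_i r (lift ord0 i) (tnth z i))%:E))%E.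
have mF' : measurable_fun setT (fun p : X * n.-tuple X =>
    f (@cons_pair n p) * (\prod_i r (lift ord0 i) (tnth p.2 i))%:E)%E.
  apply: emeasurable_funM => //; apply/measurable_EFinP.
  apply: (measurableT_comp (measurable_prod_tnth _ (fun i => r (lift ord0 i)) _)) => //.
have F'0 p : (0 <= f (@cons_pair n p) * (\prod_i r (lift ord0 i) (tnth p.2 i))%:E)%E.
  by rewrite mule_ge0// lee_fin prodr_ge0.
have mF : measurable_fun setT F.
  exact: (measurable_fun_fubini_tonelli_F (m2 := pow_prob n) _ mF').
transitivity (\int[nu]_x F (phi ord0 x))%E.
  apply: eq_integral => x _; under eq_integral do rewrite tupE.
  exact: (ih (fun i => phi (lift ord0 i)) (fun i => r (lift ord0 i))
    (fun i => mphi _) (fun i => mr _) (fun i => r0 _) (fun i => phir _)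
    (fun z => f [the n.+1.-tuple X of phi ord0 x :: z]) (msec _) (fun z => f0 _)).
rewrite phir//; last by move=> x; apply: integral_ge0 => z _; exact: (F'0 (x, z)).
apply: eq_integral => x _; rewrite /F -ge0_integralZr//; last 3 first.
- exact: (measurableT_comp mF' (pair1_measurable x)).
- by move=> z _; exact: (F'0 (x, z)).
- by rewrite lee_fin.
apply: eq_integral => z _; rewrite -muleA; congr (_ * _)%E.
rewrite -EFinM big_ord_recl tnth0 mulrC; congr (_ * _)%:E.
by apply: eq_bigr => i _; rewrite tnthS.
Qed.

Lemma integral_pow_prob_tnth n (i : 'I_n) (f : X -> \bar R) :
  measurable_fun setT f -> (forall x, 0 <= f x)%E ->
  (\int[pow_prob n]_z f (tnth z i) = \int[nu]_x f x)%E.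
Proof.
move=> mf f0; elim: n i => [|n ih] i; first by case: i.
rewrite ge0_integral_pow_probS; last 2 first.
- by apply: (measurableT_comp mf); exact: measurable_tnth.
- by [].
case: (unliftP ord0 i) => [j|] ->.
  under eq_integral do under eq_integral do rewrite tnthS.
  under eq_integral do rewrite ih.
  exact: integral_cst_probability.
apply: eq_integral => x _; under eq_integral do rewrite tnth0.
exact: integral_cst_probability.
Qed.

Lemma measurable_box n (A : 'I_n -> set X) : (forall i, measurable (A i)) ->
  measurable [set z : n.-tuple X | forall i, A i (tnth z i)].
Proof.
move=> mA; rewrite (_ : [set _ | _] =
    \bigcap_(i in [set: 'I_n]) ((@tnth n X)^~ i @^-1` A i)); last first.
  by apply/seteqP; split=> z /= h i; [move=> _; exact: h|exact: h].
apply: fin_bigcap_measurable => // i _.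
by rewrite -[X in measurable X]setTI; apply: measurable_tnth.
Qed.

Lemma pow_prob_box n (A : 'I_n -> set X) : (forall i, measurable (A i)) ->
  pow_prob n [set z | forall i, A i (tnth z i)] = (\prod_i nu (A i))%E.
Proof.
elim: n A => [|n ih] A mA.
  rewrite big_ord0 /= diracE mem_set//= => -[]//.
have mbox := measurable_box n (fun i => A (lift ord0 i)) (fun i => mA _).
rewrite big_ord_recl -(ih (fun i => A (lift ord0 i)))//.
rewrite -(product_measure1E nu (pow_prob n) (mA ord0) mbox).
congr ((nu \x pow_prob n)%E _); apply/seteqP; split => -[x z] /=.
  move=> h; split; first by have := h ord0; rewrite tnth0.
  by move=> i; have := h (lift ord0 i); rewrite tnthS.
by move=> [h0 h] i; case: (unliftP ord0 i) => [j|] ->; rewrite ?tnthS ?tnth0.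
Qed.

(** Boxes are stable under intersection and generate the sigma-algebra. This is how the law of a
    block of noise is identified. *)
Lemma pow_prob_unique n (Q : probability (n.-tuple X) R) :
  (forall A : 'I_n -> set X, (forall i, measurable (A i)) ->
    Q [set z | forall i, A i (tnth z i)] = (\prod_i nu (A i))%E) ->
  forall B, measurable B -> Q B = pow_prob n B.
Proof.
move=> QE B mB.
pose G : set (set (n.-tuple X)) := [set B | exists2 A : 'I_n -> set X,
  (forall i, measurable (A i)) & B = [set z | forall i, A i (tnth z i)]].
apply: (measure_unique G (fun=> setT)) => //.
- apply/seteqP; split; last first.
    apply: smallest_sub; first exact: sigma_algebra_measurable.
    by move=> _ [A mA ->]; exact: measurable_box.
  apply: smallest_sub; first exact: smallest_sigma_algebra.
  move=> C; rewrite -bigcup_seq => -[i _] [D mD <-]; apply: sub_sigma_algebra.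
  exists (fun j => if j == i then D else setT); first by move=> j; case: ifP.
  apply/seteqP; split => z /=.
    by move=> [_ zD] j; case: eqP => // ->.
  by move=> /(_ i); rewrite eqxx.
- move=> _ _ [A mA ->] [A' mA' ->]; exists (fun i => A i `&` A' i).
    by move=> i; exact: measurableI.
  apply/seteqP; split => z /=; first by move=> [h h'] i; split.
  by move=> h; split => i; have [] := h i.
- move=> _; exists (fun=> setT) => //.
  by apply/seteqP; split.
- by rewrite bigcup_const//; exists 0%N.
- by move=> _ [A mA ->]; etransitivity; [exact: QE|exact/esym/pow_prob_box].
- by move=> _; rewrite /= probability_setT ltry.
Qed.

End product_power.

Lemma measurable_fun_inv_gt0 d (T : measurableType d) (R : realType) (f : T -> R) :
  (forall t, 0 < f t) -> measurable_fun setT f ->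
  measurable_fun setT (fun t => (f t)^-1).
Proof.
move=> f0 mf; rewrite (_ : (fun t => _) = fun t => expR (- ln (f t))).
  apply: measurableT_comp => //; apply: measurableT_comp => //.
  by apply: measurableT_comp mf; exact: measurable_ln.
by apply/funext => t; rewrite expRN lnK ?posrE.
Qed.

(** * Vectors of independent complex Gaussians *)

Section gaussian_vector.
Context {R : realType}.
Notation C := (R[i]).
Variable n : nat.

Definition gaussn : probability (n.-tuple C) R := pow_prob _ _ _ gaussC n.

Definition rhon (m : 'I_n -> C) (s : 'I_n -> R) (z : n.-tuple C) : R :=
  \prod_i rho (m i) (s i) (tnth z i).

Lemma rhon_gt0 m s z : (forall i, 0 < s i) -> 0 < rhon m s z.
Proof. by move=> s0; apply: prodr_gt0 => i _; exact: rho_gt0. Qed.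

Lemma rhon_ge0 m s z : 0 <= rhon m s z.
Proof. by apply: prodr_ge0 => i _; exact: rho_ge0. Qed.

Lemma measurable_rhon d (T : measurableType d) (m : T -> 'I_n -> C) s
    (z : T -> n.-tuple C) :
  (forall i, measurable_fun setT (m^~ i)) -> measurable_fun setT z ->
  measurable_fun setT (fun t => rhon (m t) s (z t)).
Proof.
move=> mm mz; apply: measurable_prod => i _; apply: measurable_rho => //.
exact: (measurableT_comp (measurable_tnth _) mz).
Qed.

Lemma gaussn_affine (m : 'I_n -> C) (s : 'I_n -> R) (f : n.-tuple C -> \bar R) :
  (forall i, 0 < s i) ->
  measurable_fun setT f -> (forall z, 0 <= f z)%E ->
  (\int[gaussn]_z f [tuple (m i + (s i)%:C%C * tnth z i)%R | i < n] =
   \int[gaussn]_z (f z * (rhon m s z)%:E))%E.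
Proof.
move=> s0 mf f0.
apply: (pow_prob_change _ _ _ gaussC n (fun i z => m i + (s i)%:C%C * z)
  (fun i => rho (m i) (s i))) => //.
- by move=> i; apply: measurable_Cadd => //; exact: measurable_Cmul.
- by move=> i; exact: measurable_rho.
- by move=> i z; exact: rho_ge0.
- by move=> i g mg g0; exact: gaussC_affine.
Qed.

Lemma gaussn_shift (m : 'I_n -> C) (f : n.-tuple C -> \bar R) :
  measurable_fun setT f -> (forall z, 0 <= f z)%E ->
  (\int[gaussn]_z f [tuple (m i + tnth z i)%R | i < n] =
   \int[gaussn]_z (f z * (rhon m (fun=> 1%R) z)%:E))%E.
Proof.
move=> mf f0; rewrite -gaussn_affine//; apply: eq_integral => z _; congr f.
by apply: eq_from_tnth => i; rewrite !tnth_mktuple mul1r.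
Qed.

Lemma integral_rhon m s : (forall i, 0 < s i) ->
  (\int[gaussn]_z (rhon m s z)%:E = 1)%E.
Proof.
move=> s0; under eq_integral do rewrite -[X in X%:E]mul1r EFinM.
rewrite -(gaussn_affine m s (cst 1%E))//.
exact: integral_cst_probability.
Qed.

(* Bayes' rule for the joint law of [z] and [t = q z + s u]. *)
Lemma rho_bayes (q z t : C) (s : R) : 0 < s -> nsq q + s ^+ 2 = 1 ->
  rho (q * z) s t = rho (conjc q * t) s z.
Proof.
move=> s0 qs; rewrite /rho; congr (_ * expR _).
have s2 : s ^+ 2 != 0 by rewrite lt0r_neq0// exprn_gt0.
apply: (mulIf s2); rewrite !mulrBl !divfK//.
have -> : s ^+ 2 = 1 - nsq q by rewrite -qs; ring.
case: q z t {qs} => [a b] [x y] [v w]; rewrite /nsq /=; ring.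
Qed.

(** After Tonelli, [rho_bayes] turns the likelihood of the output given [z] into a probability
    density in [z], which integrates to 1. *)
Lemma gaussn_rotation (q : 'I_n -> C) (s : 'I_n -> R) (f : n.-tuple C -> \bar R) :
  (forall i, 0 < s i) -> (forall i, nsq (q i) + s i ^+ 2 = 1) ->
  measurable_fun setT f -> (forall z, 0 <= f z)%E ->
  (\int[gaussn]_z \int[gaussn]_u
     f [tuple (q i * tnth z i + (s i)%:C%C * tnth u i)%R | i < n] =
   \int[gaussn]_z f z)%E.
Proof.
move=> s0 qs mf f0.
under eq_integral do rewrite (gaussn_affine _ s f)//.
have mrho : measurable_fun setT (fun p : n.-tuple C * n.-tuple C =>
    rhon (fun i => q i * tnth p.1 i) s p.2).
  apply: measurable_rhon => // i; apply: measurable_Cmul => //.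
  exact: (measurableT_comp (measurable_tnth _) measurable_fst).
have mg : measurable_fun setT (fun p : n.-tuple C * n.-tuple C =>
    f p.2 * (rhon (fun i => q i * tnth p.1 i) s p.2)%:E)%E.
  apply: emeasurable_funM; last exact/measurable_EFinP.
  exact: (measurableT_comp mf measurable_snd).
have g0 p : (0 <= f p.2 * (rhon (fun i => q i * tnth p.1 i) s p.2)%:E)%E.
  by rewrite mule_ge0// lee_fin rhon_ge0.
etransitivity; first exact: (fubini_tonelli (m1 := gaussn) (m2 := gaussn) _ mg g0).
apply: eq_integral => t _ /=.
rewrite ge0_integralZl//; last 2 first.
- apply/measurable_EFinP; apply: measurable_rhon => // i.
  by apply: measurable_Cmul => //; exact: measurable_tnth.
- by move=> z _; rewrite lee_fin rhon_ge0.
rewrite -[RHS]mule1; congr (_ * _)%E.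
etransitivity; last exact: (integral_rhon (fun i => conjc (q i) * tnth t i) s s0).
apply: eq_integral => z _; congr EFin; apply: eq_bigr => i _.
exact: rho_bayes.
Qed.

Lemma integral_nsq_gaussn (i : 'I_n) : (\int[gaussn]_z (nsq (tnth z i))%:E = 1)%E.
Proof.
rewrite (integral_pow_prob_tnth _ _ _ gaussC n i (fun z => (nsq z)%:E)).
- exact: integral_nsq_gaussC.
- by apply/measurable_EFinP; exact: measurable_nsq.
- by move=> z; rewrite lee_fin nsq_ge0.
Qed.

Lemma integral_nsq_affine_gaussn (a b : C) (i : 'I_n) :
  (\int[gaussn]_z (nsq (a + b * tnth z i))%:E = (nsq a + nsq b)%:E)%E.
Proof.
rewrite (integral_pow_prob_tnth _ _ _ gaussC n i (fun z => (nsq (a + b * z))%:E)).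
- exact: integral_nsq_affine.
- apply/measurable_EFinP; apply: measurable_nsq; apply: measurable_Cadd => //.
  exact: measurable_Cmul.
- by move=> z; rewrite lee_fin nsq_ge0.
Qed.

Lemma rho_ratio (m m' z : C) (s s' : R) : 0 < s -> 0 < s' ->
  rho m s z / rho m' s' z =
  expR (ln (s' ^+ 2) - ln (s ^+ 2) + nsq (z - m') / s' ^+ 2
        - nsq (z - m) / s ^+ 2).
Proof.
move=> s0 s'0; rewrite /rho !expRD !expRN !lnK ?posrE ?exprn_gt0//.
field; rewrite !gt_eqF ?expR_gt0//.
Qed.

End gaussian_vector.

Section ge0_EFin.
Context d (T : measurableType d) (R : realType) (mu : {measure set T -> \bar R}).

Lemma ge0_integral_EFinD (f g : T -> R) :
  (forall t, 0 <= f t) -> (forall t, 0 <= g t) ->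
  measurable_fun setT f -> measurable_fun setT g ->
  (\int[mu]_t (f t + g t)%:E = \int[mu]_t (f t)%:E + \int[mu]_t (g t)%:E)%E.
Proof.
move=> f0 g0 mf mg; under eq_integral do rewrite EFinD.
by rewrite ge0_integralD//; try (by move=> t _; rewrite lee_fin);
  exact/measurable_EFinP.
Qed.

Lemma ge0_integral_EFinZ (k : R) (f : T -> R) :
  0 <= k -> (forall t, 0 <= f t) -> measurable_fun setT f ->
  (\int[mu]_t (k * f t)%:E = k%:E * \int[mu]_t (f t)%:E)%E.
Proof.
move=> k0 f0 mf; under eq_integral do rewrite EFinM.
by rewrite ge0_integralZl//; [exact/measurable_EFinP|move=> t _; rewrite lee_fin].
Qed.

Lemma ge0_integral_EFin_sum (I : finType) (f : I -> T -> R) :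
  (forall i t, 0 <= f i t) -> (forall i, measurable_fun setT (f i)) ->
  (\int[mu]_t (\sum_i f i t)%:E = \sum_i \int[mu]_t (f i t)%:E)%E.
Proof.
move=> f0 mf; under eq_integral do rewrite -sumEFin.
rewrite ge0_integral_sum// => i; first exact/measurable_EFinP.
by move=> t _; rewrite lee_fin.
Qed.

End ge0_EFin.

Section avg.
Context {R : realType} {W : finType}.

Definition avg (f : W -> R) : R := (\sum_w f w) / #|W|%:R.

End avg.

(** * Converse for fixed channels *)

Section core_inequality.
Context {R : realType}.
Notation C := (R[i]).
Variables (n : nat) (W1 W2 : finType) (w10 : W1) (w20 : W2).
Variables (h11 h12 h22 : 'I_n -> C) (x1 : W1 -> 'I_n -> C) (x2 : W2 -> 'I_n -> C).
Hypothesis weak : forall i, nsq (h12 i) < nsq (h22 i).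
Hypothesis x2_centered : forall i, \sum_w x2 w i = 0.
Variables (D1 : n.-tuple C -> W1) (D2 : W1 -> n.-tuple C -> W2).
Hypotheses (mD1 : forall w, measurable [set y | D1 y = w])
           (mD2 : forall w1 w, measurable [set y | D2 w1 y = w]).

Notation gauss := (@gaussn R n).
Notation tup := (n.-tuple C).

Let a w i := h11 i * x1 w i.
Let b w i := h12 i * x2 w i.
Let c w i := h22 i * x2 w i.

Let N1 : R := #|W1|%:R.
Let N2 : R := #|W2|%:R.

Let P1 i := avg (fun w => nsq (x1 w i)).
Let P2 i := avg (fun w => nsq (x2 w i)).

Let q i := conjc (h12 i / h22 i).
Let sigma i := Num.sqrt (1 - nsq (q i)).
(** [v] is the second moment of the output of receiver 1, and [k] the ratio of the second moments of
    the outputs of receivers 2 and 1 without the signal of user 1. Their logarithms add up to the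
    sum rate in nats. *)
Let v i := 1 + nsq (h11 i) * P1 i + nsq (h12 i) * P2 i.
Let k i := (1 + nsq (h22 i) * P2 i) / (1 + nsq (h12 i) * P2 i).
Let tau i := sigma i ^+ 2 * k i.
(** Coefficient of the best linear estimate of the output of receiver 2 from that of receiver 1,
    both without user 1: the covariance [h22 * conjc h12 * P2 + q] equals [q * (1 + nsq h22 * P2)]
    for this [q], and dividing by [1 + nsq h12 * P2] leaves [k * q]. *)
Let alpha i := (k i)%:C%C * q i.

Let N1_gt0 : 0 < N1. Proof. by rewrite ltr0n; apply/card_gt0P; exists w10. Qed.
Let N2_gt0 : 0 < N2. Proof. by rewrite ltr0n; apply/card_gt0P; exists w20. Qed.

Let P1_ge0 i : 0 <= P1 i.
Proof. by rewrite divr_ge0// sumr_ge0// => w _; exact: nsq_ge0. Qed.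

Let P2_ge0 i : 0 <= P2 i.
Proof. by rewrite divr_ge0// sumr_ge0// => w _; exact: nsq_ge0. Qed.

Let h22_gt0 i : 0 < nsq (h22 i).
Proof. exact: le_lt_trans (nsq_ge0 _) (weak i). Qed.

Let h22_neq0 i : h22 i != 0.
Proof.
by apply/eqP => h0; have := h22_gt0 i; rewrite h0 /nsq /= expr0n addr0 ltxx.
Qed.

Let nsq_q i : nsq (q i) * nsq (h22 i) = nsq (h12 i).
Proof.
have -> : nsq (q i) = nsq (h12 i / h22 i).
  by rewrite /q; case: (h12 i / h22 i) => x y; rewrite /nsq /= sqrrN.
by rewrite -nsqM divfK.
Qed.

Let q_lt1 i : nsq (q i) < 1.
Proof. by rewrite -(ltr_pM2r (h22_gt0 i)) nsq_q mul1r. Qed.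

Let sigma_gt0 i : 0 < sigma i.
Proof. by rewrite sqrtr_gt0 subr_gt0. Qed.

Let sigma2 i : sigma i ^+ 2 = 1 - nsq (q i).
Proof. by rewrite sqr_sqrtr// subr_ge0 ltW. Qed.

Let v_ge1 i : 1 <= v i.
Proof. by rewrite /v -addrA lerDl addr_ge0// mulr_ge0// nsq_ge0. Qed.

Let den_gt0 i : 0 < 1 + nsq (h12 i) * P2 i.
Proof. by rewrite ltr_pwDl// mulr_ge0// nsq_ge0. Qed.

Let k_ge1 i : 1 <= k i.
Proof. by rewrite ler_pdivlMr// mul1r lerD2l ler_wpM2r// ltW. Qed.

Let tau_gt0 i : 0 < tau i.
Proof. by rewrite mulr_gt0 ?exprn_gt0// (lt_le_trans ltr01). Qed.

Let v_gt0 i : 0 < v i.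
Proof. exact: lt_le_trans ltr01 (v_ge1 i). Qed.

(* The error [h22 x2 - alpha h12 x2 + (q - alpha) z + sigma u] of the linear
   estimate of the unfaded output from the faded one has variance [tau]. *)
Let mmse i :
  nsq (h22 i - alpha i * h12 i) * P2 i + nsq (q i - alpha i) + sigma i ^+ 2 = tau i.
Proof.
have qh : q i * h12 i = (nsq (q i))%:C%C * h22 i.
  have -> : h12 i = (h12 i / h22 i) * h22 i by rewrite divfK.
  rewrite /q; case: (h12 i / h22 i) => x y; case: (h22 i) => e f.
  rewrite /nsq /=; apply/eqP; rewrite eq_complex /=; apply/andP; split; apply/eqP; ring.
have -> : h22 i - alpha i * h12 i = (1 - k i * nsq (q i))%:C%C * h22 i.
  rewrite /alpha -mulrA qh; case: (h22 i) => e f.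
  by apply/eqP; rewrite eq_complex /=; apply/andP; split; apply/eqP; ring.
have -> : q i - alpha i = (1 - k i)%:C%C * q i.
  rewrite /alpha; case: (q i) => e f.
  by apply/eqP; rewrite eq_complex /=; apply/andP; split; apply/eqP; ring.
have nsqr (r : R) : nsq r%:C%C = r ^+ 2 by rewrite /nsq /= expr0n addr0.
rewrite !nsqM !nsqr /tau sigma2 /k -nsq_q.
have := den_gt0 i; rewrite -nsq_q => d0.
by field; rewrite lt0r_neq0.
Qed.

(** The messages are independent, so the cross term is a product of two means, and the mean of [x2]
    is zero. *)
Let sum_centered (A B : C) i :
  \sum_w1 \sum_w2 nsq (A * x1 w1 i + B * x2 w2 i) =
  N1 * N2 * (nsq A * P1 i + nsq B * P2 i).
Proof.
have nsqD (z w : C) : nsq (z + w) = nsq z + nsq w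
    + 2 * (complex.Re z * complex.Re w + complex.Im z * complex.Im w).
  by case: z w => [? ?] [? ?]; rewrite /nsq /=; ring.
have ReD : {morph @complex.Re R : z w / z + w} by move=> [? ?] [? ?].
have ImD : {morph @complex.Im R : z w / z + w} by move=> [? ?] [? ?].
have Re0 : complex.Re (0 : C) = 0 by [].
have Im0 : complex.Im (0 : C) = 0 by [].
have B0 : \sum_w2 B * x2 w2 i = 0 by rewrite -mulr_sumr x2_centered mulr0.
have cross z : \sum_w2 2 * (complex.Re z * complex.Re (B * x2 w2 i)
    + complex.Im z * complex.Im (B * x2 w2 i)) = 0.
  rewrite -mulr_sumr big_split /= -!mulr_sumr -(big_morph _ ReD Re0).
  by rewrite -(big_morph _ ImD Im0) B0 /= !mulr0 addr0 mulr0.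
have inner z : \sum_w2 nsq (z + B * x2 w2 i) = N2 * nsq z + nsq B * (N2 * P2 i).
  under eq_bigr do rewrite nsqD.
  rewrite big_split big_split /= sumr_const -[_ *+ _]mulr_natl -addrA; congr (_ + _).
  rewrite cross addr0.
  under eq_bigr do rewrite nsqM.
  rewrite -mulr_sumr /P2 /avg; congr (_ * _); rewrite mulrC divfK//.
  exact: lt0r_neq0.
under eq_bigr do rewrite inner nsqM.
rewrite big_split /= sumr_const -[_ *+ _]mulr_natl -!mulr_sumr /P1 /avg -/N1 -/N2.
field; exact: lt0r_neq0.
Qed.

Let phi (W : finType) (w w' : W) : R := if w' == w then #|W|%:R else 1.

(** The decoded message contributes [#|W|] and each other one 1. This is the source of the factor 2
    in the means of [U1] and [U2]. *)
Let sum_phi (W : finType) (w' : W) : \sum_w phi _ w w' <= 2 * #|W|%:R.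
Proof.
rewrite (bigD1 w')//= /phi eqxx mulrDl mul1r lerD2l.
rewrite (eq_bigr (fun=> 1)); last by move=> w /negbTE; rewrite eq_sym => ->.
rewrite sumr_const -[_ *+ _]/(_%:R) ler_nat; apply: subset_leq_card.
exact/fintype.subsetP.
Qed.

Let measurable_phi (W : finType) (D : tup -> W) (w : W) :
  measurable [set y | D y = w] -> measurable_fun setT (fun y => phi _ w (D y)).
Proof.
move=> mD; rewrite (_ : (fun y => _) =
    fun y => 1 + (#|W|%:R - 1) * \1_[set y | D y = w] y).
  by apply: measurable_funD => //; apply: measurable_funM.
apply/funext => y; rewrite /phi indicE.
have [<-|Dw] := eqVneq (D y) w; first by rewrite mem_set//= mulr1 addrC subrK.
by rewrite memNset ?mulr0 ?addr0//=; exact/eqP.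
Qed.

Let phi_gt0 (W : finType) (w w' : W) : 0 < phi _ w w'.
Proof. by rewrite /phi; case: ifP => // _; rewrite ltr0n; apply/card_gt0P; exists w. Qed.

(* [S] and [T] are the outputs of receivers 1 and 2 without the signal of user 1.
   The coupling of their noises only matters through [S] being a degraded version
   of [T]: as [b = conjc q * c], by [rho_bayes] the law of [S] given [T] does not
   depend on [w2]. *)
Let S w2 (z : tup) : tup := [tuple b w2 i + tnth z i | i < n].
Let T w2 (z u : tup) : tup :=
  [tuple (c w2 i + q i * tnth z i) + (sigma i)%:C%C * tnth u i | i < n].
(** Conditional mean of [T w2] given [S w2 = s]: once [w2] is fixed, [s] reveals the noise
    [z = s - b w2]. *)
Let mu w2 (s : tup) i := c w2 i + q i * (tnth s i - b w2 i).
Let Y w1 (s : tup) : tup := [tuple a w1 i + tnth s i | i < n].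

(** Density of the true law of [S], a mixture over the codewords of user 2. *)
Let srel (s : tup) := (\sum_w2 rhon _ (b w2) (fun=> 1) s) / N2.

(* [U1] and [U2] replace the true likelihoods of [S] and of [T] given [S] by those
   of Gaussian signals of the same second moments, and reward a correct decision by
   the factor [phi]. Both have mean at most 2, and [srel] cancels in [U1 * U2]. *)
Let U1 w1 s := rhon _ (fun i => - a w1 i) (fun i => Num.sqrt (v i)) s
  * phi _ w1 (D1 (Y w1 s)) / srel s.

Let U2 w1 w2 s t :=
  srel s * rhon _ (fun i => alpha i * tnth s i) (fun i => Num.sqrt (tau i)) t
  * phi _ w2 (D2 w1 t)
  / (rhon _ (b w2) (fun=> 1) s * rhon _ (mu w2 s) sigma t).

Let srel_gt0 s : 0 < srel s.
Proof.
rewrite divr_gt0// (bigD1 w20)//= ltr_pwDl//; first exact: rhon_gt0.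
by rewrite sumr_ge0// => w _; exact: rhon_ge0.
Qed.

Let sqrt_v_gt0 i : 0 < Num.sqrt (v i). Proof. by rewrite sqrtr_gt0. Qed.
Let sqrt_tau_gt0 i : 0 < Num.sqrt (tau i). Proof. by rewrite sqrtr_gt0. Qed.

Let U1_gt0 w1 s : 0 < U1 w1 s.
Proof. by rewrite divr_gt0// mulr_gt0// rhon_gt0. Qed.

Let U2_gt0 w1 w2 s t : 0 < U2 w1 w2 s t.
Proof.
apply: divr_gt0; last by apply: mulr_gt0; exact: rhon_gt0.
by apply: mulr_gt0 => //; apply: mulr_gt0 => //; exact: rhon_gt0.
Qed.

Let measurable_srel : measurable_fun setT srel.
Proof.
apply: measurable_funM => //; apply: measurable_sum => w.
exact: measurable_rhon.
Qed.

Let measurable_srelV : measurable_fun setT (fun s => (srel s)^-1).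
Proof. exact: measurable_fun_inv_gt0. Qed.

Let measurable_S w2 : measurable_fun setT (S w2).
Proof.
apply: measurable_mktuple => i; apply: measurable_Cadd => //.
exact: measurable_tnth.
Qed.

Let measurable_Y w1 : measurable_fun setT (Y w1).
Proof.
apply: measurable_mktuple => i; apply: measurable_Cadd => //.
exact: measurable_tnth.
Qed.

Let measurable_U1 w1 : measurable_fun setT (U1 w1).
Proof.
rewrite /U1; apply: measurable_funM; last exact: measurable_srelV.
apply: measurable_funM; first exact: measurable_rhon.
by apply: (measurableT_comp (measurable_phi _ _ _ (mD1 w1))); exact: measurable_Y.
Qed.

Let integral_fst (f : tup -> \bar R) : measurable_fun setT f ->
  (forall z, 0 <= f z)%E ->
  (\int[gauss \x gauss]_p f p.1 = \int[gauss]_z f z)%E.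
Proof.
move=> mf f0.
have mg : measurable_fun setT (fun p : tup * tup => f p.1).
  exact: (measurableT_comp mf measurable_fst).
etransitivity.
  exact: (fubini_tonelli1 (m1 := gauss) (m2 := gauss) _ mg (fun p => f0 p.1)).
apply: eq_integral => z _; rewrite /fubini_F /=.
exact: (integral_cst_probability _ _ _ gauss (f z)).
Qed.

(** Summing over [w2] produces [N2 * srel], which cancels the denominator of [U1]. What remains is
    the law of Gaussian vectors of mean [- a w1] and variances [v]; adding [a w1] back gives an
    output whose law does not depend on [w1], so [sum_phi] applies under the integral. *)
Let integral_U1 :
  (\sum_w1 \sum_w2 \int[gauss \x gauss]_p (U1 w1 (S w2 p.1))%:E
   <= (2 * N1 * N2)%:E)%E.
Proof.
have mU1 w1 : measurable_fun setT (fun s => (U1 w1 s)%:E).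
  exact/measurable_EFinP.
have U10 w1 s : (0 <= (U1 w1 s)%:E)%E by rewrite lee_fin ltW.
pose sqv (z : tup) := [tuple (Num.sqrt (v i))%:C%C * tnth z i | i < n].
have msqv : measurable_fun setT sqv.
  apply: measurable_mktuple => i; apply: measurable_Cmul => //.
  exact: measurable_tnth.
have inner w1 : (\sum_w2 \int[gauss \x gauss]_p (U1 w1 (S w2 p.1))%:E =
    N2%:E * \int[gauss]_z (phi _ w1 (D1 (sqv z)))%:E)%E.
  have mphiY : measurable_fun setT (fun s => (phi _ w1 (D1 (Y w1 s)))%:E).
    apply/measurable_EFinP.
    by apply: (measurableT_comp (measurable_phi _ _ _ (mD1 w1))); exact: measurable_Y.
  have phiY0 s : (0 <= (phi _ w1 (D1 (Y w1 s)))%:E)%E by rewrite lee_fin ltW.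
  transitivity (\sum_w2 \int[gauss]_s
      ((U1 w1 s)%:E * (rhon _ (b w2) (fun=> 1%R) s)%:E))%E.
    apply: eq_bigr => w2 _.
    rewrite (integral_fst (fun z => (U1 w1 (S w2 z))%:E)).
    - exact: (gaussn_shift _ (b w2) (fun s => (U1 w1 s)%:E)).
    - exact: (measurableT_comp (mU1 w1) (measurable_S w2)).
    - by [].
  rewrite -ge0_integral_sum//; last 2 first.
  - move=> w2; apply: emeasurable_funM => //; apply/measurable_EFinP.
    exact: measurable_rhon.
  - by move=> w2 s _; rewrite mule_ge0// lee_fin rhon_ge0.
  transitivity (\int[gauss]_s (N2%:E * ((phi _ w1 (D1 (Y w1 s)))%:E *
     (rhon _ (fun i => - a w1 i) (fun i => Num.sqrt (v i)) s)%:E)))%E.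
    apply: eq_integral => s _.
    under eq_bigr do rewrite -EFinM; rewrite sumEFin -mulr_sumr -!EFinM.
    have -> : \sum_w2 rhon _ (b w2) (fun=> 1) s = N2 * srel s.
      by rewrite /srel mulrC divfK// lt0r_neq0.
    by congr EFin; rewrite /U1; field; exact: lt0r_neq0.
  rewrite ge0_integralZl//; last 3 first.
  - apply: emeasurable_funM => //; apply/measurable_EFinP; exact: measurable_rhon.
  - by move=> s _; rewrite mule_ge0// lee_fin rhon_ge0.
  - by rewrite lee_fin ltW.
  rewrite -gaussn_affine//; congr (_ * _)%E; apply: eq_integral => z _.
  congr (phi _ w1 (D1 _))%:E; apply: eq_from_tnth => i.
  by rewrite !tnth_mktuple addrA subrr add0r.
under eq_bigr do rewrite inner.
rewrite -ge0_sume_distrr; last first.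
  by move=> w1 _; apply: integral_ge0 => z _; rewrite lee_fin ltW.
rewrite -ge0_integral_sum//; last 2 first.
- move=> w1; apply/measurable_EFinP.
  exact: (measurableT_comp (measurable_phi _ _ _ (mD1 w1)) msqv).
- by move=> w1 z _; rewrite lee_fin ltW.
rewrite mulrC EFinM lee_pmul2l ?lte_fin//.
apply: (@le_trans _ _ (\int[gauss]_z (2 * N1)%:E)%E); last first.
  by rewrite integral_cst_probability.
apply: ge0_le_integral => //.
- by move=> z _; apply: sume_ge0 => w1 _; rewrite lee_fin ltW.
- apply: emeasurable_sum => w1; apply/measurable_EFinP.
  exact: (measurableT_comp (measurable_phi _ _ _ (mD1 w1)) msqv).
- by move=> z _; rewrite sumEFin lee_fin sum_phi.
Qed.

Let measurable_T w2 : measurable_fun setT (fun p : tup * tup => T w2 p.1 p.2).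
Proof.
apply: measurable_mktuple => i; apply: measurable_Cadd.
  apply: measurable_Cadd => //; apply: measurable_Cmul => //.
  exact: (measurableT_comp (measurable_tnth _) measurable_fst).
apply: measurable_Cmul => //.
exact: (measurableT_comp (measurable_tnth _) measurable_snd).
Qed.

Let measurable_mu w2 i : measurable_fun setT (fun s : tup => mu w2 s i).
Proof.
apply: measurable_Cadd => //; apply: measurable_Cmul => //.
by apply: measurable_Cadd => //; exact: measurable_tnth.
Qed.

Let TE w2 z u : T w2 z u =
  [tuple mu w2 (S w2 z) i + (sigma i)%:C%C * tnth u i | i < n].
Proof.
apply: eq_from_tnth => i; rewrite !tnth_mktuple /mu tnth_mktuple.
by rewrite [b w2 i + _]addrC addrK.
Qed.

(** Conditional density of [T] given [S = s] if user 2 sent Gaussian symbols of powers [P2]. *)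
Let gc (s t : tup) : R :=
  rhon _ (fun i => alpha i * tnth s i) (fun i => Num.sqrt (tau i)) t.

Let gc_ge0 s t : 0 <= gc s t. Proof. exact: rhon_ge0. Qed.

Let measurable_gc : measurable_fun setT (fun p : tup * tup => gc p.1 p.2).
Proof.
apply: measurable_rhon => // i; apply: measurable_Cmul => //.
exact: (measurableT_comp (measurable_tnth _) measurable_fst).
Qed.

Let measurable_phi2 w1 w2 : measurable_fun setT (fun t => phi _ w2 (D2 w1 t)).
Proof. exact: measurable_phi. Qed.

Let measurable_U2 w1 w2 :
  measurable_fun setT (fun p : tup * tup => U2 w1 w2 p.1 p.2).
Proof.
rewrite /U2; apply: measurable_funM; last first.
  apply: measurable_fun_inv_gt0.
    by move=> p; apply: mulr_gt0; exact: rhon_gt0.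
  apply: measurable_funM.
    exact: measurable_rhon.
  apply: measurable_rhon => // i.
  exact: (measurableT_comp (measurable_mu _ _) measurable_fst).
apply: measurable_funM; last first.
  exact: (measurableT_comp (measurable_phi2 w1 w2) measurable_snd).
apply: measurable_funM; last exact: measurable_gc.
exact: (measurableT_comp measurable_srel measurable_fst).
Qed.

Let J w1 w2 s : \bar R :=
  (\int[gauss]_t (gc s t * phi _ w2 (D2 w1 t))%:E)%E.

Let measurable_gcphi w1 w2 : measurable_fun setT
  (fun p : tup * tup => (gc p.1 p.2 * phi _ w2 (D2 w1 p.2))%:E).
Proof.
apply/measurable_EFinP; apply: measurable_funM => //.
exact: (measurableT_comp (measurable_phi2 _ _) measurable_snd).
Qed.

Let gcphi_ge0 w1 w2 s t : (0 <= (gc s t * phi _ w2 (D2 w1 t))%:E)%E.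
Proof. by rewrite lee_fin mulr_ge0// ltW. Qed.

Let J_ge0 w1 w2 s : (0 <= J w1 w2 s)%E.
Proof. by apply: integral_ge0 => t _; exact: gcphi_ge0. Qed.

Let measurable_J w1 w2 : measurable_fun setT (J w1 w2).
Proof.
exact: (measurable_fun_fubini_tonelli_F (m2 := gauss) _ (measurable_gcphi w1 w2)
  (fun p => gcphi_ge0 w1 w2 p.1 p.2)).
Qed.

Let sum_J w1 s : (\sum_w2 J w1 w2 s <= (2 * N2)%:E)%E.
Proof.
have mg w2 : measurable_fun setT (fun t => (gc s t * phi _ w2 (D2 w1 t))%:E).
  exact: (measurableT_comp (measurable_gcphi w1 w2) (pair1_measurable s)).
have mgc : measurable_fun setT (fun t => (gc s t)%:E).
  apply/measurable_EFinP.
  exact: (measurableT_comp measurable_gc (pair1_measurable s)).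
rewrite -ge0_integral_sum//.
apply: (@le_trans _ _ (\int[gauss]_t ((2 * N2)%:E * (gc s t)%:E))%E).
  apply: ge0_le_integral => //.
  - by move=> t _; apply: sume_ge0.
  - exact: emeasurable_sum.
  - exact: measurable_funeM.
  - move=> t _; rewrite sumEFin -EFinM lee_fin -mulr_sumr mulrC.
    by rewrite ler_wpM2r// sum_phi.
rewrite ge0_integralZl//.
- by rewrite [X in (_ * X)%E](integral_rhon n) ?mule1.
- by move=> t _; rewrite lee_fin.
- by rewrite lee_fin mulr_ge0// ltW.
Qed.

Let integral_srel : (\int[gauss]_s (srel s)%:E = 1)%E.
Proof.
under eq_integral do rewrite /srel mulrC EFinM -sumEFin.
have mr w2 : measurable_fun setT (fun s => (rhon n (b w2) (fun=> 1) s)%:E).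
  by apply/measurable_EFinP; exact: measurable_rhon.
rewrite ge0_integralZl//; last 3 first.
- exact: emeasurable_sum.
- by move=> s _; apply: sume_ge0 => w _; rewrite lee_fin rhon_ge0.
- by rewrite lee_fin invr_ge0 ltW.
rewrite ge0_integral_sum//; last first.
  by move=> w s _; rewrite lee_fin rhon_ge0.
under eq_bigr do rewrite integral_rhon//.
rewrite sumEFin -EFinM sumr_const -[_ *+ _]/(_%:R) mulVf//.
exact: lt0r_neq0.
Qed.

(** The changes of variables from [u] to [t] and from [z] to [s] produce the two true likelihoods in
    the denominator of [U2]. There remains [srel s * gc s t] times the reward: [sum_phi] bounds the
    sum over [w2], and [gc s] and [srel] have mass 1. *)
Let integral_U2 :
  (\sum_w1 \sum_w2 \int[gauss \x gauss]_p
     (U2 w1 w2 (S w2 p.1) (T w2 p.1 p.2))%:E <= (2 * N1 * N2)%:E)%E.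
Proof.
have one w1 w2 : (\int[gauss \x gauss]_p
     (U2 w1 w2 (S w2 p.1) (T w2 p.1 p.2))%:E =
   \int[gauss]_s ((srel s)%:E * J w1 w2 s))%E.
  have mU : measurable_fun setT
      (fun p : tup * tup => (U2 w1 w2 (S w2 p.1) (T w2 p.1 p.2))%:E).
    apply/measurable_EFinP.
    apply: (measurableT_comp (measurable_U2 w1 w2)
      (g := fun p => (S w2 p.1, T w2 p.1 p.2))).
    apply/measurable_fun_pairP; split => /=; last exact: measurable_T.
    exact: (measurableT_comp (measurable_S w2) measurable_fst).
  pose F s := (((srel s / rhon _ (b w2) (fun=> 1) s)%R)%:E * J w1 w2 s)%E.
  have mF : measurable_fun setT F.
    apply: emeasurable_funM => //; apply/measurable_EFinP.
    apply: measurable_funM => //; apply: measurable_fun_inv_gt0.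
      by move=> s; exact: rhon_gt0.
    exact: measurable_rhon.
  have F0 s : (0 <= F s)%E.
    by rewrite mule_ge0// lee_fin divr_ge0 ?rhon_ge0// ltW.
  transitivity (\int[gauss]_z F (S w2 z))%E.
    etransitivity.
      apply: (fubini_tonelli1 (m1 := gauss) (m2 := gauss) _ mU) => p.
      by rewrite lee_fin ltW.
    apply: eq_integral => z _; rewrite /fubini_F /=; set s := S w2 z.
    have mU2s : measurable_fun setT (fun t => (U2 w1 w2 s t)%:E).
      apply/measurable_EFinP.
      exact: (measurableT_comp (measurable_U2 w1 w2) (pair1_measurable s)).
    under eq_integral do rewrite TE.
    etransitivity.
      apply: (gaussn_affine n (mu w2 s) sigma (fun t => (U2 w1 w2 s t)%:E)) => //.
      by move=> t; rewrite lee_fin ltW.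
    rewrite /F /J -ge0_integralZl//; last 2 first.
    - exact: (measurableT_comp (measurable_gcphi w1 w2) (pair1_measurable s)).
    - by rewrite lee_fin divr_ge0 ?rhon_ge0// ltW.
    apply: eq_integral => t _; rewrite -!EFinM; congr EFin.
    rewrite /U2 -/(gc s t); field.
    by rewrite !lt0r_neq0 ?rhon_gt0.
  etransitivity; first exact: (gaussn_shift n (b w2) F).
  apply: eq_integral => s _; rewrite /F muleAC -EFinM divfK//.
  by rewrite lt0r_neq0 ?rhon_gt0.
have two w1 : (\sum_w2 \int[gauss \x gauss]_p
     (U2 w1 w2 (S w2 p.1) (T w2 p.1 p.2))%:E <= (2 * N2)%:E)%E.
  under eq_bigr do rewrite one.
  rewrite -ge0_integral_sum//; last 2 first.
  - by move=> w2; apply: emeasurable_funM => //; exact/measurable_EFinP.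
  - by move=> w2 s _; rewrite mule_ge0// lee_fin ltW.
  rewrite -[leRHS]mule1 -integral_srel -ge0_integralZl//; last 3 first.
  - exact/measurable_EFinP.
  - by move=> s _; rewrite lee_fin ltW.
  - by rewrite lee_fin mulr_ge0// ltW.
  apply: ge0_le_integral => //.
  - by move=> s _; apply: sume_ge0 => w2 _; rewrite mule_ge0// lee_fin ltW.
  - apply: emeasurable_sum => w2.
    by apply: emeasurable_funM => //; exact/measurable_EFinP.
  - by apply: measurable_funeM; exact/measurable_EFinP.
  - move=> s _; rewrite -ge0_sume_distrr; last by move=> w2 _; exact: J_ge0.
    by rewrite muleC lee_wpmul2r// lee_fin ltW.
apply: (@le_trans _ _ (\sum_(w1 : W1) (2 * N2)%:E)%E).
  by apply: lee_sum => w1 _; exact: two.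
rewrite sumEFin lee_fin sumr_const -[_ *+ _]mulr_natl -/N1.
by rewrite mulrCA mulrA.
Qed.

Let prod_expR (I : finType) (f : I -> R) : \prod_i expR (f i) = expR (\sum_i f i).
Proof. by rewrite (big_morph expR (@expRD R) (@expR0 R)). Qed.

(** The three parts of the log-likelihood ratio: [K] comes from the normalising constants, [Q] is
    the quadratic form of the Gaussian model, and [noise] that of the true law given the
    messages. *)
Let K := \sum_i (ln (v i) + ln (k i)).
Let Q w1 w2 (z u : tup) := \sum_i
  (nsq (a w1 i + tnth (S w2 z) i) / v i
   + nsq (tnth (T w2 z u) i - alpha i * tnth (S w2 z) i) / tau i).
Let noise (z u : tup) := \sum_i (nsq (tnth z i) + nsq (tnth u i)).

Let likelihood_ratio w1 w2 z u :
  let s := S w2 z in let t := T w2 z u in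
  U1 w1 s * U2 w1 w2 s t = phi _ w1 (D1 (Y w1 s)) * phi _ w2 (D2 w1 t)
    * expR (- (K + Q w1 w2 z u - noise z u)).
Proof.
move=> s t.
have -> : U1 w1 s * U2 w1 w2 s t = phi _ w1 (D1 (Y w1 s)) * phi _ w2 (D2 w1 t) *
   ((rhon n (fun i => - a w1 i) (fun i => Num.sqrt (v i)) s / rhon n (b w2) (fun=> 1) s) *
   (gc s t / rhon n (mu w2 s) sigma t)).
  by rewrite /U1 /U2 -/(gc s t); field; rewrite !lt0r_neq0 ?rhon_gt0.
congr (_ * _); rewrite /gc /rhon -!prodf_div -big_split /=.
rewrite /K /Q /noise -big_split -sumrB -sumrN -prod_expR.
apply: eq_bigr => i _.
rewrite !rho_ratio// -expRD; congr expR.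
have -> : tnth s i - b w2 i = tnth z i.
  by rewrite tnth_mktuple [b w2 i + _]addrC addrK.
have -> : nsq (tnth t i - mu w2 s i) = sigma i ^+ 2 * nsq (tnth u i).
  rewrite /t TE tnth_mktuple [mu w2 s i + _]addrC addrK nsqM; congr (_ * _).
  by rewrite /nsq /= expr0n addr0.
rewrite (sqr_sqrtr (ltW (v_gt0 i))) (sqr_sqrtr (ltW (tau_gt0 i))) /=.
rewrite !expr1n ln1 divr1 opprK [_ + a w1 i]addrC.
have k_gt0 : 0 < k i by exact: lt_le_trans ltr01 (k_ge1 i).
(* The ratio of conditional densities contributes [ln tau - ln (sigma ^+ 2)], that is [ln k]. *)
have -> : ln (tau i) = ln (sigma i ^+ 2) + ln (k i).
  by rewrite -lnM ?posrE ?exprn_gt0.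
rewrite -/s -/t mulrAC divff ?mul1r; last by rewrite lt0r_neq0 ?exprn_gt0.
lra.
Qed.

Let ln_phi (W : finType) (w w' : W) :
  ln (phi _ w w') = ln (#|W|%:R) * (w' == w)%:R.
Proof. by rewrite /phi; case: ifP => _; rewrite ?mulr1// ln1 mulr0. Qed.

(** Apply [ln x <= x - 1] to [U1] and to [U2]. With [noise] on the left and [Q] on the right, both
    sides are nonnegative and can be integrated as they stand. *)
Let pointwise w1 w2 z u :
  2 + ln N1 * (D1 (Y w1 (S w2 z)) == w1)%:R
    + ln N2 * (D2 w1 (T w2 z u) == w2)%:R + noise z u <=
  K + Q w1 w2 z u + U1 w1 (S w2 z) + U2 w1 w2 (S w2 z) (T w2 z u).
Proof.
have ln_le (x : R) : 0 < x -> ln x <= x - 1.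
  by move=> x0; rewrite -{1}(subrKC 1 x); apply: le_ln1Dx; lra.
have := likelihood_ratio w1 w2 z u => /= LR.
have : ln (U1 w1 (S w2 z) * U2 w1 w2 (S w2 z) (T w2 z u)) =
    ln N1 * (D1 (Y w1 (S w2 z)) == w1)%:R
    + ln N2 * (D2 w1 (T w2 z u) == w2)%:R - (K + Q w1 w2 z u - noise z u).
  by rewrite LR !lnM ?posrE ?mulr_gt0 ?expR_gt0 ?phi_gt0// expRK !ln_phi.
rewrite lnM ?posrE//.
have := ln_le _ (U1_gt0 w1 (S w2 z)).
have := ln_le _ (U2_gt0 w1 w2 (S w2 z) (T w2 z u)).
lra.
Qed.

Let E1 w1 w2 : set tup := [set z | D1 (Y w1 (S w2 z)) = w1].
Let E2 w1 w2 : set tup := [set z | D2 w1 [tuple c w2 i + tnth z i | i < n] = w2].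

Let measurable_E1 w1 w2 : measurable (E1 w1 w2).
Proof.
have mYS : measurable_fun setT (fun z => Y w1 (S w2 z)).
  exact: (measurableT_comp (measurable_Y w1) (measurable_S w2)).
by have := mYS measurableT _ (mD1 w1); rewrite setTI.
Qed.

Let measurable_shift_c w2 :
  measurable_fun setT (fun z : tup => [tuple c w2 i + tnth z i | i < n]).
Proof.
apply: measurable_mktuple => i; apply: measurable_Cadd => //.
exact: measurable_tnth.
Qed.

Let measurable_E2 w1 w2 : measurable (E2 w1 w2).
Proof. by have := measurable_shift_c w2 measurableT _ (mD2 w1 w2); rewrite setTI. Qed.

Let nat_eq_indic (U V : Type) (W : eqType) (f : U -> W) (w : W) x :
  (f x == w)%:R = \1_[set y | f y = w] x :> R.
Proof.
rewrite indicE; have [<-|fw] := eqVneq (f x) w; first by rewrite mem_set.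
by rewrite memNset//=; exact/eqP.
Qed.

Let measurable_tnth1 i : measurable_fun setT (fun p : tup * tup => tnth p.1 i).
Proof. exact: (measurableT_comp (measurable_tnth _) measurable_fst). Qed.

Let measurable_tnth2 i : measurable_fun setT (fun p : tup * tup => tnth p.2 i).
Proof. exact: (measurableT_comp (measurable_tnth _) measurable_snd). Qed.

Let measurable_noise : measurable_fun setT (fun p : tup * tup => noise p.1 p.2).
Proof.
apply: measurable_sum => i; apply: measurable_funD; apply: measurable_nsq.
  exact: measurable_tnth1.
exact: measurable_tnth2.
Qed.

Let noise_ge0 z u : 0 <= noise z u.
Proof. by rewrite sumr_ge0// => i _; rewrite addr_ge0 ?nsq_ge0. Qed.

Let integral_noise :
  (\int[gauss \x gauss]_p (noise p.1 p.2)%:E = (n%:R * 2)%:E)%E.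
Proof.
rewrite ge0_integral_EFin_sum; last 2 first.
- by move=> i p; rewrite addr_ge0 ?nsq_ge0.
- move=> i; apply: measurable_funD; apply: measurable_nsq.
    exact: measurable_tnth1.
  exact: measurable_tnth2.
transitivity (\sum_(i < n) 2%:E : \bar R)%E; last first.
  by rewrite sumEFin sumr_const card_ord -[_ *+ _]mulr_natl.
apply: eq_bigr => i _; rewrite ge0_integral_EFinD; last 4 first.
- by move=> p; exact: nsq_ge0.
- by move=> p; exact: nsq_ge0.
- by apply: measurable_nsq; exact: measurable_tnth1.
- by apply: measurable_nsq; exact: measurable_tnth2.
have mi : measurable_fun setT (fun z : tup => (nsq (tnth z i))%:E).
  by apply/measurable_EFinP; apply: measurable_nsq; exact: measurable_tnth.
have i0 (z : tup) : (0 <= (nsq (tnth z i))%:E)%E by rewrite lee_fin nsq_ge0.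
rewrite (integral_fst (fun z => (nsq (tnth z i))%:E) mi i0).
rewrite integral_nsq_gaussn.
have m2 : measurable_fun setT (fun p : tup * tup => (nsq (tnth p.2 i))%:E).
  exact: (measurableT_comp mi measurable_snd).
have -> : (\int[gauss \x gauss]_p (nsq (tnth p.2 i))%:E = 1)%E; last by [].
etransitivity.
  exact: (fubini_tonelli1 (m1 := gauss) (m2 := gauss) _ m2 (fun p => i0 p.2)).
rewrite /fubini_F /=; under eq_integral do rewrite integral_nsq_gaussn.
exact: (integral_cst_probability _ _ _ gauss).
Qed.

Let Qbar w1 w2 : R := \sum_i ((nsq (a w1 i + b w2 i) + 1) / v i
  + (nsq (c w2 i - alpha i * b w2 i) + nsq (q i - alpha i) + sigma i ^+ 2) / tau i).

Let Q_ge0 w1 w2 z u : 0 <= Q w1 w2 z u.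
Proof.
by rewrite sumr_ge0// => i _; rewrite addr_ge0// divr_ge0 ?nsq_ge0// ltW.
Qed.

Let measurable_Q1 w1 w2 i : measurable_fun setT
  (fun p : tup * tup => nsq (a w1 i + tnth (S w2 p.1) i)).
Proof.
apply: measurable_nsq; apply: measurable_Cadd => //.
apply: (measurableT_comp (measurable_tnth i)).
exact: (measurableT_comp (measurable_S w2) measurable_fst).
Qed.

Let measurable_Q2 w2 i : measurable_fun setT
  (fun p : tup * tup => nsq (tnth (T w2 p.1 p.2) i - alpha i * tnth (S w2 p.1) i)).
Proof.
apply: measurable_nsq.
rewrite (_ : (fun p => _) = fun p : tup * tup =>
   tnth (T w2 p.1 p.2) i + (- alpha i) * tnth (S w2 p.1) i); last first.
  by apply/funext => p; rewrite mulNr.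
apply: measurable_Cadd.
  exact: (measurableT_comp (measurable_tnth i) (measurable_T w2)).
apply: measurable_Cmul => //; apply: (measurableT_comp (measurable_tnth i)).
exact: (measurableT_comp (measurable_S w2) measurable_fst).
Qed.

Let measurable_Q w1 w2 : measurable_fun setT (fun p : tup * tup => Q w1 w2 p.1 p.2).
Proof.
by apply: measurable_sum => i; apply: measurable_funD; apply: measurable_funM.
Qed.

Let integral_Q w1 w2 :
  (\int[gauss \x gauss]_p (Q w1 w2 p.1 p.2)%:E = (Qbar w1 w2)%:E)%E.
Proof.
rewrite ge0_integral_EFin_sum; last 2 first.
- by move=> i p; rewrite addr_ge0// divr_ge0 ?nsq_ge0// ltW.
- by move=> i; apply: measurable_funD; apply: measurable_funM.
rewrite -sumEFin; apply: eq_bigr => i _.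
rewrite ge0_integral_EFinD; last 4 first.
- by move=> p; rewrite divr_ge0 ?nsq_ge0// ltW.
- by move=> p; rewrite divr_ge0 ?nsq_ge0// ltW.
- exact: measurable_funM.
- exact: measurable_funM.
under eq_integral do rewrite mulrC.
rewrite ge0_integral_EFinZ; last 3 first.
- by rewrite invr_ge0 ltW.
- by move=> p; exact: nsq_ge0.
- exact: measurable_Q1.
under [X in (_ + X)%E]eq_integral do rewrite mulrC.
rewrite ge0_integral_EFinZ; last 3 first.
- by rewrite invr_ge0 ltW.
- by move=> p; exact: nsq_ge0.
- exact: measurable_Q2.
transitivity (((v i)^-1)%:E * (nsq (a w1 i + b w2 i) + 1)%:E + ((tau i)^-1)%:E *
  (nsq (c w2 i - alpha i * b w2 i) + nsq (q i - alpha i) + sigma i ^+ 2)%:E)%E;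
  last by rewrite -!EFinM -EFinD; congr EFin; rewrite ![_^-1 * _]mulrC.
congr (_ * _ + _ * _)%E.
  transitivity (\int[gauss]_z (nsq ((a w1 i + b w2 i) + 1 * tnth z i))%:E)%E.
    rewrite -integral_fst//.
    - apply: eq_integral => p _; congr (nsq _)%:E.
      by rewrite tnth_mktuple mul1r addrA.
    - apply/measurable_EFinP; apply: measurable_nsq; apply: measurable_Cadd => //.
      by apply: measurable_Cmul => //; exact: measurable_tnth.
    - by move=> z; rewrite lee_fin nsq_ge0.
  rewrite integral_nsq_affine_gaussn; congr (_ + _)%:E.
  by rewrite /nsq /= expr1n expr0n addr0.
etransitivity.
  apply: (fubini_tonelli1 (m1 := gauss) (m2 := gauss)).
    by apply/measurable_EFinP; exact: measurable_Q2.
  by move=> p; rewrite lee_fin nsq_ge0.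
have nsqs : nsq (sigma i)%:C%C = sigma i ^+ 2 by rewrite /nsq /= expr0n addr0.
transitivity (\int[gauss]_z ((nsq ((c w2 i - alpha i * b w2 i)
    + (q i - alpha i) * tnth z i)) + sigma i ^+ 2)%:E)%E.
  apply: eq_integral => z _; rewrite /fubini_F /= -nsqs -(integral_nsq_affine_gaussn n _ _ i).
  apply: eq_integral => u _; congr (nsq _)%:E; rewrite !tnth_mktuple; ring.
rewrite ge0_integral_EFinD//; last 3 first.
- by move=> z; exact: nsq_ge0.
- by move=> z; exact: sqr_ge0.
- apply: measurable_nsq; apply: measurable_Cadd => //.
  by apply: measurable_Cmul => //; exact: measurable_tnth.
rewrite integral_nsq_affine_gaussn [X in (_ + X)%E]integral_cst_probability.
by rewrite EFinD.
Qed.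

(** As [v] and [tau] are the second moments of the quantities that they divide, each of the [2 * n]
    normalised squares has mean 1. This is also the mean of [noise], so the two cancel in the
    end. *)
Let sum_Qbar : \sum_w1 \sum_w2 Qbar w1 w2 = N1 * N2 * (n%:R * 2).
Proof.
under eq_bigr do rewrite exchange_big /=.
rewrite exchange_big /=.
transitivity (\sum_(i < n) (N1 * N2 * 2)).
  apply: eq_bigr => i _.
  have [d dE] : exists d, d = (v i)^-1 + (nsq (q i - alpha i) + sigma i ^+ 2) / tau i.
    by eexists.
  pose G w1 w2 := (v i)^-1 * nsq (h11 i * x1 w1 i + h12 i * x2 w2 i) +
    (tau i)^-1 * nsq (0 * x1 w1 i + (h22 i - alpha i * h12 i) * x2 w2 i) + d.
  transitivity (\sum_w1 \sum_w2 G w1 w2).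
    apply: eq_bigr => w1 _; apply: eq_bigr => w2 _; rewrite /G dE /c /a /b.
    have -> : 0 * x1 w1 i + (h22 i - alpha i * h12 i) * x2 w2 i =
      h22 i * x2 w2 i - alpha i * (h12 i * x2 w2 i) by ring.
    move: (v i)^-1 (tau i)^-1 (nsq (h22 i * _ - _)) (nsq (h11 i * _ + _))
      (nsq (q i - _)) (sigma i ^+ 2) => ? ? ? ? ? ?; ring.
  rewrite /G; under eq_bigr do rewrite big_split big_split /= -!mulr_sumr sumr_const.
  rewrite big_split big_split /= -!mulr_sumr sumr_const !sum_centered.
  rewrite -[_ *+ _ *+ _]mulr_natl -[d *+ _]mulr_natl -/N1 -/N2.
  have nsq00 : nsq (0 : C) = 0 by rewrite /nsq /= expr0n addr0.
  have vE : nsq (h11 i) * P1 i + nsq (h12 i) * P2 i = v i - 1 by rewrite /v; ring.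
  have tauE : nsq (h22 i - alpha i * h12 i) * P2 i =
    tau i - (nsq (q i - alpha i) + sigma i ^+ 2) by rewrite -(mmse i); ring.
  rewrite nsq00 mul0r add0r vE tauE dE.
  have := tau_gt0 i; have := v_gt0 i.
  move: (v i) (tau i) (nsq (q i - _) + _) => V tt e V0 t0.
  by field; rewrite !lt0r_neq0.
by rewrite sumr_const card_ord -[_ *+ _]mulr_natl; ring.
Qed.

(** Averaged over the messages, [pointwise] has on its right the means of the two weights, at most 4
    together, against 2 on its left: this leaves the constant 2. Since [D2] is told [w1], its output
    is taken without the signal of user 1. *)
Lemma core_inequality :
  (\sum_w1 \sum_w2 fine (gauss [set z | D1
      [tuple h11 i * x1 w1 i + (h12 i * x2 w2 i + tnth z i) | i < n] = w1]))
    * ln #|W1|%:R +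
  (\sum_w1 \sum_w2 fine (gauss [set z | D2 w1
      [tuple h22 i * x2 w2 i + tnth z i | i < n] = w2])) * ln #|W2|%:R <=
  #|W1|%:R * #|W2|%:R * (2 + \sum_i
    (ln (1 + nsq (h11 i) * avg (fun w => nsq (x1 w i))
           + nsq (h12 i) * avg (fun w => nsq (x2 w i)))
     + ln ((1 + nsq (h22 i) * avg (fun w => nsq (x2 w i)))
           / (1 + nsq (h12 i) * avg (fun w => nsq (x2 w i)))))).
Proof.
rewrite -/N1 -/N2 -/K.
have lnN1 : 0 <= ln N1 by rewrite ln_ge0// ler1n; apply/card_gt0P; exists w10.
have lnN2 : 0 <= ln N2 by rewrite ln_ge0// ler1n; apply/card_gt0P; exists w20.
have K0 : 0 <= K by rewrite sumr_ge0// => i _; rewrite addr_ge0// ln_ge0.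
pose p1 w1 w2 := fine (gauss (E1 w1 w2)); pose p2 w1 w2 := fine (gauss (E2 w1 w2)).
have -> : \sum_w1 \sum_w2 fine (gauss [set z | D1
    [tuple h11 i * x1 w1 i + (h12 i * x2 w2 i + tnth z i) | i < n] = w1]) =
    \sum_w1 \sum_w2 p1 w1 w2.
  apply: eq_bigr => w1 _; apply: eq_bigr => w2 _; congr (fine (gauss _)).
  apply/seteqP; split=> z /=; rewrite /E1/=; congr (D1 _ = _);
    by apply: eq_from_tnth => i; rewrite !tnth_mktuple.
rewrite -/(\sum_w1 \sum_w2 p2 w1 w2).
have main w1 w2 : ((2 + p1 w1 w2 * ln N1 + p2 w1 w2 * ln N2 + n%:R * 2)%:E <=
    (K + Qbar w1 w2)%:E
    + \int[gauss \x gauss]_p (U1 w1 (S w2 p.1))%:E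
    + \int[gauss \x gauss]_p (U2 w1 w2 (S w2 p.1) (T w2 p.1 p.2))%:E)%E.
  have m1 : measurable_fun setT (fun p : tup * tup => \1_(E1 w1 w2) p.1 : R).
    exact: (measurableT_comp (measurable_indic (measurable_E1 w1 w2)) measurable_fst).
  pose D := [set y | D2 w1 y = w2].
  have mD : measurable_fun setT (\1_D : tup -> R) by exact: (measurable_indic (mD2 w1 w2)).
  have m2 : measurable_fun setT (fun p : tup * tup => \1_D (T w2 p.1 p.2) : R).
    exact: (measurableT_comp mD (measurable_T w2)).
  have i1 : (\int[gauss \x gauss]_p (\1_(E1 w1 w2) p.1)%:E = (p1 w1 w2)%:E)%E.
    rewrite (integral_fst (fun z => (\1_(E1 w1 w2) z)%:E)).
    - rewrite integral_indic// setIT /p1 fineK//; exact: fin_num_measure.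
    - by apply/measurable_EFinP; exact: measurable_indic.
    - by move=> z; rewrite lee_fin.
  have i2 : (\int[gauss \x gauss]_p (\1_D (T w2 p.1 p.2))%:E = (p2 w1 w2)%:E)%E.
    etransitivity.
      by apply: (fubini_tonelli1 (m1 := gauss) (m2 := gauss)); [exact/measurable_EFinP|
        move=> p; rewrite lee_fin].
    transitivity (\int[gauss]_z (\1_(E2 w1 w2) z)%:E)%E; last first.
      rewrite integral_indic// setIT /p2 fineK//; exact: fin_num_measure.
    have qs i : nsq (q i) + sigma i ^+ 2 = 1 by rewrite sigma2 addrC subrK.
    have mE2 : measurable_fun setT (fun z => (\1_(E2 w1 w2) z : R)%:E).
      by apply/measurable_EFinP; exact: measurable_indic.
    have E20 z : (0 <= (\1_(E2 w1 w2) z : R)%:E)%E by rewrite lee_fin.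
    (* The coupled noise [q z + sigma u] is standard, so the coupling does not change the decoding
       probability of receiver 2. *)
    etransitivity; last exact: (gaussn_rotation n q sigma _ sigma_gt0 qs mE2 E20).
    apply: eq_integral => z _; apply: eq_integral => u _; congr EFin.
    rewrite !indicE; congr ((nat_of_bool _)%:R); apply/idP/idP; rewrite !inE /D /E2 /=;
      congr (D2 _ _ = _);
      by apply: eq_from_tnth => i; rewrite !tnth_mktuple addrA.
  have mU1 : measurable_fun setT (fun p : tup * tup => U1 w1 (S w2 p.1)).
    apply: (measurableT_comp (measurable_U1 w1)).
    exact: (measurableT_comp (measurable_S w2) measurable_fst).
  have mU2 : measurable_fun setT
      (fun p : tup * tup => U2 w1 w2 (S w2 p.1) (T w2 p.1 p.2)).
    apply: (measurableT_comp (measurable_U2 w1 w2)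
      (g := fun p => (S w2 p.1, T w2 p.1 p.2))).
    apply/measurable_fun_pairP; split => /=; last exact: measurable_T.
    exact: (measurableT_comp (measurable_S w2) measurable_fst).
  pose lhs p := 2 + ln N1 * \1_(E1 w1 w2) p.1 + ln N2 * \1_D (T w2 p.1 p.2)
    + noise p.1 p.2.
  pose rhs p := K + Q w1 w2 p.1 p.2 + U1 w1 (S w2 p.1)
    + U2 w1 w2 (S w2 p.1) (T w2 p.1 p.2).
  have -> : (2 + p1 w1 w2 * ln N1 + p2 w1 w2 * ln N2 + n%:R * 2)%:E =
      (\int[gauss \x gauss]_p (lhs p)%:E)%E.
    rewrite /lhs.
    have g1 (p : tup * tup) : 0 <= ln N1 * \1_(E1 w1 w2) p.1 by rewrite mulr_ge0.
    have g2 (p : tup * tup) : 0 <= ln N2 * \1_D (T w2 p.1 p.2) by rewrite mulr_ge0.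
    have n1 : measurable_fun setT (fun p : tup * tup => ln N1 * \1_(E1 w1 w2) p.1).
      exact: measurable_funM.
    have n2 : measurable_fun setT
        (fun p : tup * tup => ln N2 * \1_D (T w2 p.1 p.2)) by exact: measurable_funM.
    rewrite ge0_integral_EFinD; last 4 first.
    - by move=> p; rewrite !addr_ge0.
    - by move=> p; exact: noise_ge0.
    - by do 2 (apply: measurable_funD => //).
    - exact: measurable_noise.
    rewrite ge0_integral_EFinD//; last 2 first.
    - by move=> p; rewrite !addr_ge0.
    - exact: measurable_funD.
    rewrite ge0_integral_EFinD// !ge0_integral_EFinZ// i1 i2 integral_noise.
    rewrite [X in (X + _ + _ + _)%E]integral_cst_probability.
    by rewrite -!EFinM -!EFinD; congr EFin; ring.
  have -> : ((K + Qbar w1 w2)%:E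
    + \int[gauss \x gauss]_p (U1 w1 (S w2 p.1))%:E
    + \int[gauss \x gauss]_p (U2 w1 w2 (S w2 p.1) (T w2 p.1 p.2))%:E =
      \int[gauss \x gauss]_p (rhs p)%:E)%E.
    rewrite /rhs.
    have n1 : measurable_fun setT (fun p : tup * tup => K + Q w1 w2 p.1 p.2).
      by apply: measurable_funD => //; exact: measurable_Q.
    rewrite ge0_integral_EFinD//; last 3 first.
    - by move=> p; rewrite !addr_ge0// ltW.
    - by move=> p; rewrite ltW.
    - exact: measurable_funD.
    rewrite ge0_integral_EFinD//; last 2 first.
    - by move=> p; rewrite addr_ge0.
    - by move=> p; rewrite ltW.
    rewrite ge0_integral_EFinD// integral_Q.
    by rewrite [X in (_ = X + _ + _ + _)%E]integral_cst_probability EFinD.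
  apply: ge0_le_integral => //.
  - move=> p _; rewrite lee_fin /lhs addr_ge0 ?noise_ge0//.
    by rewrite !addr_ge0// mulr_ge0.
  - apply/measurable_EFinP; apply: measurable_funD; last exact: measurable_noise.
    by apply: measurable_funD; [apply: measurable_funD => //|]; exact: measurable_funM.
  - apply/measurable_EFinP; apply: measurable_funD => //; apply: measurable_funD => //.
    by apply: measurable_funD => //; exact: measurable_Q.
  - move=> p _; rewrite lee_fin.
    have := pointwise w1 w2 p.1 p.2.
    by rewrite (nat_eq_indic tup tup) (nat_eq_indic tup tup).
have : (\sum_w1 \sum_w2
     (2 + p1 w1 w2 * ln N1 + p2 w1 w2 * ln N2 + n%:R * 2)%:E <=
    \sum_w1 \sum_w2 ((K + Qbar w1 w2)%:E
    + \int[gauss \x gauss]_p (U1 w1 (S w2 p.1))%:E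
    + \int[gauss \x gauss]_p (U2 w1 w2 (S w2 p.1) (T w2 p.1 p.2))%:E))%E.
  by apply: lee_sum => w1 _; apply: lee_sum => w2 _; exact: main.
under [leRHS]eq_bigr do rewrite big_split big_split /=.
rewrite [leRHS]big_split [in leRHS]big_split /= => h.
have {h} := le_trans h (leeD (leeD (lexx _) integral_U1) integral_U2).
under eq_bigr do rewrite sumEFin; rewrite sumEFin.
under [in leRHS]eq_bigr do rewrite sumEFin; rewrite sumEFin.
rewrite -!EFinD lee_fin.
have sumD (f g : W1 -> W2 -> R) : \sum_w1 \sum_w2 (f w1 w2 + g w1 w2) =
    \sum_w1 \sum_w2 f w1 w2 + \sum_w1 \sum_w2 g w1 w2.
  by under eq_bigr do rewrite big_split; rewrite big_split.
have sumM (f : W1 -> W2 -> R) r : \sum_w1 \sum_w2 f w1 w2 * r =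
    (\sum_w1 \sum_w2 f w1 w2) * r.
  by under eq_bigr do rewrite -mulr_suml; rewrite -mulr_suml.
have sumC (r : R) : \sum_(w1 : W1) \sum_(w2 : W2) r = N1 * N2 * r.
  by under eq_bigr do rewrite sumr_const; rewrite sumr_const
    -[_ *+ _ *+ _]mulr_natl -[r *+ _]mulr_natl mulrA.
rewrite !sumD !sumM !sumC sum_Qbar.
by lra.
Qed.

End core_inequality.

(** * Laws of a block of noise and of a block of fading and noise *)

Lemma path_measurable_tuple {d'} {S : measurableType d'} n (B : set (n.-tuple S)) :
  measurable B -> path_measurable [set x : nat -> S | B [tuple x i | i < n]].
Proof.
move: B; pose f (x : nat -> S) := [tuple x i | i < n].
pose G : set (set (n.-tuple S)) := [set B | path_measurable (f @^-1` B)].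
change (measurable `<=` G).
have [p0 pC pU] := smallest_sigma_algebra setT
  (\bigcup_i preimage_set_system setT (fun x : nat -> S => x i) measurable).
apply: smallest_sub.
  split; first by rewrite /G /= preimage_set0.
  - by move=> A GA; rewrite /G /= setTD preimage_setC -setTD; exact: pC.
  - by move=> A GA; rewrite /G /= preimage_bigcup; exact: pU.
move=> C; rewrite -bigcup_seq => -[i _] [D mD <-].
apply: sub_sigma_algebra; exists i => //; exists D => //.
by rewrite !setTI; apply/seteqP; split => x /=; rewrite tnth_mktuple.
Qed.

Section noise_law.
Context {R : realType} {d : measure_display} {T : measurableType d}.
Variable P : probability T R.
Notation C := (R[i]).

Lemma standard_complex_gaussian_law (Z : {RV P >-> C}) (A : set C) :
  standard_complex_gaussian Z -> measurable A -> P (Z @^-1` A) = gaussC A.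
Proof.
move=> gZ [B mB <-]; rewrite setTI.
pose reim (z : C) : measurableTypeR R * measurableTypeR R :=
  (complex.Re z, complex.Im z).
have mreim : measurable_fun setT reim.
  apply/measurable_fun_pairP; split; [exact: measurable_Re|exact: measurable_Im].
have mf : measurable_fun setT (reim \o Z).
  exact: (measurableT_comp mreim (measurable_funPT Z)).
pose Q : {measure set (measurableTypeR R * measurableTypeR R) -> \bar R} :=
  (pushforward P (reim \o Z)).
transitivity (Q mf B); first by [].
by rewrite -(product_measure_unique (m1 := gauss1) (m2 := gauss1)).
Qed.

Lemma gaussian_noise_law (Z : nat -> {RV P >-> C}) n (B : set (n.-tuple C)) :
  (forall i, standard_complex_gaussian (Z i)) -> mutually_independent Z ->
  measurable B -> P [set t | B [tuple Z i t | i < n]] = gaussn n B.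
Proof.
move=> gZ iZ mB.
have mZ : measurable_fun setT (fun t => [tuple Z i t | i < n]).
  by apply: measurable_mktuple => i; exact: measurable_funPT.
pose Ztup : {RV P >-> n.-tuple C} :=
  HB.pack (fun t => [tuple Z i t | i < n]) (isMeasurableFun.Build _ _ _ _ _ mZ).
apply: (pow_prob_unique _ _ _ gaussC n (distribution P Ztup)) => // A mA.
(* Mutual independence is stated for families of sets indexed by [nat]; indices from [n] on receive
   the full set. *)
pose A' j := if insub j is Some i then A i else setT.
have mA' j : measurable (A' j) by rewrite /A'; case: insubP.
have A'E (i : 'I_n) : A' i = A i by rewrite /A' valK.
have := iZ [fset j in iota 0 n]%fset A' mA'.
rewrite (perm_big (iota 0 n)); last first.
  apply: uniq_perm; rewrite ?fset_uniq ?iota_uniq// => j.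
  by rewrite inE.
have -> : (\big[*%E/1%E]_(j <- iota 0 n) P (Z j @^-1` A' j) = \prod_i gaussC (A i))%E.
  rewrite -{1}(subn0 n) -/(index_iota 0 n) big_mkord; apply: eq_bigr => i _.
  by rewrite A'E; exact: standard_complex_gaussian_law.
move=> <-; rewrite /distribution /pushforward; congr (P _).
apply/seteqP; split => t /=.
  move=> h j /=; rewrite inE mem_iota add0n => /andP[_ jn].
  have := h (Ordinal jn); rewrite tnth_mktuple /= /preimage /=.
  by have := A'E (Ordinal jn) => /= ->.
move=> h i; rewrite tnth_mktuple -A'E; apply: h => /=.
by rewrite inE mem_iota add0n ltn_ord.
Qed.

(** By independence the joint law is a product: given the fading the noise is still standard, so the
    bound for fixed channels applies to each realization of the states. *)
Lemma joint_law {d'} {S : measurableType d'} (H : nat -> {RV P >-> S})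
    (Z : nat -> {RV P >-> C}) n (E : set (n.-tuple S * n.-tuple C)) :
  (forall i, standard_complex_gaussian (Z i)) -> mutually_independent Z ->
  independent_processes H Z -> measurable E ->
  P [set t | E ([tuple H i t | i < n], [tuple Z i t | i < n])] =
  (\int[P]_t gaussn n [set z | E ([tuple H i t | i < n], z)])%E.
Proof.
move=> gZ iZ iHZ mE.
have mZ : measurable_fun setT (fun t => [tuple Z i t | i < n]).
  by apply: measurable_mktuple => i; exact: measurable_funPT.
have mH : measurable_fun setT (fun t => [tuple H i t | i < n]).
  by apply: measurable_mktuple => i; exact: measurable_funPT.
have mHZ : measurable_fun setT
   (fun t => ([tuple H i t | i < n], [tuple Z i t | i < n])).
  exact/measurable_fun_pairP.
pose Htup : {RV P >-> n.-tuple S} :=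
  HB.pack (fun t => [tuple H i t | i < n]) (isMeasurableFun.Build _ _ _ _ _ mH).
pose Q : {measure set (n.-tuple S * n.-tuple C) -> \bar R} :=
  pushforward P (fun t => ([tuple H i t | i < n], [tuple Z i t | i < n])).
transitivity (Q mHZ E); first by [].
rewrite -(product_measure_unique (m1 := distribution P Htup) (m2 := gaussn n))//.
  rewrite /product_measure1 ge0_integral_distribution//.
  - by apply: eq_integral => t _; congr (gaussn n _); apply/seteqP; split => z /=;
      rewrite /xsection /= inE.
  - exact: measurable_fun_xsection.
move=> A B mA mB.
etransitivity.
  exact: (iHZ _ _ (path_measurable_tuple _ _ mA) (path_measurable_tuple _ _ mB)).
congr (_ * _)%E; exact: (gaussian_noise_law _ _ _ gZ iZ mB).
Qed.

End noise_law.

(** * Power policies *)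

Section conditional_expectation.
Context {R : realType} {d : measure_display} {T : measurableType d}.
Variable P : probability T R.

Lemma density_finite_measure (r : T -> \bar R) :
  measurable_fun setT r -> (forall t, 0 <= r t)%E -> (\int[P]_t r t < +oo)%E ->
  exists nu : {finite_measure set T -> \bar R},
    forall A, measurable A -> nu A = (\int[P]_(t in A) r t)%E.
Proof.
move=> mr r0 intr.
pose nu0 (A : set T) := (\int[P]_(t in A) r t)%E.
have nu00 : nu0 set0 = 0%E by rewrite /nu0 integral_set0.
have nu0_ge0 A : (0 <= nu0 A)%E by apply: integral_ge0.
have nu0_sigma : semi_sigma_additive nu0.
  move=> F mF tF mUF; rewrite /nu0 ge0_integral_bigcup//; last exact: measurable_funTS.
  by apply: is_cvg_ereal_nneg_natsum_cond => i _ _; exact: nu0_ge0.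
pose nu1 := isMeasure.Build _ _ _ nu0 nu00 nu0_ge0 nu0_sigma.
pose nu2 : {measure set T -> \bar R} := HB.pack nu0 nu1.
have nu_fin : fin_num_fun nu2.
  move=> A mA; rewrite ge0_fin_numE; last exact: nu0_ge0.
  by apply: le_lt_trans intr; apply: ge0_subset_integral.
pose nu : {finite_measure set T -> \bar R} :=
  HB.pack nu0 nu1 (Measure_isFinite.Build _ _ _ nu2 nu_fin).
by exists nu.
Qed.

(** The image under [X] of the measure with density [q] is absolutely continuous with respect to the
    law of [X]. Its derivative lives on [S], so it represents the conditional mean of [q] as a
    function of the current state, the form that a policy needs. *)
Lemma conditional_expectation {d'} {S : measurableType d'} (X : {RV P >-> S})
    (q : T -> R) :
  measurable_fun setT q -> (forall t, 0 <= q t) -> (\int[P]_t (q t)%:E < +oo)%E ->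
  exists p : S -> R, [/\ measurable_fun setT p, (forall s, 0 <= p s) &
    forall g : S -> \bar R, measurable_fun setT g -> (forall s, 0 <= g s)%E ->
      (\int[P]_t (g (X t) * (q t)%:E) = \int[P]_t (g (X t) * (p (X t))%:E))%E].
Proof.
move=> mq q0 intq.
have mqE : measurable_fun setT (fun t => (q t)%:E) by exact/measurable_EFinP.
have q0E t : (0 <= (q t)%:E)%E by rewrite lee_fin.
have [nu nuE] := density_finite_measure _ mqE q0E intq.
have mX : measurable_fun setT X by exact: measurable_funPT.
have mpre A : measurable A -> measurable (X @^-1` A).
  by move=> mA; rewrite -[Y in measurable Y]setTI; exact: mX measurableT _ mA.
pose nuX0 : {measure set S -> \bar R} := pushforward nu X.
have nuX_fin : fin_num_fun (nuX0 mX).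
  by move=> A mA; apply: (fin_num_measure nu); exact: mpre.
pose nuX1 : {finite_measure set S -> \bar R} :=
  HB.pack (pushforward nu X) (Measure_isFinite.Build _ _ _ (nuX0 mX) nuX_fin).
pose nuX := nuX1 mX.
pose mu := distribution P X.
have nuXmu : nuX `<< mu.
  apply/null_content_dominatesP => A mA muA.
  rewrite /nuX /= /pushforward nuE; last exact: mpre.
  by apply: null_set_integral => //; [exact: mpre|exact: measurable_funTS].
pose f := Radon_Nikodym_SigmaFinite.f nuX mu.
have mf : measurable_fun setT f.
  by apply: measurable_int; exact: Radon_Nikodym_SigmaFinite.f_integrable.
have f0 s : (0 <= f s)%E by exact: Radon_Nikodym_SigmaFinite.f_ge0.
have ffin s : f s \is a fin_num by exact: Radon_Nikodym_SigmaFinite.f_fin_num.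
exists (fine \o f); split.
- exact: measurableT_comp.
- by move=> s; exact: fine_ge0.
- move=> g mg g0.
  transitivity (\int[nu]_t g (X t))%E.
    rewrite (ge0_integral_density _ _ _ nu P (fun t => (q t)%:E))//.
    exact: (measurableT_comp mg mX).
  transitivity (\int[nuX]_s g s)%E.
    by rewrite (ge0_integral_pushforward mX).
  rewrite -(Radon_Nikodym_SigmaFinite.change_of_variables nuXmu g0 measurableT mg).
  rewrite ge0_integral_distribution//.
  + by apply: eq_integral => t _; rewrite /= fineK.
  + exact: emeasurable_funM.
  + by move=> s; rewrite mule_ge0.
Qed.

End conditional_expectation.

(** * The sum rate as a function of the powers, and its concavity *)

Section rate.
Context {R : realType}.
Implicit Types a b c x y : R.

(** [a] and [c] are direct gains, and [b] is the gain through which the user of power [y] disturbs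
    the user of power [x]. *)
Definition rate a b c x y : R := Cfun (a * x / (1 + b * y)) + Cfun (c * y).

Let ln2_gt0 : 0 < ln 2 :> R. Proof. by rewrite ln_gt0// ltr1n. Qed.

Lemma Cfun_ge0 x : 0 <= x -> 0 <= Cfun x.
Proof. by move=> x0; rewrite divr_ge0 ?ln_ge0// ?lerDl// ltW. Qed.

Lemma rate_ge0 a b c x y : 0 <= a -> 0 <= b -> 0 <= c -> 0 <= x -> 0 <= y ->
  0 <= rate a b c x y.
Proof.
move=> a0 b0 c0 x0 y0; rewrite addr_ge0// Cfun_ge0 ?mulr_ge0// invr_ge0 addr_ge0//.
exact: mulr_ge0.
Qed.

Lemma measurable_Cfun d (T : measurableType d) (f : T -> R) :
  measurable_fun setT f -> measurable_fun setT (fun t => Cfun (f t)).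
Proof.
move=> mf; apply: measurable_funM => //.
by apply: (measurableT_comp (@measurable_ln R)); exact: measurable_funD.
Qed.

Lemma measurable_rate d (T : measurableType d) (a b c x y : T -> R) :
  measurable_fun setT a -> measurable_fun setT b -> measurable_fun setT c ->
  measurable_fun setT x -> measurable_fun setT y ->
  (forall t, 0 <= b t) -> (forall t, 0 <= y t) ->
  measurable_fun setT (fun t => rate (a t) (b t) (c t) (x t) (y t)).
Proof.
move=> ma mb mc mx my b0 y0; apply: measurable_funD; apply: measurable_Cfun;
  last exact: measurable_funM.
apply: measurable_funM; first exact: measurable_funM.
apply: measurable_fun_inv_gt0; first by move=> t; rewrite ltr_pwDl// mulr_ge0.
by apply: measurable_funD => //; exact: measurable_funM.
Qed.

(* The slopes of the tangent plane of [rate a b c] at [(x, y)]; the maximum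
   only matters off [b <= c]. *)
Definition slope1 a b x y : R := a / (1 + a * x + b * y) / ln 2.
Definition slope2 a b c x y : R := (b / (1 + a * x + b * y)
  + Num.max 0 (c / (1 + c * y) - b / (1 + b * y))) / ln 2.

Section slopes.
Variables (a b c x y : R).
Hypotheses (a0 : 0 <= a) (b0 : 0 <= b) (c0 : 0 <= c) (x0 : 0 <= x) (y0 : 0 <= y).

Let den_gt0 : 0 < 1 + a * x + b * y.
Proof. by rewrite -addrA ltr_pwDl// addr_ge0// mulr_ge0. Qed.

Lemma slope1_ge0 : 0 <= slope1 a b x y.
Proof. by rewrite /slope1 !divr_ge0// ltW. Qed.

Lemma slope2_ge0 : 0 <= slope2 a b c x y.
Proof.
by rewrite /slope2 divr_ge0//; [rewrite addr_ge0 ?divr_ge0// ?le_max ?lexx// ltW|rewrite ltW].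
Qed.

(** This bound and the next are uniform in the gains: they make the tangent terms integrable
    whatever the law of the fading. *)
Lemma slope1_le : slope1 a b x y * x <= (ln 2)^-1.
Proof.
have by0 := mulr_ge0 b0 y0.
have h : a / (1 + a * x + b * y) * x <= 1.
  by rewrite mulrAC ler_pdivrMr// mul1r; lra.
by rewrite /slope1 mulrAC -[leRHS]mul1r ler_wpM2r// invr_ge0 ltW.
Qed.

Lemma slope2_le : slope2 a b c x y * y <= 2 / ln 2.
Proof.
rewrite /slope2 mulrAC; apply: ler_wpM2r; first by rewrite invr_ge0 ltW.
rewrite mulrDl.
have -> : (2 : R) = 1 + 1 by ring.
have by0 := mulr_ge0 b0 y0; have cy0 := mulr_ge0 c0 y0; have ax0 := mulr_ge0 a0 x0.
apply: lerD.
  by rewrite mulrAC ler_pdivrMr// mul1r; lra.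
apply: (@le_trans _ _ (c / (1 + c * y) * y)); last first.
  by rewrite mulrAC ler_pdivrMr ?ltr_pwDl// mul1r; lra.
rewrite ler_wpM2r// ge_max divr_ge0//= ?addr_ge0//.
by rewrite gerBl divr_ge0// addr_ge0.
Qed.

End slopes.

(** This form displays the concavity: the first logarithm is concave in the powers, and so is the
    second when [b <= c]. *)
Lemma rateE a b c x y : 0 <= a -> 0 <= b -> 0 <= c -> 0 <= x -> 0 <= y ->
  rate a b c x y =
  (ln (1 + a * x + b * y) + ln ((1 + c * y) / (1 + b * y))) / ln 2.
Proof.
move=> a0 b0 c0 x0 y0; rewrite /rate /Cfun -mulrDl; congr (_ / _).
have by0 := mulr_ge0 b0 y0; have cy0 := mulr_ge0 c0 y0; have ax0 := mulr_ge0 a0 x0.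
have -> : 1 + a * x / (1 + b * y) = (1 + a * x + b * y) / (1 + b * y).
  by field; rewrite lt0r_neq0// ltr_pwDl.
by rewrite !ln_div ?posrE//; [ring|lra..].
Qed.

(** Concavity, stated as the graph lying below its tangent plane at [(x0, y0)], with every term on
    the side where it is nonnegative. *)
Lemma rate_tangent a b c x y x0 y0 : 0 <= a -> 0 <= b -> b <= c ->
  0 <= x -> 0 <= y -> 0 <= x0 -> 0 <= y0 ->
  rate a b c x y + slope1 a b x0 y0 * x0 + slope2 a b c x0 y0 * y0 <=
  rate a b c x0 y0 + slope1 a b x0 y0 * x + slope2 a b c x0 y0 * y.
Proof.
move=> a0 b0 bc xx yy xx0 yy0; have c0 : 0 <= c by exact: le_trans bc.
have by_ := mulr_ge0 b0 yy; have cy := mulr_ge0 c0 yy; have ax := mulr_ge0 a0 xx.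
have by0 := mulr_ge0 b0 yy0; have cy0 := mulr_ge0 c0 yy0; have ax0 := mulr_ge0 a0 xx0.
have ln_le (r : R) : 0 < r -> ln r <= r - 1.
  by move=> r0; rewrite -{1}(subrKC 1 r); apply: le_ln1Dx; lra.
rewrite !rateE// /slope1 /slope2.
set D := 1 + a * x0 + b * y0.
have D0 : 0 < D by rewrite /D; lra.
have B0 : 0 < 1 + b * y0 by lra.
have C0 : 0 < 1 + c * y0 by lra.
have B : 0 < 1 + b * y by lra.
have C : 0 < 1 + c * y by lra.
have -> : Num.max 0 (c / (1 + c * y0) - b / (1 + b * y0)) =
    (c - b) / ((1 + c * y0) * (1 + b * y0)).
  have -> : c / (1 + c * y0) - b / (1 + b * y0) = (c - b) / ((1 + c * y0) * (1 + b * y0)).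
    by field; rewrite !lt0r_neq0.
  by apply/max_idPr; rewrite divr_ge0 ?subr_ge0// mulr_ge0// ltW.
have t1 : ln (1 + a * x + b * y) <= ln D + a / D * (x - x0) + b / D * (y - y0).
  have : ln ((1 + a * x + b * y) / D) <= (1 + a * x + b * y) / D - 1.
    by apply: ln_le; rewrite divr_gt0//; lra.
  rewrite ln_div ?posrE//; last by lra.
  have -> : (1 + a * x + b * y) / D - 1 = a / D * (x - x0) + b / D * (y - y0).
    by rewrite /D; field; rewrite lt0r_neq0// -/D.
  by lra.
have t2 : ln ((1 + c * y) / (1 + b * y)) <= ln ((1 + c * y0) / (1 + b * y0))
    + (c - b) / ((1 + c * y0) * (1 + b * y0)) * (y - y0).
  pose r := ((1 + c * y) / (1 + b * y)) / ((1 + c * y0) / (1 + b * y0)).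
  have r0 : 0 < r by rewrite !divr_gt0.
  have := ln_le _ r0; rewrite {1}/r [X in X <= _]ln_div ?posrE ?divr_gt0//.
  have -> : r - 1 = (c - b) * (y - y0) / ((1 + b * y) * (1 + c * y0)).
    by rewrite /r; field; rewrite !lt0r_neq0.
  (* The bound by [r - 1] has [1 + b * y] where the tangent has [1 + b * y0]; the difference is
     [(c - b) * b] times a square over a positive product, and this is where [b <= c] enters. *)
  suff : (c - b) * (y - y0) / ((1 + b * y) * (1 + c * y0)) <=
      (c - b) / ((1 + c * y0) * (1 + b * y0)) * (y - y0) by lra.
  rewrite -subr_ge0.
  have -> : (c - b) / ((1 + c * y0) * (1 + b * y0)) * (y - y0) -
      (c - b) * (y - y0) / ((1 + b * y) * (1 + c * y0)) =
      (c - b) * b * (y - y0) ^+ 2 / ((1 + c * y0) * (1 + b * y0) * (1 + b * y)).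
    by field; rewrite !lt0r_neq0.
  apply: divr_ge0; last by apply: mulr_ge0; [apply: mulr_ge0|]; exact: ltW.
  by apply: mulr_ge0; [rewrite mulr_ge0 ?subr_ge0|exact: sqr_ge0].
have I0 : 0 <= (ln 2)^-1 :> R by rewrite invr_ge0 ltW.
move: (lerD t1 t2); rewrite -subr_ge0 => /mulr_ge0 /(_ I0).
move=> h; rewrite -subr_ge0; move: h; congr (is_true (_ <= _)).
move: (ln (1 + a * x + b * y)) (ln ((1 + c * y) / (1 + b * y))) (ln D)
  (ln ((1 + c * y0) / (1 + b * y0))) (D^-1) (((1 + c * y0) * (1 + b * y0))^-1) (ln 2)^-1.
by move=> *; ring.
Qed.

End rate.

(** * Jensen's inequality for the rate *)

Section jensen.
Context {R : realType} {d d' : measure_display} {T : measurableType d}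
  {S : measurableType d'}.
Variable P : probability T R.
Variables a b c : S -> R.
Hypotheses (ma : measurable_fun setT a) (mb : measurable_fun setT b)
  (mc : measurable_fun setT c).
Hypotheses (a0 : forall s, 0 <= a s) (b0 : forall s, 0 <= b s)
  (c0 : forall s, 0 <= c s).

Let measurable_den (x y : S -> R) : measurable_fun setT x -> measurable_fun setT y ->
  measurable_fun setT (fun s => 1 + a s * x s + b s * y s).
Proof.
by move=> mx my; apply: measurable_funD; [apply: measurable_funD => //|];
  exact: measurable_funM.
Qed.

Let den_gt0 (x y : S -> R) s : (forall s, 0 <= x s) -> (forall s, 0 <= y s) ->
  0 < 1 + a s * x s + b s * y s.
Proof. by move=> x0 y0; rewrite -addrA ltr_pwDl// addr_ge0// mulr_ge0. Qed.

Lemma measurable_slope1 (x y : S -> R) :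
  measurable_fun setT x -> measurable_fun setT y ->
  (forall s, 0 <= x s) -> (forall s, 0 <= y s) ->
  measurable_fun setT (fun s => slope1 (a s) (b s) (x s) (y s)).
Proof.
move=> mx my x0 y0; apply: measurable_funM => //; apply: measurable_funM => //.
by apply: measurable_fun_inv_gt0; [move=> s; exact: den_gt0|exact: measurable_den].
Qed.

Lemma measurable_slope2 (x y : S -> R) :
  measurable_fun setT x -> measurable_fun setT y ->
  (forall s, 0 <= x s) -> (forall s, 0 <= y s) ->
  measurable_fun setT (fun s => slope2 (a s) (b s) (c s) (x s) (y s)).
Proof.
move=> mx my x0 y0; apply: measurable_funM => //.
have maff (f : S -> R) : measurable_fun setT f -> (forall s, 0 <= f s) ->
    measurable_fun setT (fun s => f s / (1 + f s * y s)).
  move=> mf f0; apply: measurable_funM => //; apply: measurable_fun_inv_gt0.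
    by move=> s; rewrite ltr_pwDl// mulr_ge0.
  by apply: measurable_funD => //; exact: measurable_funM.
apply: measurable_funD.
  apply: measurable_funM => //.
  by apply: measurable_fun_inv_gt0; [move=> s; exact: den_gt0|exact: measurable_den].
by apply: measurable_maxr => //; apply: measurable_funB; exact: maff.
Qed.

(** Integrate the tangent inequality at the averaged powers [p1], [p2]. The slopes there depend on
    the state alone, so they are admissible test functions [g] and the linear terms on the two sides
    have the same sum over time. *)
Lemma rate_jensen n (H : 'I_n -> {RV P >-> S}) (q1 q2 : 'I_n -> T -> R)
    (p1 p2 : S -> R) :
  (forall i, {ae P, forall t, b (H i t) <= c (H i t)}) ->
  (forall i, measurable_fun setT (q1 i)) -> (forall i, measurable_fun setT (q2 i)) ->
  measurable_fun setT p1 -> measurable_fun setT p2 ->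
  (forall i t, 0 <= q1 i t) -> (forall i t, 0 <= q2 i t) ->
  (forall s, 0 <= p1 s) -> (forall s, 0 <= p2 s) ->
  (forall g : S -> \bar R, measurable_fun setT g -> (forall s, 0 <= g s)%E ->
    \sum_i \int[P]_t (g (H i t) * (q1 i t)%:E) =
    \sum_i \int[P]_t (g (H i t) * (p1 (H i t))%:E))%E ->
  (forall g : S -> \bar R, measurable_fun setT g -> (forall s, 0 <= g s)%E ->
    \sum_i \int[P]_t (g (H i t) * (q2 i t)%:E) =
    \sum_i \int[P]_t (g (H i t) * (p2 (H i t))%:E))%E ->
  (\sum_i \int[P]_t
     (rate (a (H i t)) (b (H i t)) (c (H i t)) (q1 i t) (q2 i t))%:E <=
   \sum_i \int[P]_t
     (rate (a (H i t)) (b (H i t)) (c (H i t)) (p1 (H i t)) (p2 (H i t)))%:E)%E.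
Proof.
move=> bc mq1 mq2 mp1 mp2 q10 q20 p10 p20 E1 E2.
pose al s := slope1 (a s) (b s) (p1 s) (p2 s).
pose be s := slope2 (a s) (b s) (c s) (p1 s) (p2 s).
have al0 s : 0 <= al s by apply: slope1_ge0.
have be0 s : 0 <= be s by apply: slope2_ge0.
have mal : measurable_fun setT al by exact: measurable_slope1.
have mbe : measurable_fun setT be by exact: measurable_slope2.
have mH (i : 'I_n) (f : S -> R) : measurable_fun setT f ->
    measurable_fun setT (fun t => f (H i t)).
  by move=> mf; apply: (measurableT_comp mf); exact: measurable_funPT.
have mrate i (x y : T -> R) : measurable_fun setT x -> measurable_fun setT y ->
    (forall t, 0 <= y t) -> measurable_fun setT
    (fun t => rate (a (H i t)) (b (H i t)) (c (H i t)) (x t) (y t)).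
  by move=> mx my y0; apply: measurable_rate => //; exact: mH.
have rate0 i (x y : T -> R) t : 0 <= x t -> 0 <= y t ->
    0 <= rate (a (H i t)) (b (H i t)) (c (H i t)) (x t) (y t).
  by move=> x0 y0; exact: rate_ge0.
have split3 i (x y x' y' : T -> R) :
    measurable_fun setT x -> measurable_fun setT y -> (forall t, 0 <= x t) ->
    (forall t, 0 <= y t) ->
    measurable_fun setT x' -> measurable_fun setT y' -> (forall t, 0 <= x' t) ->
    (forall t, 0 <= y' t) ->
    (\int[P]_t (rate (a (H i t)) (b (H i t)) (c (H i t)) (x t) (y t)
       + al (H i t) * x' t + be (H i t) * y' t)%:E =
     \int[P]_t (rate (a (H i t)) (b (H i t)) (c (H i t)) (x t) (y t))%:E
     + \int[P]_t ((al (H i t))%:E * (x' t)%:E)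
     + \int[P]_t ((be (H i t))%:E * (y' t)%:E))%E.
  move=> mx my x0 y0 mx' my' x'0 y'0.
  have m1 : measurable_fun setT (fun t => al (H i t) * x' t).
    by apply: measurable_funM => //; exact: mH.
  have m2 : measurable_fun setT (fun t => be (H i t) * y' t).
    by apply: measurable_funM => //; exact: mH.
  have m3 := mrate i _ _ mx my y0.
  rewrite ge0_integral_EFinD//.
  - by rewrite ge0_integral_EFinD// => t; [exact: rate0|rewrite mulr_ge0].
  - by move=> t; apply: addr_ge0; [exact: rate_ge0|exact: mulr_ge0].
  - by move=> t; rewrite mulr_ge0.
  - exact: measurable_funD.
have mp1H i := mH i _ mp1; have mp2H i := mH i _ mp2.
have le3 i : (\int[P]_t (rate (a (H i t)) (b (H i t)) (c (H i t)) (q1 i t) (q2 i t)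
       + al (H i t) * p1 (H i t) + be (H i t) * p2 (H i t))%:E <=
    \int[P]_t (rate (a (H i t)) (b (H i t)) (c (H i t)) (p1 (H i t)) (p2 (H i t))
       + al (H i t) * q1 i t + be (H i t) * q2 i t)%:E)%E.
  apply: ae_ge0_le_integral => //.
  - move=> t _; rewrite lee_fin; apply: addr_ge0; last exact: mulr_ge0.
    by apply: addr_ge0; [exact: rate_ge0|exact: mulr_ge0].
  - apply/measurable_EFinP; apply: measurable_funD; last by apply: measurable_funM => //; exact: mH.
    apply: measurable_funD; last by apply: measurable_funM => //; exact: mH.
    exact: (mrate i (q1 i) (q2 i)).
  - move=> t _; rewrite lee_fin; apply: addr_ge0; last exact: mulr_ge0.
    by apply: addr_ge0; [exact: rate_ge0|exact: mulr_ge0].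
  - apply/measurable_EFinP; apply: measurable_funD; last by apply: measurable_funM => //; exact: mH.
    apply: measurable_funD; last by apply: measurable_funM => //; exact: mH.
    exact: (mrate i (fun t => p1 (H i t)) (fun t => p2 (H i t))).
  - by apply: filterS (bc i) => t bct _; rewrite lee_fin; exact: rate_tangent.
have : (\sum_i \int[P]_t (rate (a (H i t)) (b (H i t)) (c (H i t)) (q1 i t) (q2 i t))%:E
      + \sum_i \int[P]_t ((al (H i t))%:E * (p1 (H i t))%:E)
      + \sum_i \int[P]_t ((be (H i t))%:E * (p2 (H i t))%:E) <=
    \sum_i \int[P]_t (rate (a (H i t)) (b (H i t)) (c (H i t)) (p1 (H i t)) (p2 (H i t)))%:E
      + \sum_i \int[P]_t ((al (H i t))%:E * (q1 i t)%:E)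
      + \sum_i \int[P]_t ((be (H i t))%:E * (q2 i t)%:E))%E.
  rewrite -!big_split /=.
  apply: lee_sum => i _.
  rewrite -(split3 i (q1 i) (q2 i) (fun t => p1 (H i t)) (fun t => p2 (H i t)))//.
  by rewrite -(split3 i (fun t => p1 (H i t)) (fun t => p2 (H i t)) (q1 i) (q2 i)).
have malE : measurable_fun setT (fun s => (al s)%:E) by exact/measurable_EFinP.
have mbeE : measurable_fun setT (fun s => (be s)%:E) by exact/measurable_EFinP.
have al0E s : (0 <= (al s)%:E)%E by rewrite lee_fin.
have be0E s : (0 <= (be s)%:E)%E by rewrite lee_fin.
rewrite (E1 _ malE al0E) (E2 _ mbeE be0E).
(* Only the linear terms are cancelled, so only they have to be finite; the integrals of the rates
   may be infinite. *)
have fin (e : S -> R) (p : S -> R) k : measurable_fun setT e -> measurable_fun setT p ->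
    (forall s, 0 <= e s) -> (forall s, 0 <= p s) -> (forall s, e s * p s <= k) ->
    (\sum_i \int[P]_t ((e (H i t))%:E * (p (H i t))%:E) \is a fin_num)%E.
  move=> me mp e0 p0 ek; apply/sum_fin_numP => i _ _; rewrite ge0_fin_numE.
    apply: (@le_lt_trans _ _ (\int[P]_t k%:E)%E); last first.
      by rewrite integral_cst_probability ltry.
    apply: ge0_le_integral => //.
    - by move=> t _; rewrite -EFinM lee_fin mulr_ge0.
    - by apply/measurable_EFinP; apply: measurable_funM; exact: mH.
    - by move=> t _; rewrite -EFinM lee_fin.
  by apply: integral_ge0 => t _; rewrite -EFinM lee_fin mulr_ge0.
rewrite leeD2rE; last by apply: (fin be p2 (2 / ln 2)) => // s; exact: slope2_le.
by rewrite leeD2rE//; apply: (fin al p1 (ln 2)^-1) => // s; exact: slope1_le.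
Qed.

End jensen.

Lemma limn_einf_le (R : realType) (u : (\bar R)^nat) (c : \bar R) :
  (forall n, u n <= c)%E -> (limn_einf u <= c)%E.
Proof.
move=> uc; apply: (le_trans (limn_einf_sup u)); rewrite limn_esup_lim.
apply: lime_le; first exact: is_cvg_esups.
by apply: nearW => n; apply: ge_ereal_sup => _ [m _ <-].
Qed.

Lemma cvg_summable_increments (R : realType) (u : R^nat) :
  (\sum_(n <oo) `|u n.+1 - u n|%:E < +oo)%E -> cvgn u.
Proof.
move=> h.
have : cvgn (series (telescope u)).
  apply: normed_cvg; rewrite /normed_series_of.
  apply: nondecreasing_is_cvgn.
    apply: nondecreasing_series => k _ _; exact: normr_ge0.
  exists (fine (\sum_(n <oo) `|u n.+1 - u n|%:E)%E) => _ [n _ <-].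
  rewrite -lee_fin fineK; last first.
    by rewrite ge0_fin_numE// nneseries_ge0.
  rewrite /series /= -sumEFin; exact: nneseries_lim_ge.
move=> c; rewrite (_ : u = (fun n => u 0%N + series (telescope u) n)).
  by apply: is_cvgD => //; exact: is_cvg_cst.
by apply/funext => n; rewrite -eq_sum_telescope.
Qed.

(** * Existence of a policy that maximises the minimum of finitely many concave payoffs *)

Section optimal_policy.
Context {R : realType} {d : measure_display} {S : measurableType d}.
Variables (mu : probability S R) (Pbar : 'I_2 -> R) (J : finType).
Variable F : J -> S -> ('I_2 -> R) -> R.

Definition policy (p : 'I_2 -> S -> R) := forall k,
  [/\ measurable_fun setT (p k), forall s, 0 <= p k s &
      (\int[mu]_s (p k s)%:E <= (Pbar k)%:E)%E].

Definition payoff j p : \bar R := (\int[mu]_s (F j s (p^~ s))%:E)%E.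

Hypothesis Pbar_ge0 : forall k, 0 <= Pbar k.
Hypothesis F_meas : forall j p, policy p -> measurable_fun setT (fun s => F j s (p^~ s)).
Hypothesis F_ge0 : forall j s x, (forall k, 0 <= x k) -> 0 <= F j s x.
Hypothesis F_cont : forall j s (x : nat -> 'I_2 -> R) y,
  (forall n k, 0 <= x n k) -> (forall k, x n k @[n --> \oo] --> y k) ->
  F j s (x n) @[n --> \oo] --> F j s y.
Hypothesis F_concave : forall j, {ae mu, forall s, forall x y : 'I_2 -> R,
  (forall k, 0 <= x k) -> (forall k, 0 <= y k) ->
  F j s x + F j s y <= 2 * F j s (fun k => (x k + y k) / 2)}.
Variable w : 'I_2 -> R.
Hypotheses (w0 : forall k, 0 <= w k) (wP : forall k, w k * Pbar k <= 1).
(** Sublinear growth in the powers, uniformly over the policies: the part not covered by the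
    integrable [G] has mean at most [2 * e]. *)
Hypothesis F_dominated : forall e, 0 < e -> exists G : S -> R,
  [/\ measurable_fun setT G, forall s, 0 <= G s, (\int[mu]_s (G s)%:E < +oo)%E &
   forall j p, policy p ->
     {ae mu, forall s, F j s (p^~ s) <= G s + e * \sum_k w k * p k s}].

Let budget e p : 0 <= e -> policy p ->
  (\int[mu]_s (e * \sum_k w k * p k s)%:E <= (e * 2)%:E)%E.
Proof.
move=> e0 pp.
have mp k : measurable_fun setT (fun s => w k * p k s).
  by have [mpk _ _] := pp k; exact: measurable_funM.
have p0 k s : 0 <= w k * p k s by have [_ pk0 _] := pp k; rewrite mulr_ge0.
rewrite ge0_integral_EFinZ//; last 2 first.
- by move=> s; exact: sumr_ge0.
- exact: measurable_sum.
rewrite EFinM; apply: lee_wpmul2l; first by rewrite lee_fin.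
rewrite ge0_integral_EFin_sum//.
apply: (@le_trans _ _ (\sum_(k < 2) 1%:E)%E); last first.
  by rewrite sumEFin lee_fin sumr_const card_ord.
apply: lee_sum => k _; have [mpk pk0 pkP] := pp k.
rewrite ge0_integral_EFinZ//.
apply: (@le_trans _ _ ((w k)%:E * (Pbar k)%:E)%E); last by rewrite -EFinM lee_fin.
by apply: lee_wpmul2l => //; rewrite lee_fin.
Qed.

Let measurable_budget e p : policy p ->
  measurable_fun setT (fun s => e * \sum_k w k * p k s).
Proof.
move=> pp; apply: measurable_funM => //; apply: measurable_sum => k.
by have [mpk _ _] := pp k; exact: measurable_funM.
Qed.

(** Fatou is applied to the distance [h] from [F] to the majorant [B]. The majorant changes with the
    policy and may lose mean power in the limit, but its mean always lies between that of [G] and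
    that of [G] plus [e], so the loss is at most [e]. *)
Let payoff_usc (pn : nat -> 'I_2 -> S -> R) p j (r : R) :
  (forall n, policy (pn n)) -> policy p ->
  (forall k s, pn n k s @[n --> \oo] --> p k s) ->
  (forall n, r%:E <= payoff j (pn n))%E -> (r%:E <= payoff j p)%E.
Proof.
move=> pnp pp pnp_cvg rV.
have pn0 n s k : 0 <= pn n k s by have [_ ] := pnp n k.
have p0 s k : 0 <= p k s by have [_ ] := pp k.
apply/lee_addgt0Pr => e e0.
have e20 : 0 < e / 2 by rewrite divr_gt0.
have [G [mG G0 intG GP]] := F_dominated _ e20.
pose B q s : R := G s + e / 2 * \sum_k w k * q k s.
(* The absolute value keeps [h] nonnegative everywhere, since [F] is below [B] only almost
   everywhere. *)
pose h q s : R := `|B q s - F j s (q^~ s)|.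
have mB q : policy q -> measurable_fun setT (B q).
  by move=> qp; apply: measurable_funD => //; exact: measurable_budget.
have mh q : policy q -> measurable_fun setT (h q).
  move=> qp; apply: measurableT_comp => //.
  by apply: measurable_funB; [exact: mB|exact: F_meas].
have h0 q s : 0 <= h q s by exact: normr_ge0.
have Gfin : (\int[mu]_s (G s)%:E)%E \is a fin_num.
  by rewrite ge0_fin_numE// integral_ge0// => s _; rewrite lee_fin.
have step1 n : (\int[mu]_s (h (pn n) s)%:E + payoff j (pn n) <=
    \int[mu]_s (G s)%:E + e%:E)%E.
  have Fn0 s : 0 <= F j s ((pn n)^~ s) by exact: F_ge0.
  have Bn0 s : 0 <= B (pn n) s.
    apply: addr_ge0 => //; apply: mulr_ge0; first exact: ltW.
    by apply: sumr_ge0 => k _; exact: mulr_ge0.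
  rewrite -ge0_integral_EFinD//; [|exact: mh|exact: F_meas].
  apply: (@le_trans _ _ (\int[mu]_s (B (pn n) s)%:E)%E).
    apply: ae_ge0_le_integral => //.
    - by move=> s _; rewrite lee_fin addr_ge0.
    - by apply/measurable_EFinP; apply: measurable_funD; [exact: mh|exact: F_meas].
    - by move=> s _; rewrite lee_fin.
    - by apply/measurable_EFinP; exact: mB.
    - apply: filterS (GP j (pn n) (pnp n)) => s Fs _.
      by rewrite lee_fin /h ger0_norm ?subr_ge0// subrK.
  rewrite /B ge0_integral_EFinD//; last 2 first.
  - move=> s; apply: mulr_ge0; first exact: ltW.
    by apply: sumr_ge0 => k _; exact: mulr_ge0.
  - exact: measurable_budget.
  apply: leeD => //; apply: (le_trans (budget _ _ (ltW e20) (pnp n))).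
  by rewrite divfK.
have step2 n : (\int[mu]_s (h (pn n) s)%:E <= \int[mu]_s (G s)%:E + e%:E - r%:E)%E.
  rewrite leeBrDr//; apply: le_trans (step1 n).
  by apply: leeD.
have step3 : (\int[mu]_s (h p s)%:E <= \int[mu]_s (G s)%:E + e%:E - r%:E)%E.
  apply: le_trans (limn_einf_le _ _ _ step2).
  have mhn n : measurable_fun setT (fun s => (h (pn n) s)%:E).
    by apply/measurable_EFinP; exact: mh.
  apply: le_trans (fatou mu measurableT mhn _) => [|n s _]; last by rewrite lee_fin.
  rewrite le_eqVlt; apply/orP; left; apply/eqP; apply: eq_integral => s _.
  have hcvg : h (pn n) s @[n --> \oo] --> h p s.
    apply: cvg_norm; apply: cvgB; last exact: F_cont.
    apply: cvgD; first exact: cvg_cst.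
    apply: cvgMl_tmp; apply: (cvg_big add_continuous) => k _.
    exact: cvgMl_tmp.
  have hE : (h (pn n) s)%:E @[n --> \oo] --> (h p s)%:E by apply: cvg_EFin => //; exact: nearW.
  by have [-> _] := cvg_limn_einf_sup hE.
have step4 : (\int[mu]_s (G s)%:E <= \int[mu]_s (h p s)%:E + payoff j p)%E.
  rewrite -ge0_integral_EFinD//; [|by move=> s; exact: F_ge0|exact: mh|exact: F_meas].
  apply: ge0_le_integral => //.
  - by move=> s _; rewrite lee_fin.
  - exact/measurable_EFinP.
  - by apply/measurable_EFinP; apply: measurable_funD; [exact: mh|exact: F_meas].
  - move=> s _; rewrite lee_fin /h -lerBlDr; apply: le_trans (ler_norm _).
    rewrite lerD2r /B lerDl; apply: mulr_ge0; first exact: ltW.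
    by apply: sumr_ge0 => k _; exact: mulr_ge0.
have := le_trans step4 (leeD step3 (lexx _)).
rewrite -(fineK Gfin) -EFinN -!EFinD; case: (payoff j p) => [v||]; last first.
- by [].
- by move=> _; rewrite addye// leey.
by rewrite -!EFinD !lee_fin; lra.
Qed.

Definition mid (p q : 'I_2 -> S -> R) k s := (p k s + q k s) / 2.

Let policy_mid p q : policy p -> policy q -> policy (mid p q).
Proof.
move=> pp qp k; have [mp p0 pP] := pp k; have [mq q0 qP] := qp k; split.
- by apply: measurable_funM => //; exact: measurable_funD.
- by move=> s; rewrite divr_ge0 ?addr_ge0.
- rewrite /mid; under eq_integral do rewrite mulrC.
  rewrite ge0_integral_EFinZ//; [|by move=> s; exact: addr_ge0|exact: measurable_funD].
  rewrite ge0_integral_EFinD//.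
  apply: (@le_trans _ _ ((2^-1)%:E * ((Pbar k)%:E + (Pbar k)%:E))%E).
    by apply: lee_wpmul2l; [rewrite lee_fin invr_ge0|exact: leeD].
  by rewrite -EFinD -EFinM lee_fin; lra.
Qed.

Let payoff_mid p q j (r : R) : policy p -> policy q ->
  (r%:E <= payoff j p)%E -> (r%:E <= payoff j q)%E -> (r%:E <= payoff j (mid p q))%E.
Proof.
move=> pp qp rp rq.
have pF s : 0 <= F j s (p^~ s) by apply: F_ge0 => k; have [] := pp k.
have qF s : 0 <= F j s (q^~ s) by apply: F_ge0 => k; have [] := qp k.
have mF s : 0 <= F j s ((mid p q)^~ s).
  by apply: F_ge0 => k; have [] := policy_mid p q pp qp k.
have : (payoff j p + payoff j q <= 2%:E * payoff j (mid p q))%E.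
  rewrite -ge0_integral_EFinZ//; last exact/F_meas/policy_mid.
  rewrite -ge0_integral_EFinD//; [|exact: F_meas..].
  apply: ae_ge0_le_integral => //.
  - by move=> s _; rewrite lee_fin addr_ge0.
  - by apply/measurable_EFinP; apply: measurable_funD; exact: F_meas.
  - by move=> s _; rewrite lee_fin mulr_ge0.
  - apply/measurable_EFinP; apply: measurable_funM => //.
    exact/F_meas/policy_mid.
  - apply: filterS (F_concave j) => s Fs _; rewrite lee_fin.
    by apply: Fs => k; [have [] := pp k|have [] := qp k].
move=> /(le_trans (leeD rp rq)).
case: (payoff j (mid p q)) => [v||] /=.
- by rewrite -EFinM -EFinD !lee_fin; lra.
- by rewrite leey.
- by rewrite mulrNy gtr0_sg// mul1e.
Qed.

(** A strictly convex function of the powers that is bounded, so its mean is finite for every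
    policy. Minimising it selects one among the near-optimal policies. *)
Let util (p : 'I_2 -> S -> R) s : R := \sum_k expR (- p k s).

Let measurable_util p : policy p -> measurable_fun setT (util p).
Proof.
move=> pp; apply: measurable_sum => k; have [mp _ _] := pp k.
by apply: measurableT_comp => //; exact: measurableT_comp.
Qed.

Let util_ge0 p s : 0 <= util p s.
Proof. by apply: sumr_ge0 => k _; exact: expR_ge0. Qed.

Let disutility p : R := fine (\int[mu]_s (util p s)%:E)%E.

Let disutilityE p : policy p -> (\int[mu]_s (util p s)%:E = (disutility p)%:E)%E /\
  0 <= disutility p <= 2.
Proof.
move=> pp.
have le2 : (\int[mu]_s (util p s)%:E <= 2%:E)%E.
  rewrite -(integral_cst_probability _ _ _ mu 2%:E).
  apply: ge0_le_integral => //.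
  - by move=> s _; rewrite lee_fin.
  - by apply/measurable_EFinP; exact: measurable_util.
  - move=> s _; rewrite lee_fin; apply: (@le_trans _ _ (\sum_(k < 2) 1)); last first.
      by rewrite sumr_const card_ord.
    apply: ler_sum => k _; have [_ p0 _] := pp k.
    by rewrite -expR0 ler_expR oppr_le0.
have ge0 : (0 <= \int[mu]_s (util p s)%:E)%E.
  by apply: integral_ge0 => s _; rewrite lee_fin.
have fin : (\int[mu]_s (util p s)%:E)%E \is a fin_num.
  by rewrite ge0_fin_numE//; apply: le_lt_trans le2 _; rewrite ltry.
by rewrite /disutility fineK//; split => //; rewrite -!lee_fin fineK// ge0 le2.
Qed.

(** The square root of [expR (- p k s)]: the exponential at a midpoint is a product of two such
    roots, so the convexity defect in [util_mid] is exactly a square. *)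
Let half (p : 'I_2 -> S -> R) k s := expR (- p k s / 2).

Let measurable_half p k : policy p -> measurable_fun setT (half p k).
Proof.
move=> pp; have [mp _ _] := pp k; apply: measurableT_comp => //.
by apply: measurable_funM => //; exact: measurableT_comp.
Qed.

Let util_mid p q s :
  util (mid p q) s + 2^-1 * \sum_k (half p k s - half q k s) ^+ 2 =
  2^-1 * (util p s + util q s).
Proof.
rewrite /util -big_split /= !mulr_sumr -big_split /=; apply: eq_bigr => k _.
have hh x : expR (- x) = expR (- x / 2) ^+ 2 :> R.
  by rewrite -expRM_natl; congr expR; rewrite mulrC divfK.
rewrite (hh (p k s)) (hh (q k s)) /half.
have -> : expR (- mid p q k s) = expR (- p k s / 2) * expR (- q k s / 2).
  by rewrite -expRD /mid; congr expR; by field.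
by field.
Qed.

(** The hypothesis bounds the mean convexity defect, hence the mean square of the differences, by
    [2 * e]. The free parameter [l] converts this into a first-moment bound, summable along a
    sequence. *)
Let gap p q (l e : R) : policy p -> policy q -> 0 < l ->
  disutility p + disutility q <= 2 * (disutility (mid p q) + e) ->
  (\int[mu]_s (\sum_k `|half p k s - half q k s|)%:E <= (l + e / l)%:E)%E.
Proof.
move=> pp qp l0 he.
pose D s := \sum_k (half p k s - half q k s) ^+ 2.
have D0 s : 0 <= D s by apply: sumr_ge0 => k _; exact: sqr_ge0.
have mdiff k : measurable_fun setT (fun s => half p k s - half q k s).
  by apply: measurable_funB; exact: measurable_half.
have mD : measurable_fun setT D.
  by apply: measurable_sum => k; exact: measurable_funX.
have [pE _] := disutilityE p pp; have [qE _] := disutilityE q qp.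
have [mE _] := disutilityE _ (policy_mid p q pp qp).
have intD : (\int[mu]_s (D s)%:E <= (2 * e)%:E)%E.
  have : ((disutility (mid p q))%:E + 2^-1%:E * \int[mu]_s (D s)%:E =
      2^-1%:E * ((disutility p)%:E + (disutility q)%:E))%E.
    rewrite -pE -qE -mE -ge0_integral_EFinZ//.
    rewrite -ge0_integral_EFinD//; [|by move=> s; rewrite mulr_ge0|
      by apply: measurable_util; exact: policy_mid|exact: measurable_funM].
    rewrite -ge0_integral_EFinD//; [|exact: measurable_util..].
    rewrite -ge0_integral_EFinZ//; [|by move=> s; exact: addr_ge0|
      by apply: measurable_funD; exact: measurable_util].
    by apply: eq_integral => s _; rewrite util_mid.
  case: (\int[mu]_s (D s)%:E)%E => [v||] /=.
  - move=> h; have [hv] : (disutility (mid p q) + 2^-1 * v)%:E =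
        (2^-1 * (disutility p + disutility q))%:E by exact: h.
    by rewrite lee_fin; move: hv he;
      move: (disutility _) (disutility p) (disutility q) => x y z; lra.
  - by rewrite gt0_muley ?lte_fin ?invr_gt0.
  - by rewrite leNye.
apply: (@le_trans _ _ (\int[mu]_s (l + (2 * l)^-1 * D s)%:E)%E).
  apply: ge0_le_integral => //.
  - by move=> s _; rewrite lee_fin sumr_ge0.
  - apply/measurable_EFinP; apply: measurable_sum => k.
    exact: measurableT_comp.
  - by apply/measurable_EFinP; apply: measurable_funD => //; exact: measurable_funM.
  - move=> s _; rewrite lee_fin /D mulr_sumr.
    rewrite [X in X + _](_ : l = \sum_(k < 2) (l / 2)); last first.
      by rewrite sumr_const card_ord -[_ *+ 2]mulr_natr divfK.
    rewrite -big_split /=; apply: ler_sum => k _.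
    set x := half p k s - half q k s; rewrite -(real_normK (num_real x)).
    (* AM-GM: [|x| <= l / 2 + |x|^2 / (2 l)] *)
    rewrite -subr_ge0.
    have -> : l / 2 + (2 * l)^-1 * `|x| ^+ 2 - `|x| = (l - `|x|) ^+ 2 / (2 * l).
      by field; rewrite lt0r_neq0.
    by rewrite divr_ge0 ?sqr_ge0// mulr_ge0// ltW.
have l20 : 0 <= (2 * l)^-1 by rewrite invr_ge0 mulr_ge0// ltW.
rewrite ge0_integral_EFinD//; [|by move=> _; exact: ltW|
  by move=> s; rewrite mulr_ge0|exact: measurable_funM].
rewrite integral_cst_probability EFinD ge0_integral_EFinZ//.
apply: leeD => //.
apply: (@le_trans _ _ ((2 * l)^-1%:E * (2 * e)%:E)%E); first by apply: lee_wpmul2l.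
by rewrite -EFinM lee_fin invfM; lra.
Qed.

Let achieves p (r : R) := policy p /\ forall j, (r%:E <= payoff j p)%E.

(** By concavity of the payoffs the midpoint of two near-optimal policies is near-optimal, so its
    disutility cannot be much below the least possible value; then [gap] brings the two policies
    together. *)
Let minimizing_sequence (s : R) : (forall e, 0 < e -> exists p, achieves p (s - e)) ->
  exists p : nat -> 'I_2 -> S -> R,
  [/\ forall n, achieves (p n) (s - n.+1%:R^-1) &
   forall n, (\int[mu]_t (\sum_k `|half (p n) k t - half (p n.+1) k t|)%:E <=
     (2 / 2 ^+ n.+1)%:E)%E].
Proof.
move=> sP.
pose A e := [set disutility p | p in [set p | achieves p (s - e)]].
have A_lb e : lbound (A e) 0.
  by move=> _ [p [pp _] <-]; have [_ /andP[]] := disutilityE p pp.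
have A_inf e : 0 < e -> has_inf (A e).
  move=> e0; split; last by exists 0.
  by have [p pe] := sP e e0; exists (disutility p), p.
pose B := [set inf (A e) | e in [set e | 0 < e]].
have B_sup : has_sup B.
  split; first by exists (inf (A 1)), 1 => //=.
  exists 2 => _ [e e0 <-]; have [p pe] := sP e e0.
  have [_ /andP[_ p2]] := disutilityE p pe.1.
  by apply: le_trans p2; apply: ge_inf; [exists 0|exists p].
have inf_anti e e' : 0 < e' -> e' <= e -> inf (A e) <= inf (A e').
  move=> e'0 e'e; apply: lb_le_inf; first by have [] := A_inf e' e'0.
  move=> _ [p [pp pe] <-]; apply: ge_inf; first by exists 0.
  exists p => //; split => // j; apply: le_trans (pe j).
  by rewrite lee_fin lerD2l lerN2.
(* The least disutility of policies within [e] of optimal grows as [e] decreases, so [M] is its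
   limit as [e] tends to 0. *)
pose M := sup B.
pose l n : R := (2 ^+ n.+1)^-1.
have l0 n : 0 < l n by rewrite invr_gt0 exprn_gt0.
have seq n : exists pd : ('I_2 -> S -> R) * R,
   [/\ 0 < pd.2 <= n.+1%:R^-1, M - (l n) ^+ 2 / 2 <= inf (A pd.2),
     achieves pd.1 (s - pd.2) & disutility pd.1 <= M + (l n) ^+ 2 / 2].
  have e0 : 0 < (l n) ^+ 2 / 2 by rewrite divr_gt0// exprn_gt0.
  have [_ [d0 d00 <-] hd0] := sup_adherent e0 B_sup.
  pose dn := Num.min d0 n.+1%:R^-1.
  have dn0 : 0 < dn by rewrite lt_min; apply/andP; split => //; rewrite invr_gt0.
  have [_ [p pA <-] hp] := inf_adherent e0 (A_inf dn dn0).
  exists (p, dn); split => //=.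
  - by rewrite dn0 ge_min lexx orbT.
  - apply: le_trans (ltW hd0) _; apply: inf_anti => //; by rewrite ge_min lexx.
  - apply: (le_trans (ltW hp)); rewrite lerD2r; apply: ub_le_sup; last by exists dn.
    by have [] := B_sup.
have [pd pdP] := choice seq.
exists (fun n => (pd n).1); split => n.
  have [/andP[_ dn] _ [pp pe] _] := pdP n; split => // j.
  by apply: le_trans (pe j); rewrite lee_fin lerD2l lerN2.
have [/andP[d0 _] h1 [pp pe] h2] := pdP n.
have [/andP[d0' _] h1' [pp' pe'] h2'] := pdP n.+1.
have l_le : l n.+1 ^+ 2 / 2 <= l n ^+ 2 / 2.
  rewrite ler_pM2r ?invr_gt0// ler_sqr ?nnegrE ?(ltW (l0 _))//.
  by rewrite /l lef_pV2 ?posrE ?exprn_gt0// ler_eXn2l ?ltr1n.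
(* [gap] is used with [e = l n ^+ 2]: both disutilities are at most [M + l n ^+ 2 / 2] and that of
   the midpoint is at least [M - l n ^+ 2 / 2]. *)
have -> : 2 / 2 ^+ n.+1 = l n + l n ^+ 2 / l n.
  rewrite expr2 mulfK ?lt0r_neq0// /l; ring.
apply: gap => //.
pose dm := Num.max (pd n).2 (pd n.+1).2.
have dm0 : 0 < dm by rewrite lt_max d0.
have : inf (A dm) <= disutility (mid (pd n).1 (pd n.+1).1).
  apply: ge_inf; first by exists 0.
  eexists; last by reflexivity.
  split; first exact: policy_mid.
  move=> j; apply: payoff_mid => //.
    by apply: le_trans (pe j); rewrite lee_fin lerD2l lerN2 le_max lexx.
  by apply: le_trans (pe' j); rewrite lee_fin lerD2l lerN2 le_max lexx orbT.
have : M - l n ^+ 2 / 2 <= inf (A dm).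
  rewrite /dm; case: (leP (pd n).2 (pd n.+1).2) => _ //.
  by apply: le_trans h1'; rewrite lerD2l lerN2.
move: (disutility _) (disutility (pd n).1) (disutility _) h2 h2' l_le => x y z.
by move: (l n ^+ 2) (l n.+1 ^+ 2) (inf _) => *; lra.
Qed.

(** Summable increments make [half (p n)] converge almost everywhere. A limit 0 would mean that the
    power tends to infinity, which the budget excludes almost everywhere: by Fatou the lower limit
    [L] of the powers is integrable. *)
Let limit_policy (p : nat -> 'I_2 -> S -> R) :
  (forall n, policy (p n)) ->
  (forall n, (\int[mu]_t (\sum_k `|half (p n) k t - half (p n.+1) k t|)%:E <=
     (2 / 2 ^+ n.+1)%:E)%E) ->
  exists2 A : set S, measurable A /\ {ae mu, forall s, A s} &
    forall s k, A s -> cvgn (fun n => p n k s).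
Proof.
move=> pp pD.
have p0 n k s : 0 <= p n k s by have [] := pp n k.
have mp n k : measurable_fun setT (p n k) by have [] := pp n k.
pose D n s := (\sum_k `|half (p n) k s - half (p n.+1) k s|)%:E.
have D0 n s : (0 <= D n s)%E by rewrite lee_fin sumr_ge0.
have mD n : measurable_fun setT (D n).
  apply/measurable_EFinP; apply: measurable_sum => k; apply: measurableT_comp => //.
  by apply: measurable_funB; exact: measurable_half.
pose L k s := limn_einf (fun n => (p n k s)%:E).
have mL k : measurable_fun setT (L k).
  rewrite (_ : L k = fun s => - limn_esup (fun n => - (p n k s)%:E))%E//.
  apply: measurableT_comp => //; apply: measurable_fun_limn_esup => n.
  by apply: measurableT_comp => //; exact/measurable_EFinP.
have L0 k s : (0 <= L k s)%E.
  rewrite /L limn_einf_lim; apply: lime_ge; first exact: is_cvg_einfs.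
  by apply: nearW => n; apply: le_ereal_inf_tmp => _ [m _ <-]; rewrite lee_fin.
have intL k : mu.-integrable setT (L k).
  apply/integrableP; split => //.
  under eq_integral do rewrite gee0_abs//.
  apply: (@le_lt_trans _ _ (Pbar k)%:E); last by rewrite ltry.
  apply: le_trans (fatou mu measurableT _ _) _.
  - by move=> n; apply/measurable_EFinP.
  - by move=> n s _; rewrite lee_fin.
  - by apply: limn_einf_le => n; have [] := pp n k.
pose SD s := (\sum_(n <oo) D n s)%E.
have mSD : measurable_fun setT SD.
  by apply: ge0_emeasurable_sum.
have intSD : mu.-integrable setT SD.
  apply/integrableP; split => //.
  under eq_integral do rewrite gee0_abs ?nneseries_ge0//.
  rewrite integral_nneseries//.
  apply: (@le_lt_trans _ _ 2%:E); last by rewrite ltry.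
  apply: (@le_trans _ _ (\sum_(n <oo) (2 / 2 ^+ n.+1)%:E)%E).
    by apply: lee_nneseries => [n _ _|n _]; [exact: integral_ge0|exact: pD].
  under eq_eseriesr do rewrite -natrX.
  exact: epsilon_trick0.
pose A := [set s | SD s \is a fin_num] `&` \bigcap_(k in [set: 'I_2]) [set s | L k s \is a fin_num].
have mfin (f : S -> \bar R) : measurable_fun setT f -> measurable [set s | f s \is a fin_num].
  move=> mf; rewrite (_ : [set _ | _] = setT `&` [set s | f s \is a fin_num]).
    exact: emeasurable_fin_num.
  by rewrite setTI.
exists A.
  split.
    apply: measurableI; first exact: mfin.
    by apply: fin_bigcap_measurable => // k _; exact: mfin.
  have aeL k := integrable_ae measurableT (intL k).
  have aeS := integrable_ae measurableT intSD.
  have aeL2 : {ae mu, forall s, forall k, L k s \is a fin_num}.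
    apply: filterS2 (aeL 0) (aeL 1) => s h0 h1 k.
    by case: k => -[|[|//]] kk; [rewrite (_ : Ordinal kk = 0)|
      rewrite (_ : Ordinal kk = 1)]; (try exact/val_inj); [exact: h0|exact: h1].
  by apply: filterS2 aeS aeL2 => s h0 h1; split; [exact: h0|move=> k _; exact: h1].
move=> s k [SDs /(_ k I) Ls].
have cu : cvgn (fun n => half (p n) k s).
  apply: cvg_summable_increments.
  apply: (@le_lt_trans _ _ (SD s)); last by rewrite -ge0_fin_numE// nneseries_ge0.
  apply: lee_nneseries => [n _ _|n _]; first by rewrite lee_fin.
  rewrite lee_fin (bigD1 k)//= distrC lerDl; exact: sumr_ge0.
pose l := limn (fun n => half (p n) k s).
have ul : half (p n) k s @[n --> \oo] --> l by exact: cu.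
have l0 : 0 <= l by apply: limr_ge => //; apply: nearW => n; exact: expR_ge0.
have [l_gt0|l_le0] := ltP 0 l.
  apply/cvg_ex; exists (-2 * ln l).
  have : ln (half (p n) k s) @[n --> \oo] --> ln l.
    by apply: (cvg_comp _ (@ln R) ul); exact: continuous_ln.
  move=> lnl; rewrite (_ : (fun n => p n k s) = fun n => -2 * ln (half (p n) k s)).
    exact: cvgMl_tmp.
  by apply/funext => n; rewrite /half expRK; lra.
exfalso.
have {l_le0 l0} l0 : l = 0 by apply/eqP; rewrite eq_le l_le0 l0.
have poo : (p n k s)%:E @[n --> \oo] --> +oo%E.
  apply/cvgeryP/cvgryPge => B.
  have : \forall n \near \oo, half (p n) k s < expR (- B / 2).
    by apply: (cvgr_lt l ul); rewrite l0 expR_gt0.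
  by apply: filterS => n; rewrite ltr_expR; lra.
have Loo : L k s = +oo%E := (cvg_limn_einf_sup poo).1.
by move: Ls => /=; rewrite Loo.
Qed.

Lemma optimal_policy : J -> exists2 p, policy p &
  forall q (r : R), policy q -> (forall j, r%:E <= payoff j q)%E ->
    forall j, (r%:E <= payoff j p)%E.
Proof.
move=> j0.
pose B := [set r | exists p, achieves p r].
have B0 : B 0.
  exists (fun _ _ => 0); split.
    move=> k; split => //; rewrite integral_cst_probability lee_fin.
    exact: Pbar_ge0.
  by move=> j; apply: integral_ge0 => s _; rewrite lee_fin F_ge0.
have B_sup : has_sup B.
  split; first by exists 0.
  have [G [mG G0 intG GP]] := F_dominated 1 ltr01.
  have Gfin : (\int[mu]_s (G s)%:E)%E \is a fin_num.
    by rewrite ge0_fin_numE// integral_ge0// => s _; rewrite lee_fin.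
  exists (fine (\int[mu]_s (G s)%:E)%E + 2) => r [p [pp rp]].
  rewrite -lee_fin EFinD fineK//; apply: le_trans (rp j0) _.
  have sum0 s : 0 <= 1 * \sum_k w k * p k s.
    rewrite mul1r; apply: sumr_ge0 => k _; apply: mulr_ge0 => //.
    by have [_ ->] := pp k.
  apply: (@le_trans _ _ (\int[mu]_s (G s + 1 * \sum_k w k * p k s)%:E)%E).
    apply: ae_ge0_le_integral => //.
    - by move=> s _; rewrite lee_fin F_ge0// => k; have [_ ->] := pp k.
    - by apply/measurable_EFinP; exact: F_meas.
    - by move=> s _; rewrite lee_fin addr_ge0.
    - apply/measurable_EFinP; apply: measurable_funD => //.
      exact: measurable_budget.
    - by apply: filterS (GP j0 p pp) => s Fs _; rewrite lee_fin.
  rewrite ge0_integral_EFinD//; last exact: measurable_budget.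
  by apply: leeD => //; have := budget 1 p ler01 pp; rewrite mul1r.
have [|p [pA pD]] := minimizing_sequence (sup B).
  move=> e e0; have [r [p [pp rp]] er] := sup_adherent e0 B_sup.
  by exists p; split => // j; apply: le_trans (rp j); rewrite lee_fin ltW.
have pp n : policy (p n) by have [] := pA n.
have p0 n k s : 0 <= p n k s by have [] := pp n k.
have mp n k : measurable_fun setT (p n k) by have [] := pp n k.
have [A [mA aeA] Acvg] := limit_policy p pp pD.
(* Setting the powers to 0 off the set of convergence changes no integral and makes the sequence
   converge at every state. *)
pose pn n k s := p n k s * \1_A s.
have mpn n k : measurable_fun setT (pn n k).
  by apply: measurable_funM => //; exact: measurable_indic.
have pn0 n k s : 0 <= pn n k s by exact: mulr_ge0.
have pnA n : {ae mu, forall s, forall k, pn n k s = p n k s}.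
  by apply: filterS aeA => s As k; rewrite /pn indicE mem_set// mulr1.
have ppn n : policy (pn n).
  move=> k; have [_ _ pP] := pp n k; split => //; apply: le_trans pP.
  apply: ge0_le_integral => //.
  - by move=> s _; rewrite lee_fin.
  - exact/measurable_EFinP.
  - exact/measurable_EFinP.
  - move=> s _; rewrite lee_fin /pn ler_piMr// indicE; by case: (s \in A).
have payoff_pn n j : payoff j (pn n) = payoff j (p n).
  apply: ae_eq_integral => //; [apply/measurable_EFinP; exact: F_meas..|].
  apply: filterS (pnA n) => s ps _; congr (F j s _)%:E.
  by apply/funext => k; exact: ps.
have pn_cvg k s : cvgn (fun n => pn n k s).
  rewrite /pn; have [sA|sA] := boolP (s \in A).
    rewrite (_ : (fun n => _) = fun n => p n k s); first by apply: Acvg; rewrite inE in sA.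
    by apply/funext => n; rewrite indicE sA mulr1.
  rewrite (_ : (fun n => _) = fun n => 0); first exact: is_cvg_cst.
  by apply/funext => n; rewrite indicE (negbTE sA) mulr0.
pose q k s := limn (fun n => pn n k s).
have pq k s : pn n k s @[n --> \oo] --> q k s by exact: pn_cvg.
have pq_policy : policy q.
  move=> k; split.
  - by apply: (@measurable_fun_cvg _ _ _ _ (fun n => pn n k)) => // s _; exact: pq.
  - by move=> s; apply: limr_ge; [exact: pn_cvg|exact: nearW].
  - have -> : (\int[mu]_s (q k s)%:E = \int[mu]_s limn_einf (fun n => (pn n k s)%:E))%E.
      apply: eq_integral => s _.
      have qE : (pn n k s)%:E @[n --> \oo] --> (q k s)%:E.
        by apply: cvg_EFin; [exact: nearW|exact: pq].
      by rewrite (cvg_limn_einf_sup qE).1.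
    apply: le_trans (fatou mu measurableT _ _) _.
    + by move=> n; apply/measurable_EFinP.
    + by move=> n s _; rewrite lee_fin.
    + by apply: limn_einf_le => n; have [] := ppn n k.
exists q => // q' r q'p rq' j.
apply: (@le_trans _ _ (sup B)%:E).
  by rewrite lee_fin; apply: ub_le_sup; [have [] := B_sup|exists q'].
apply/lee_addgt0Pr => e e0.
have [N eN] : exists N, forall n, (N <= n)%N -> n.+1%:R^-1 <= e.
  exists (Num.truncn e^-1) => n Nn.
  rewrite -[leRHS]invrK lef_pV2 ?posrE ?invr_gt0// ltW//.
  apply: lt_le_trans (truncnS_gt _) _; by rewrite ler_nat.
rewrite -leeBlDr// -EFinB.
(* [payoff_usc] requires the bound at every index, so the first [N] policies are dropped. *)
apply: (payoff_usc (fun n => pn (n + N)%N)) => //.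
  by move=> k s; rewrite (cvg_shiftn N (fun n => pn n k s)); exact: pq.
move=> n; rewrite payoff_pn; have [_ /(_ j)] := pA (n + N)%N.
by apply: le_trans; rewrite lee_fin lerD2l lerN2 eN// leq_addl.
Qed.

End optimal_policy.

(** * An optimal policy for the two sum rates *)

Section optimal_rate.
Context {R : realType} {d : measure_display} {S : measurableType d}.
Variables (mu : probability S R) (Pbar : 'I_2 -> R) (a b c e : S -> R).
Hypotheses (ma : measurable_fun setT a) (mb : measurable_fun setT b)
  (mc : measurable_fun setT c) (me : measurable_fun setT e).
Hypotheses (a0 : forall s, 0 <= a s) (b0 : forall s, 0 <= b s)
  (c0 : forall s, 0 <= c s) (e0 : forall s, 0 <= e s).
Hypotheses (bc : {ae mu, forall s, b s <= c s}) (ea : {ae mu, forall s, e s <= a s}).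
Hypothesis Pbar_ge0 : forall k, 0 <= Pbar k.

Definition rates (j : bool) (s : S) (x : 'I_2 -> R) : R :=
  if j then rate (a s) (b s) (c s) (x 0) (x 1)
  else rate (c s) (e s) (a s) (x 1) (x 0).

Let ln2_gt0 : 0 < ln 2 :> R. Proof. by rewrite ln_gt0// ltr1n. Qed.

Let rates_meas j p : policy mu Pbar p ->
  measurable_fun setT (fun s => rates j s (p^~ s)).
Proof.
move=> pp; have [mp0 p00 _] := pp 0; have [mp1 p10 _] := pp 1.
by case: j; apply: measurable_rate.
Qed.

Let rates_ge0 j s (x : 'I_2 -> R) : (forall k, 0 <= x k) -> 0 <= rates j s x.
Proof. by move=> x0; case: j; exact: rate_ge0. Qed.

Let Cfun_cvg (u : nat -> R) (l : R) : 0 <= l -> u n @[n --> \oo] --> l ->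
  Cfun (u n) @[n --> \oo] --> Cfun l.
Proof.
move=> l0 ul; apply: cvgMr_tmp.
apply: (@cvg_comp _ _ _ (fun n => 1 + u n) (@ln R) _ (nbhs (1 + l))).
  by apply: cvgD => //; exact: cvg_cst.
by apply: continuous_ln; rewrite ltr_pwDl.
Qed.

Let rate_cvg (A B D : R) (x y : nat -> R) (x0 y0 : R) : 0 <= A -> 0 <= B -> 0 <= D ->
  (forall n, 0 <= x n) -> (forall n, 0 <= y n) ->
  x n @[n --> \oo] --> x0 -> y n @[n --> \oo] --> y0 ->
  rate A B D (x n) (y n) @[n --> \oo] --> rate A B D x0 y0.
Proof.
move=> A0 B0 D0 xn yn xx yy.
have x00 : 0 <= x0.
  by rewrite -(cvg_lim _ xx)//; apply: limr_ge; [exact: cvgP xx|exact: nearW].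
have y00 : 0 <= y0.
  by rewrite -(cvg_lim _ yy)//; apply: limr_ge; [exact: cvgP yy|exact: nearW].
have den : 0 < 1 + B * y0 by rewrite ltr_pwDl// mulr_ge0.
apply: cvgD; apply: Cfun_cvg.
- by rewrite divr_ge0 ?mulr_ge0// ltW.
- apply: cvgM; first exact: cvgMl_tmp.
  apply: cvgV; first exact: lt0r_neq0.
  by apply: cvgD; [exact: cvg_cst|exact: cvgMl_tmp].
- exact: mulr_ge0.
- exact: cvgMl_tmp.
Qed.

Let rates_cont j s (x : nat -> 'I_2 -> R) (y : 'I_2 -> R) :
  (forall n k, 0 <= x n k) -> (forall k, x n k @[n --> \oo] --> y k) ->
  rates j s (x n) @[n --> \oo] --> rates j s y.
Proof. by move=> x0 xy; case: j; apply: rate_cvg. Qed.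

Let rate_mid (A B D x y x' y' : R) : 0 <= A -> 0 <= B -> B <= D ->
  0 <= x -> 0 <= y -> 0 <= x' -> 0 <= y' ->
  rate A B D x y + rate A B D x' y' <= 2 * rate A B D ((x + x') / 2) ((y + y') / 2).
Proof.
move=> A0 B0 BD x0 y0 x'0 y'0.
have mx : 0 <= (x + x') / 2 by rewrite divr_ge0 ?addr_ge0.
have my : 0 <= (y + y') / 2 by rewrite divr_ge0 ?addr_ge0.
have := rate_tangent A B D x y _ _ A0 B0 BD x0 y0 mx my.
have := rate_tangent A B D x' y' _ _ A0 B0 BD x'0 y'0 mx my.
move: (rate A B D x y) (rate A B D x' y') (rate A B D _ _) (slope1 _ _ _ _)
  (slope2 _ _ _ _ _) => r r' m s1 s2 h h'.
have : s1 * x + s1 * x' = 2 * (s1 * ((x + x') / 2)) by field.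
have : s2 * y + s2 * y' = 2 * (s2 * ((y + y') / 2)) by field.
lra.
Qed.

Let rates_concave j : {ae mu, forall s, forall x y : 'I_2 -> R,
  (forall k, 0 <= x k) -> (forall k, 0 <= y k) ->
  rates j s x + rates j s y <= 2 * rates j s (fun k => (x k + y k) / 2)}.
Proof.
by case: j; [apply: filterS bc|apply: filterS ea] => s hs x y x0 y0; exact: rate_mid.
Qed.

Let Cfun_le (u v : R) : 0 <= u -> u <= v -> Cfun u <= Cfun v.
Proof.
move=> u0 uv; rewrite ler_pM2r ?invr_gt0//.
by rewrite ler_ln ?posrE ?ltr_pwDl// ?lerD2l// (le_trans u0).
Qed.

Let rate_le (A B D x y : R) : 0 <= A -> 0 <= B -> 0 <= x -> 0 <= y ->
  rate A B D x y <= Cfun (A * x) + Cfun (D * y).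
Proof.
move=> A0 B0 x0 y0; have By := mulr_ge0 B0 y0; have Ax := mulr_ge0 A0 x0.
rewrite lerD2r; apply: Cfun_le; first by rewrite divr_ge0// addr_ge0.
by rewrite ler_piMr// invf_le1 ?ltr_pwDl// lerDl.
Qed.

Let rate_ge1 (A B D x y : R) : 0 <= A -> 0 <= B -> B <= D -> 0 <= x -> 0 <= y ->
  Cfun (A * x) <= rate A B D x y.
Proof.
move=> A0 B0 BD x0 y0; have By := mulr_ge0 B0 y0; have Ax := mulr_ge0 A0 x0.
have D0 : 0 <= D by exact: le_trans BD.
rewrite rateE// ler_pM2r ?invr_gt0//.
apply: (@le_trans _ _ (ln (1 + A * x + B * y))).
  by rewrite ler_ln ?posrE; lra.
rewrite lerDl ln_ge0// ler_pdivlMr ?ltr_pwDl// mul1r lerD2l.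
exact: ler_wpM2r.
Qed.

Let rate_ge2 (A B D x y : R) : 0 <= A -> 0 <= B -> 0 <= x -> 0 <= y ->
  Cfun (D * y) <= rate A B D x y.
Proof.
move=> A0 B0 x0 y0; rewrite lerDr Cfun_ge0// divr_ge0 ?mulr_ge0// addr_ge0//.
exact: mulr_ge0.
Qed.

(** Separates the fading from the policy: with [p] the average power allowed, the first term depends
    on the state only and the second on the normalised power only. For [p = 0] the quotient is 0,
    and the last hypothesis saves the bound. *)
Let Cfun_split (A x p : R) : 0 <= A -> 0 <= x -> 0 <= p -> (p = 0 -> x = 0) ->
  Cfun (A * x) <= Cfun (A * p) + Cfun (x / p).
Proof.
move=> A0 x0 p0 px; rewrite -mulrDl ler_pM2r ?invr_gt0//.
have Ap := mulr_ge0 A0 p0; have xp : 0 <= x / p by rewrite divr_ge0.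
have Ax := mulr_ge0 A0 x0.
rewrite -lnM ?posrE ?ltr_pwDl// ler_ln ?posrE ?mulr_gt0 ?ltr_pwDl//.
have -> : (1 + A * p) * (1 + x / p) = 1 + A * p + x / p + A * x.
  have [p_eq0|p_neq0] := eqVneq p 0; last by field.
  by rewrite p_eq0 (px p_eq0) invr0; ring.
lra.
Qed.

(** From [ln v <= v - 1] at [v = t * ln 2 * (1 + u)]: the slope [t] can be as small as desired, at
    the price of a larger constant. *)
Let Cfun_linear (t u : R) : 0 < t -> 0 <= u ->
  Cfun u <= t * u + (t * ln 2 - 1 - ln (t * ln 2)) / ln 2.
Proof.
move=> t0 u0; have tl : 0 < t * ln 2 by rewrite mulr_gt0.
have : ln ((t * ln 2) * (1 + u)) <= (t * ln 2) * (1 + u) - 1.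
  have pos : 0 < t * ln 2 * (1 + u) by rewrite mulr_gt0// ltr_pwDl.
  by rewrite -{1}(subrKC 1 (t * ln 2 * (1 + u))); apply: le_ln1Dx; lra.
rewrite lnM ?posrE ?ltr_pwDl// => h.
rewrite /Cfun ler_pdivrMr// mulrDl divfK ?lt0r_neq0//; lra.
Qed.

Let Pinv k : R := (Pbar k)^-1.

Let ae_zero p k : policy mu Pbar p -> {ae mu, forall s, Pbar k = 0 -> p k s = 0}.
Proof.
move=> pp; have [mp p0 _] := pp k.
have [P0|P0] := eqVneq (Pbar k) 0; last first.
  by apply: filterS filterT => s _ /eqP; rewrite (negbTE P0).
have : (\int[mu]_s `|(p k s)%:E| = 0)%E.
  apply/eqP; rewrite eq_le; apply/andP; split; last exact: integral_ge0.
  under eq_integral do rewrite gee0_abs ?lee_fin//.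
  by have [_ _] := pp k; rewrite P0.
move/(ae_eq_integral_abs mu measurableT _).1.
have mpE : measurable_fun setT (fun s => (p k s)%:E) by exact/measurable_EFinP.
by move=> /(_ mpE); apply: filterS => s /(_ I) [].
Qed.

(** The constant policy [Pbar] decides. If its value is infinite it is optimal; if not, both
    single-user rates at the powers [Pbar] are integrable and provide the dominating function
    [G]. *)
Lemma optimal_rates : exists2 p, policy mu Pbar p &
  forall q, policy mu Pbar q ->
    (Order.min (payoff mu bool rates true q) (payoff mu bool rates false q) <=
     Order.min (payoff mu bool rates true p) (payoff mu bool rates false p))%E.
Proof.
pose p0 k (s : S) := Pbar k.
have p0_policy : policy mu Pbar p0.
  move=> k; split; [exact: measurable_cst|by move=> s; exact: Pbar_ge0|].
  by rewrite /p0 integral_cst_probability.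
have [oo|fin] := eqVneq (Order.min (payoff mu bool rates true p0)
    (payoff mu bool rates false p0)) +oo%E.
  by exists p0 => // q qp; rewrite oo leey.
have mCfun (f : S -> R) k : measurable_fun setT f ->
    measurable_fun setT (fun s => Cfun (f s * Pbar k)).
  by move=> mf; apply: measurable_Cfun; exact: measurable_funM.
have C0 (f : S -> R) k s : (forall s, 0 <= f s) -> 0 <= Cfun (f s * Pbar k).
  by move=> f0; rewrite Cfun_ge0// mulr_ge0.
have fin_le (f : S -> R) k : measurable_fun setT f -> (forall s, 0 <= f s) ->
    (forall j, {ae mu, forall s, Cfun (f s * Pbar k) <= rates j s (p0^~ s)}) ->
    (\int[mu]_s (Cfun (f s * Pbar k))%:E < +oo)%E.
  move=> mf f0 fr.
  have le j : (\int[mu]_s (Cfun (f s * Pbar k))%:E <= payoff mu bool rates j p0)%E.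
    apply: ae_ge0_le_integral => //.
    - by move=> s _; rewrite lee_fin C0.
    - by apply/measurable_EFinP; exact: mCfun.
    - by move=> s _; rewrite lee_fin rates_ge0.
    - by apply/measurable_EFinP; exact: rates_meas.
    - by apply: filterS (fr j) => s h _; rewrite lee_fin.
  have : (\int[mu]_s (Cfun (f s * Pbar k))%:E <=
      Order.min (payoff mu bool rates true p0) (payoff mu bool rates false p0))%E.
    by rewrite le_min !le.
  by move=> /le_lt_trans; apply; rewrite ltey.
(* Under weak interference each single-user rate lies below both sum rates, so it is finite in mean
   even if only one of the two payoffs is. *)
have fa : (\int[mu]_s (Cfun (a s * Pbar 0))%:E < +oo)%E.
  apply: fin_le => //; case.
    by apply: filterS bc => s h; rewrite /rates /p0; apply: rate_ge1.
  by apply: filterS ea => s h; rewrite /rates /p0; apply: rate_ge2.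
have fc : (\int[mu]_s (Cfun (c s * Pbar 1))%:E < +oo)%E.
  apply: fin_le => //; case.
    by apply: filterS bc => s h; rewrite /rates /p0; apply: rate_ge2.
  by apply: filterS ea => s h; rewrite /rates /p0; apply: rate_ge1.
have w0 k : 0 <= Pinv k by rewrite invr_ge0.
have wP k : Pinv k * Pbar k <= 1.
  rewrite /Pinv; have [->|P0] := eqVneq (Pbar k) 0; first by rewrite mulr0.
  by rewrite mulVf.
have dominated t : 0 < t -> exists G : S -> R,
  [/\ measurable_fun setT G, forall s, 0 <= G s, (\int[mu]_s (G s)%:E < +oo)%E &
   forall j p, policy mu Pbar p ->
     {ae mu, forall s, rates j s (p^~ s) <= G s + t * \sum_k Pinv k * p k s}].
  move=> t0; pose K : R := (t * ln 2 - 1 - ln (t * ln 2)) / ln 2.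
  have K0 : 0 <= K.
    by have := Cfun_linear t 0 t0 (lexx 0); rewrite /Cfun addr0 ln1 mul0r mulr0 add0r.
  exists (fun s => Cfun (a s * Pbar 0) + Cfun (c s * Pbar 1) + 2 * K); split.
  - by apply: measurable_funD => //; apply: measurable_funD; exact: mCfun.
  - move=> s; apply: addr_ge0; last exact: mulr_ge0.
    by apply: addr_ge0; exact: C0.
  - rewrite ge0_integral_EFinD//; [|by move=> s; apply: addr_ge0; exact: C0|
      by move=> _; exact: mulr_ge0|by apply: measurable_funD; exact: mCfun].
    rewrite integral_cst_probability ge0_integral_EFinD//;
      [|by move=> s; exact: C0|by move=> s; exact: C0|exact: mCfun|exact: mCfun].
    by apply: lte_add_pinfty; [exact: lte_add_pinfty|exact: ltry].
  - move=> j p pp.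
    have [_ p00 _] := pp 0; have [_ p10 _] := pp 1.
    apply: filterS2 (ae_zero p 0 pp) (ae_zero p 1 pp) => s z0 z1.
    have : rates j s (p^~ s) <= Cfun (a s * p 0 s) + Cfun (c s * p 1 s).
      by case: j; [|rewrite addrC]; exact: rate_le.
    have := Cfun_split (a s) _ _ (a0 s) (p00 s) (Pbar_ge0 0) z0.
    have := Cfun_split (c s) _ _ (c0 s) (p10 s) (Pbar_ge0 1) z1.
    have := Cfun_linear t (p 0 s / Pbar 0) t0 (divr_ge0 (p00 s) (Pbar_ge0 0)).
    have := Cfun_linear t (p 1 s / Pbar 1) t0 (divr_ge0 (p10 s) (Pbar_ge0 1)).
    rewrite -/K !big_ord_recl big_ord0 /Pinv.
    have -> : lift ord0 ord0 = 1 :> 'I_2 by exact: val_inj.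
    rewrite -[ord0]/(0 : 'I_2) ![_^-1 * _]mulrC.
    move: (p 0 s / _) (p 1 s / _) (Cfun _) (Cfun _) (Cfun _) (Cfun _) (Cfun _) (Cfun _).
    by move=> *; lra.
have [p pp pmax] := optimal_policy mu Pbar bool rates Pbar_ge0 rates_meas rates_ge0
  rates_cont rates_concave Pinv w0 wP dominated true.
exists p => // q qp.
have V0 j : (0 <= payoff mu bool rates j q)%E.
  apply: integral_ge0 => s _; rewrite lee_fin rates_ge0// => k.
  by have [_ ->] := qp k.
have : (0 <= Order.min (payoff mu bool rates true q) (payoff mu bool rates false q))%E.
  by rewrite le_min !V0.
case E : (Order.min _ _) => [r||] // _; rewrite le_min.
  by apply/andP; split; apply: (pmax q r qp) => -[]; rewrite -E ge_min lexx ?orbT.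
have pmax_oo j : payoff mu bool rates j p = +oo%E.
  apply/eqyP => A _; apply: (pmax q A qp) => j'.
  have : (+oo <= payoff mu bool rates j' q)%E.
    by rewrite -E ge_min; case: j'; rewrite lexx ?orbT.
  by rewrite leye_eq => /eqP ->; rewrite leey.
by rewrite !pmax_oo leey.
Qed.

End optimal_rate.

(** * Codes over the fading channel *)

Section stationary_law.
Context {R : realType} {d : measure_display} {T : measurableType d}.
Variable P : probability T R.
Context {d' : measure_display} {S : measurableType d'}.
Variable X : nat -> {RV P >-> S}.
Hypothesis X_stationary : stationary X.

Lemma stationary_marginal i (A : set S) : measurable A ->
  P (X i @^-1` A) = P (X 0%N @^-1` A).
Proof.
move=> mA; elim: i => [//|i <-].
have := X_stationary [set x : nat -> S | A (x i)]; apply.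
apply: sub_sigma_algebra; exists i => //; exists A => //.
by rewrite setTI.
Qed.

Lemma stationary_integral i (f : S -> \bar R) : measurable_fun setT f ->
  (forall s, 0 <= f s)%E ->
  (\int[P]_t f (X i t) = \int[distribution P (X 0%N)]_s f s)%E.
Proof.
move=> mf f0; transitivity (\int[distribution P (X i)]_s f s)%E.
  by rewrite ge0_integral_distribution.
by apply: eq_measure_integral => A mA _; exact: stationary_marginal.
Qed.

Lemma stationary_ae i (A : set S) : measurable A ->
  {ae P, forall t, A (X 0%N t)} -> {ae P, forall t, A (X i t)}.
Proof.
move=> mA; have mC j : measurable (~` [set t | A (X j t)]).
  by apply: measurableC; rewrite -[X in measurable X]setTI; exact: measurable_funPT.
have PC j : P (~` [set t | A (X j t)]) = P (X 0%N @^-1` (~` A)).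
  by rewrite -(stationary_marginal j)//; exact: measurableC.
move=> /(negligibleP P (mC 0%N)) h; apply/(negligibleP P (mC i)).
exact: (etrans (PC i) (etrans (esym (PC 0%N)) h)).
Qed.

Lemma distribution_ae (Y : {RV P >-> S}) (A : set S) : measurable A ->
  {ae P, forall t, A (Y t)} -> {ae distribution P Y, forall s, A s}.
Proof.
move=> mA h; apply/(negligibleP (distribution P Y)); first exact: measurableC.
have mC : measurable (~` [set t | A (Y t)]).
  by apply: measurableC; rewrite -[X in measurable X]setTI; exact: measurable_funPT.
by move/(negligibleP P mC) : h.
Qed.

End stationary_law.

Lemma measurable_entry (R : realType) (m k : 'I_2) :
  measurable_fun setT (fun A : 'M[R[i]]_2 => A m k).
Proof.
pose f (A : 'M[R[i]]_2) : (R[i] * R[i]) * (R[i] * R[i]) :=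
  ((A 0 0, A 0 1), (A 1 0, A 1 1)).
have mf : measurable_fun setT f by move=> _ B mB; exists B.
have /measurable_fun_pairP[m1 m2] := mf.
have I2 (j : 'I_2) : j = 0 \/ j = 1.
  by case: j => [[|[|//]] ?]; [left|right]; exact: val_inj.
by case: (I2 m) => ->; case: (I2 k) => ->;
  [exact: (measurableT_comp measurable_fst m1)|
   exact: (measurableT_comp measurable_snd m1)|
   exact: (measurableT_comp measurable_fst m2)|
   exact: (measurableT_comp measurable_snd m2)].
Qed.

Definition gain {R : realType} (m k : 'I_2) (h : 'M[R[i]]_2) : R := nsq (h m k).

Lemma gain_ge0 (R : realType) m k (h : 'M[R[i]]_2) : 0 <= gain m k h.
Proof. exact: nsq_ge0. Qed.

Lemma measurable_gain (R : realType) m k : measurable_fun setT (@gain R m k).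
Proof. by apply: measurable_nsq; exact: measurable_entry. Qed.

Lemma uniformly_weakE (R : realType) (h : 'M[R[i]]_2) :
  uniformly_weak h <-> gain 1 0 h < gain 0 0 h /\ gain 0 1 h < gain 1 1 h.
Proof.
have n0 (z : R[i]) : 0 <= normc z by case: z => x y; exact: sqrtr_ge0.
by rewrite /uniformly_weak /gain -!normc_sqr !ltr_pXn2r ?nnegrE.
Qed.

Lemma measurable_uniformly_weak (R : realType) :
  measurable [set h : 'M[R[i]]_2 | uniformly_weak h].
Proof.
have -> : [set h : 'M[R[i]]_2 | uniformly_weak h] =
    [set h | gain 1 0 h < gain 0 0 h] `&` [set h | gain 0 1 h < gain 1 1 h].
  by apply/seteqP; split => h; [move/uniformly_weakE|move=> ?; apply/uniformly_weakE].
have mlt (f g : 'M[R[i]]_2 -> R) : measurable_fun setT f -> measurable_fun setT g ->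
    measurable [set h | f h < g h].
  move=> mf mg; rewrite -[X in measurable X]setTI.
  by apply: (measurable_fun_ltr mf mg) => //; exact: (@measurable_set1 _ bool true).
by apply: measurableI; apply: mlt; exact: measurable_gain.
Qed.

Lemma card_messages (B : 'I_2 -> nat) (u v : 'I_2) : u != v ->
  #|{: messages B}| = (2 ^ B u * 2 ^ B v)%N.
Proof.
move=> uv; rewrite /messages card_dep_ffun foldrE big_image /=.
rewrite (bigD1 u)//= (bigD1 v)/=; last by rewrite eq_sym.
rewrite big1 ?muln1 ?card_ord// => k /andP[ku kv].
by move: u v k uv ku kv; do 3![case=> -[|[|//]] ?].
Qed.

Lemma big_messages (R : realType) (B : 'I_2 -> nat) (u v : 'I_2)
    (f : 'I_(2 ^ B u) -> 'I_(2 ^ B v) -> R) : u != v ->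
  \sum_(w : messages B) f (w u) (w v) = \sum_x \sum_y f x y.
Proof.
move=> uv; rewrite pair_big /=.
pose pairing (w : messages B) := (w u, w v).
rewrite [RHS](reindex pairing) //=; apply: onW_bij; apply: inj_card_bij.
  move=> w w' [wu wv]; apply/ffunP => k.
  have [->//|ku] := eqVneq k u.
  suff -> : k = v by [].
  apply: val_inj; move: u v k uv ku {f pairing w w' wu wv}.
  by do 3![case=> -[|[|//]] ?].
by rewrite card_prod !card_ord (card_messages _ _ _ uv).
Qed.

(** * Variance of a codebook over the messages *)

Section spread.
Context {R : realType} {W : finType}.
Variable w0 : W.
Notation C := (R[i]).
Implicit Type x : W -> C.

Definition mean x : C := (\sum_w x w) / #|W|%:R.
Definition spread x : R := avg (fun w => nsq (x w - mean x)).

Let card_neq0 : #|W|%:R != 0 :> C.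
Proof. by rewrite pnatr_eq0 -lt0n; apply/card_gt0P; exists w0. Qed.

Lemma sum_centered x : \sum_w (x w - mean x) = 0.
Proof.
by rewrite sumrB sumr_const -[_ *+ _]mulr_natr /mean divfK// subrr.
Qed.

Lemma spread_ge0 x : 0 <= spread x.
Proof. by rewrite divr_ge0// sumr_ge0// => w _; exact: nsq_ge0. Qed.

(** A second moment is the variance plus the squared mean; centred codewords therefore keep within
    the power constraint. *)
Lemma spread_le x : spread x <= avg (fun w => nsq (x w)).
Proof.
rewrite ler_wpM2r ?invr_ge0//.
pose y w := x w - mean x; pose m := mean x.
have ReS (f : W -> C) : complex.Re (\sum_w f w) = \sum_w complex.Re (f w).
  by apply: (big_ind2 (fun z r => complex.Re z = r)) => // -[? ?] ? [? ?] ? /= <- <-.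
have ImS (f : W -> C) : complex.Im (\sum_w f w) = \sum_w complex.Im (f w).
  by apply: (big_ind2 (fun z r => complex.Im z = r)) => // -[? ?] ? [? ?] ? /= <- <-.
have yRe : \sum_w complex.Re (y w) = 0 by rewrite -ReS sum_centered.
have yIm : \sum_w complex.Im (y w) = 0 by rewrite -ImS sum_centered.
have E w : nsq (x w) = nsq (y w) + nsq m +
    (2 * complex.Re m * complex.Re (y w) + 2 * complex.Im m * complex.Im (y w)).
  rewrite -[x w](subrK m) -/(y w) /nsq; case: (y w) => ? ?; case: m => ? ? /=; ring.
have cross : \sum_w (2 * complex.Re m * complex.Re (y w) +
    2 * complex.Im m * complex.Im (y w)) = 0.
  by rewrite big_split /= -2!mulr_sumr yRe yIm !mulr0 addr0.
have -> : \sum_w nsq (x w) = \sum_w nsq (y w) + \sum_(w : W) nsq m.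
  have split (f g : W -> R) : \sum_w (f w + g w) = \sum_w f w + \sum_w g w.
    by rewrite big_split.
  etransitivity; first exact: (eq_bigr _ (fun w _ => E w)).
  by etransitivity; [exact: split|rewrite cross addr0; exact: split].
rewrite lerDl.
by apply: sumr_ge0 => w _; exact: nsq_ge0.
Qed.

End spread.

Section code_inequality.
Context {R : realType}.
Notation C := (R[i]).
Variables (n : nat) (W1 W2 : finType) (w10 : W1) (w20 : W2).
Variables (h11 h12 h22 : 'I_n -> C) (x1 : W1 -> 'I_n -> C) (x2 : W2 -> 'I_n -> C).
Hypothesis weak : forall i, nsq (h12 i) < nsq (h22 i).
Variables (D1 : n.-tuple C -> W1) (D2 : W1 -> n.-tuple C -> W2).
Hypotheses (mD1 : forall w, measurable [set y | D1 y = w])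
           (mD2 : forall w1 w, measurable [set y | D2 w1 y = w]).

(* Subtracting the means of the codewords, known to the receivers, shifts the
   outputs but not the decoding probabilities. *)
Lemma code_inequality :
  (\sum_w1 \sum_w2 fine (gaussn n [set z | D1
      [tuple h11 i * x1 w1 i + (h12 i * x2 w2 i + tnth z i) | i < n] = w1]))
    * ln #|W1|%:R +
  (\sum_w1 \sum_w2 fine (gaussn n [set z | D2 w1
      [tuple h22 i * x2 w2 i + tnth z i | i < n] = w2])) * ln #|W2|%:R <=
  #|W1|%:R * #|W2|%:R * (2 + \sum_i ln 2 *
    rate (nsq (h11 i)) (nsq (h12 i)) (nsq (h22 i))
      (spread (x1^~ i)) (spread (x2^~ i))).
Proof.
pose m1 i := mean (x1^~ i); pose m2 i := mean (x2^~ i).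
pose shift (m : 'I_n -> C) (y : n.-tuple C) : n.-tuple C :=
  [tuple tnth y i + m i | i < n].
have mshift m (A : set (n.-tuple C)) : measurable A -> measurable (shift m @^-1` A).
  move=> mA; rewrite -[X in measurable X]setTI.
  apply: (_ : measurable_fun setT (shift m)) => //.
  apply: measurable_mktuple => i; apply: measurable_Cadd => //.
  exact: measurable_tnth.
have := core_inequality n W1 W2 w10 w20 h11 h12 h22
  (fun w i => x1 w i - m1 i) (fun w i => x2 w i - m2 i) weak
  (fun i => sum_centered w20 (x2^~ i))
  (fun y => D1 (shift (fun i => h11 i * m1 i + h12 i * m2 i) y))
  (fun w1 y => D2 w1 (shift (fun i => h22 i * m2 i) y))
  (fun w => mshift _ _ (mD1 w)) (fun w1 w => mshift _ _ (mD2 w1 w)).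
congr (is_true (_ * _ + _ * _ <= _ * (_ + _))).
- apply: eq_bigr => w1 _; apply: eq_bigr => w2 _; congr (fine (gaussn n _)).
  apply/funext => z /=; congr (D1 _ = _); apply: eq_from_tnth => i.
  by rewrite !tnth_mktuple; ring.
- apply: eq_bigr => w1 _; apply: eq_bigr => w2 _; congr (fine (gaussn n _)).
  apply/funext => z /=; congr (D2 _ _ = _); apply: eq_from_tnth => i.
  by rewrite !tnth_mktuple; ring.
- apply: eq_bigr => i _; rewrite rateE ?nsq_ge0 ?spread_ge0// [RHS]mulrC divfK//.
  by rewrite lt0r_neq0// ln_gt0// ltr1n.
Qed.

End code_inequality.

Lemma measurable_Csum (R : realType) d (T : measurableType d) (W : finType)
    (f : W -> T -> R[i]) : (forall w, measurable_fun setT (f w)) ->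
  measurable_fun setT (fun t => \sum_w f w t).
Proof.
move=> mf; elim: (index_enum W) => [|w s IHs].
  apply: (eq_measurable_fun (fun=> 0 : R[i])); last exact: measurable_cst.
  by move=> t _; rewrite big_nil.
apply: (eq_measurable_fun (fun t => f w t + \sum_(w' <- s) f w' t)).
  by move=> t _; rewrite big_cons.
exact: measurable_Cadd.
Qed.

Lemma measurable_spread (R : realType) d (T : measurableType d) (W : finType)
    (x : W -> T -> R[i]) : (forall w, measurable_fun setT (x w)) ->
  measurable_fun setT (fun t => spread (x^~ t)).
Proof.
move=> mx; apply: measurable_funM => //; apply: measurable_sum => w.
apply: measurable_nsq; apply: measurable_Cadd => //.
apply: (eq_measurable_fun (fun t => (\sum_w x w t) * - #|W|%:R^-1)).
  by move=> t _; rewrite /mean mulrN.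
by apply: measurable_Cmul; [exact: measurable_Csum|exact: measurable_cst].
Qed.

(** * Codes over a fixed block of fading states *)

Section code.
Context {R : realType} {n : nat} {B : 'I_2 -> nat} (c : Defs.code R n B).
Notation C := (R[i]).
Notation M := ('M[R[i]]_2).

(** The counterpart of [codeword] on a finite block of states, where measurability in the states is
    available. *)
Definition symbol (k : 'I_2) (w : 'I_(2 ^ B k)) (i : 'I_n) (h : n.-tuple M) : C :=
  @enc _ _ _ c k i w [tuple tnth h (widen_ord (ltn_ord i) j) | j < i.+1].

Definition symbol_spread (k : 'I_2) (i : 'I_n) (h : n.-tuple M) : R :=
  spread (fun w : 'I_(2 ^ B k) => symbol k w i h).

Definition received (m : 'I_2) (w : messages B) (h : n.-tuple M) (z : n.-tuple C) :=
  [tuple tnth h i m 0 * symbol 0 (w 0) i h + tnth h i m 1 * symbol 1 (w 1) i h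
    + tnth z i | i < n].

Definition correct (k : 'I_2) (w : messages B) : set (n.-tuple M * n.-tuple C) :=
  [set x | dec c k x.1 (received k w x.1 x.2) = w k].

Lemma measurable_symbol k w i : measurable_fun setT (symbol k w i).
Proof.
apply: (measurableT_comp (@enc_measurable _ _ _ c k i w)).
by apply: measurable_mktuple => j; exact: measurable_tnth.
Qed.

Lemma measurable_symbol_spread k i : measurable_fun setT (symbol_spread k i).
Proof. by apply: measurable_spread => w; exact: measurable_symbol. Qed.

Lemma symbol_spread_ge0 k i h : 0 <= symbol_spread k i h.
Proof. exact: spread_ge0. Qed.

Let message0 (k : 'I_2) : 'I_(2 ^ B k) := Ordinal (expn_gt0 2 (B k)).

Lemma sum_symbol_spread (Pbar : 'I_2 -> R) k h : power_constraint Pbar c ->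
  \sum_i symbol_spread k i h <= n%:R * Pbar k.
Proof.
move=> Pc; pose N : R := #|'I_(2 ^ B k)|%:R.
have N0 : 0 < N by rewrite ltr0n; apply/card_gt0P; exists (message0 k).
apply: (@le_trans _ _ (\sum_i avg (fun w => nsq (symbol k w i h)))).
  by apply: ler_sum => i _; exact: spread_le.
rewrite -mulr_suml exchange_big /= ler_pdivrMr// -/N.
apply: (@le_trans _ _ (\sum_(w : 'I_(2 ^ B k)) n%:R * Pbar k)); last first.
  by rewrite sumr_const -[_ *+ _]mulr_natr.
(* The power constraint is stated for infinite paths; the block is continued by 0, which the symbols
   do not see. *)
apply: ler_sum => w _; apply: le_trans (Pc k w (fun j => nth 0 h j)).
apply: ler_sum => i _; rewrite normc_sqr /codeword /symbol.
rewrite le_eqVlt; apply/orP; left; apply/eqP; congr (nsq (enc _ _ _)).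
by apply: eq_from_tnth => j; rewrite !tnth_mktuple (tnth_nth 0).
Qed.

Lemma measurable_correct k w : measurable (correct k w).
Proof.
pose f (x : n.-tuple M * n.-tuple C) := (x.1, received k w x.1 x.2).
have mf : measurable_fun setT f.
  apply/measurable_fun_pairP; split; first exact: measurable_fst.
  have ms j v i : measurable_fun setT
      (fun x : n.-tuple M * n.-tuple C => symbol j v i x.1).
    by apply: (measurableT_comp (measurable_symbol j v i)); exact: measurable_fst.
  have mh j i : measurable_fun setT
      (fun x : n.-tuple M * n.-tuple C => tnth x.1 i k j).
    apply: (measurableT_comp (measurable_entry R k j)).
    by apply: (measurableT_comp (measurable_tnth i)); exact: measurable_fst.
  apply: measurable_mktuple => i; apply: measurable_Cadd.
    by apply: measurable_Cadd; apply: measurable_Cmul.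
  by apply: (measurableT_comp (measurable_tnth i)); exact: measurable_snd.
rewrite (_ : correct k w = f @^-1` [set x | dec c k x.1 x.2 = w k])//.
by rewrite -[X in measurable X]setTI; apply: mf => //; exact: dec_measurable.
Qed.

(** With [u] and [v] left free, the pairs [(0, 1)] and [(1, 0)] give the two sum rates. Passing from
    nats to bits turns the constant 2 into [2 / ln 2]. *)
Lemma code_rate_bound (u v : 'I_2) (h : n.-tuple M) : u != v ->
  (forall i, gain u v (tnth h i) < gain v v (tnth h i)) ->
  \sum_(w : messages B) (fine (gaussn n (xsection (correct u w) h)) * (B u)%:R
     + fine (gaussn n (xsection (correct v w) h)) * (B v)%:R) <=
  #|{: messages B}|%:R * (2 / ln 2 + \sum_i
    rate (gain u u (tnth h i)) (gain u v (tnth h i)) (gain v v (tnth h i))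
      (symbol_spread u i h) (symbol_spread v i h)).
Proof.
move=> uv weak.
have ln2_gt0 : 0 < ln 2 :> R by rewrite ln_gt0// ltr1n.
have swap (X : 'I_2 -> C) : X 0 + X 1 = X u + X v.
  have I2 (j : 'I_2) : j = 0 \/ j = 1.
    by case: j => [[|[|//]] ?]; [left|right]; exact: val_inj.
  move: uv; case: (I2 u) => ->; case: (I2 v) => ->; rewrite ?eqxx// => _.
  exact: addrC.
pose D1 y := dec c u h y.
(* Knowing [w1], the genie-aided decoder adds the signal of user [u] back and runs the decoder of
   the code. *)
pose D2 (w1 : 'I_(2 ^ B u)) y := dec c v h
  [tuple tnth h i v u * symbol u w1 i h + tnth y i | i < n].
have mdec k w : measurable [set y | dec c k h y = w].
  have := measurable_xsection h (@dec_measurable _ _ _ c k w).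
  by congr measurable; apply/seteqP; split => y; rewrite /xsection /= inE.
have mD2 w1 w : measurable [set y | D2 w1 y = w].
  rewrite (_ : [set y | _] = (fun y => [tuple tnth h i v u * symbol u w1 i h + tnth y i
      | i < n]) @^-1` [set y | dec c v h y = w])//.
  rewrite -[X in measurable X]setTI.
  apply: (_ : measurable_fun setT _) => //; apply: measurable_mktuple => i.
  by apply: measurable_Cadd => //; exact: measurable_tnth.
have := code_inequality n _ _ (message0 u) (message0 v) (fun i => tnth h i u u)
  (fun i => tnth h i u v) (fun i => tnth h i v v) (fun w i => symbol u w i h)
  (fun w i => symbol v w i h) weak D1 D2 (mdec u) mD2.
have E1 w : xsection (correct u w) h = [set z | D1
    [tuple tnth h i u u * symbol u (w u) i h +
      (tnth h i u v * symbol v (w v) i h + tnth z i) | i < n] = w u].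
  apply/seteqP; split => z; rewrite /xsection /correct /= inE /= /D1;
    congr (dec _ _ _ _ = _); apply: eq_from_tnth => i; rewrite !tnth_mktuple;
    by rewrite addrA (swap (fun k => tnth h i u k * symbol k (w k) i h)).
have E2 w : xsection (correct v w) h = [set z | D2 (w u)
    [tuple tnth h i v v * symbol v (w v) i h + tnth z i | i < n] = w v].
  apply/seteqP; split => z; rewrite /xsection /correct /= inE /= /D2;
    congr (dec _ _ _ _ = _); apply: eq_from_tnth => i; rewrite !tnth_mktuple;
    by rewrite addrA (swap (fun k => tnth h i v k * symbol k (w k) i h)).
under [X in _ -> X <= _]eq_bigr do rewrite E1 E2.
rewrite big_split -!mulr_suml /= (card_messages _ _ _ uv) natrM -mulr_sumr.
rewrite !card_ord !natrX !lnXn// -![ln 2 *+ _]mulr_natr.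
rewrite -(big_messages R B u v (fun w1 w2 => fine (gaussn n [set z | D1
  [tuple tnth h i u u * symbol u w1 i h + (tnth h i u v * symbol v w2 i h + tnth z i)
     | i < n] = w1])) uv).
rewrite -(big_messages R B u v (fun w1 w2 => fine (gaussn n [set z | D2 w1
  [tuple tnth h i v v * symbol v w2 i h + tnth z i | i < n] = w2])) uv).
move: (\sum_w _) (\sum_w _) (\sum_i rate _ _ _ _ _) => X Y S bound.
rewrite -(ler_pM2r ln2_gt0); move: bound; congr (is_true (_ <= _)); first by ring.
by rewrite -!mulrA; congr (_ * (_ * _)); rewrite mulrDl divfK ?lt0r_neq0// [S * _]mulrC.
Qed.

End code.

(** * Averaging the converse over the fading *)

Section expected_rate.
Context {R : realType} {d : measure_display} {T : measurableType d}.
Variables (P : probability T R) (H : nat -> {RV P >-> 'M[R[i]]_2})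
  (Z : 'I_2 -> nat -> {RV P >-> R[i]}).
Hypotheses (Z_gaussian : forall m i, standard_complex_gaussian (Z m i))
  (Z_independent : forall m, mutually_independent (Z m))
  (HZ_independent : forall m, independent_processes H (Z m)).
Context (n : nat) (B : 'I_2 -> nat) (c : Defs.code R n B).

Definition states (t : T) : n.-tuple 'M[R[i]]_2 := [tuple H i t | i < n].

Lemma measurable_states : measurable_fun setT states.
Proof. by apply: measurable_mktuple => i; exact: measurable_funPT. Qed.

Let decodedE k w : [set t | decoded H Z c w k t = w k] =
  [set t | correct c k w (states t, [tuple Z k i t | i < n])].
Proof.
apply/funext => t; rewrite /correct /decoded /=; congr (dec c k _ _ = _).
apply: eq_from_tnth => i; rewrite !tnth_mktuple /output /symbol /codeword.
suff -> : [tuple fading_path H t j | j < i.+1] =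
  [tuple tnth (states t) (widen_ord (ltn_ord i) j) | j < i.+1] by [].
by apply: eq_from_tnth => j; rewrite !tnth_mktuple.
Qed.

Let measurable_decoded k w : measurable [set t | decoded H Z c w k t = w k].
Proof.
rewrite decodedE -[X in measurable X]setTI.
apply: (_ : measurable_fun setT (fun t => (states t, [tuple Z k i t | i < n]))) => //;
  last exact: measurable_correct.
apply/measurable_fun_pairP; split; first exact: measurable_states.
by apply: measurable_mktuple => i; exact: measurable_funPT.
Qed.

Let prob_decoded k w : (P [set t | decoded H Z c w k t = w k] =
  \int[P]_t gaussn n (xsection (correct c k w) (states t)))%E.
Proof.
rewrite decodedE /states joint_law//; last exact: measurable_correct.
apply: eq_integral => t _; congr (gaussn n _).
by apply/seteqP; split => z; rewrite /xsection /= inE.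
Qed.

Let measurable_error w : measurable (error_event H Z c w).
Proof.
rewrite (_ : error_event H Z c w =
    \bigcup_(k in [set: 'I_2]) ~` [set t | decoded H Z c w k t = w k]); last first.
  by apply/seteqP; split => t [k]; [exists k|exists k].
by apply: fin_bigcup_measurable => // k _; apply: measurableC.
Qed.

Let e w := fine (P (error_event H Z c w)).

Let errorE w : P (error_event H Z c w) = (e w)%:E.
Proof. by rewrite fineK// fin_num_measure. Qed.

Let prob_correct_ge k w :
  ((1 - e w)%:E <= \int[P]_t gaussn n (xsection (correct c k w) (states t)))%E.
Proof.
rewrite -prob_decoded -[X in P X]setCK probability_setC//; last exact: measurableC.
rewrite EFinB -errorE leeB// le_measure ?inE//; first exact: measurableC.
by move=> t h; exists k.
Qed.

Let N : R := #|{: messages B}|%:R.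

Let N_gt0 (u v : 'I_2) : u != v -> 0 < N.
Proof. by move=> uv; rewrite /N (card_messages _ _ _ uv) ltr0n muln_gt0 !expn_gt0. Qed.

(** The error event contains the errors of both users, so each is decoded correctly with probability
    at least one minus its probability. By [joint_law] these probabilities are means over the fading
    of those bounded in [code_rate_bound]. *)
Lemma code_converse (u v : 'I_2) : u != v ->
  (forall i, {ae P, forall t, gain u v (H i t) < gain v v (H i t)}) ->
  (((1 - fine (avg_error H Z c)) * ((B u)%:R + (B v)%:R) - 2 / ln 2)%:E <=
   \sum_(i < n) \int[P]_t (rate (gain u u (H i t)) (gain u v (H i t))
     (gain v v (H i t)) (symbol_spread c u i (states t))
     (symbol_spread c v i (states t)))%:E)%E.
Proof.
move=> uv weak; have N0 := N_gt0 _ _ uv.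
have ln2_gt0 : 0 < ln 2 :> R by rewrite ln_gt0// ltr1n.
pose g k w t := fine (gaussn n (xsection (correct c k w) (states t))).
have gE k w t : gaussn n (xsection (correct c k w) (states t)) = (g k w t)%:E.
  by rewrite fineK// fin_num_measure//; apply: measurable_xsection; exact: measurable_correct.
have g0 k w t : 0 <= g k w t by rewrite fine_ge0.
have mg k w : measurable_fun setT (g k w).
  apply/measurable_EFinP.
  apply: (eq_measurable_fun (fun t => gaussn n (xsection (correct c k w) (states t)))).
    by move=> t _; rewrite gE.
  exact: (measurableT_comp
    (measurable_fun_xsection (gaussn n) (measurable_correct c k w)) measurable_states).
pose r (i : 'I_n) t := rate (gain u u (H i t)) (gain u v (H i t))
     (gain v v (H i t)) (symbol_spread c u i (states t))
     (symbol_spread c v i (states t)).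
have r0 i t : 0 <= r i t.
  by apply: rate_ge0; rewrite ?gain_ge0 ?symbol_spread_ge0.
have mr i : measurable_fun setT (r i).
  have mH m k : measurable_fun setT (fun t => gain m k (H i t)).
    by apply: (measurableT_comp (measurable_gain R m k)); exact: measurable_funPT.
  have mq k : measurable_fun setT (fun t => symbol_spread c k i (states t)).
    apply: (measurableT_comp (measurable_symbol_spread c k i)).
    exact: measurable_states.
  apply: measurable_rate => // t; [exact: gain_ge0|exact: symbol_spread_ge0].
have bound : (\int[P]_t (\sum_w (g u w t * (B u)%:R + g v w t * (B v)%:R))%:E <=
    \int[P]_t (N * (2 / ln 2 + \sum_i r i t))%:E)%E.
  apply: ae_ge0_le_integral => //.
  - by move=> t _; rewrite lee_fin sumr_ge0// => w _; rewrite addr_ge0// mulr_ge0.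
  - apply/measurable_EFinP; apply: measurable_sum => w.
    by apply: measurable_funD; exact: measurable_funM.
  - move=> t _; rewrite lee_fin mulr_ge0 ?(ltW N0)// addr_ge0// ?sumr_ge0//.
    by rewrite divr_ge0// ltW.
  - apply/measurable_EFinP; apply: measurable_funM => //.
    by apply: measurable_funD => //; exact: measurable_sum.
  - have : {ae P, forall t, forall i : 'I_n, gain u v (H i t) < gain v v (H i t)}.
      exact: filter_forall.
    apply: filterS => t ht _; rewrite lee_fin.
    have statesE i : tnth (states t) i = H i t by rewrite tnth_mktuple.
    have h i : gain u v (tnth (states t) i) < gain v v (tnth (states t) i).
      by rewrite statesE.
    apply: le_trans (code_rate_bound c u v (states t) uv h) _; rewrite -/N.
    by under eq_bigr do rewrite statesE.
have rhs : (\int[P]_t (N * (2 / ln 2 + \sum_i r i t))%:E =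
    N%:E * ((2 / ln 2)%:E + \sum_i \int[P]_t (r i t)%:E))%E.
  have S0 t : 0 <= \sum_i r i t by exact: sumr_ge0.
  have c0 : 0 <= 2 / ln 2 :> R by rewrite divr_ge0// ltW.
  rewrite ge0_integral_EFinZ ?(ltW N0)//; last 2 first.
  - by move=> t; rewrite addr_ge0.
  - by apply: measurable_funD => //; exact: measurable_sum.
  rewrite ge0_integral_EFinD//; last exact: measurable_sum.
  by rewrite integral_cst_probability ge0_integral_EFin_sum.
have lhs : ((N * ((1 - fine (avg_error H Z c)) * ((B u)%:R + (B v)%:R)))%:E <=
    \int[P]_t (\sum_w (g u w t * (B u)%:R + g v w t * (B v)%:R))%:E)%E.
  have gB k w t : 0 <= (B k)%:R * g k w t by rewrite mulr_ge0.
  have mgB k w : measurable_fun setT (fun t => (B k)%:R * g k w t).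
    exact: measurable_funM.
  rewrite ge0_integral_EFin_sum; last 2 first.
  - by move=> w t; rewrite ![_ * _%:R]mulrC addr_ge0.
  - by move=> w; apply: measurable_funD; exact: measurable_funM.
  have -> : N * ((1 - fine (avg_error H Z c)) * ((B u)%:R + (B v)%:R)) =
      \sum_w ((B u)%:R * (1 - e w) + (B v)%:R * (1 - e w)).
    under eq_bigr do rewrite -mulrDl.
    rewrite -mulr_sumr sumrB sumr_const -/N /avg_error.
    under eq_bigr do rewrite errorE.
    rewrite sumEFin -EFinM /= -/N mulrBl mul1r; field.
    by rewrite lt0r_neq0.
  rewrite -sumEFin; apply: lee_sum => w _.
  under eq_integral do rewrite ![_ * _%:R]mulrC.
  rewrite ge0_integral_EFinD// EFinD !EFinM.
  rewrite !ge0_integral_EFinZ//.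
  have le k : ((1 - e w)%:E <= \int[P]_t (g k w t)%:E)%E.
    apply: le_trans (prob_correct_ge k w) _.
    by under eq_integral do rewrite gE.
  by apply: leeD; apply: lee_wpmul2l; rewrite ?lee_fin.
have := le_trans lhs bound; rewrite rhs -/(r _ _).
case: (\sum_i _)%E => [s||].
- rewrite -EFinD -EFinM !lee_fin ler_pM2l//; lra.
- by rewrite leey.
- by rewrite addeNy gt0_muleNy.
Qed.

End expected_rate.

(** * From a code to a power policy *)

Section policy_of_code.
Context {R : realType} {d : measure_display} {T : measurableType d}.
Variables (P : probability T R) (H : nat -> {RV P >-> 'M[R[i]]_2})
  (Z : 'I_2 -> nat -> {RV P >-> R[i]}) (Pbar : 'I_2 -> R).
Hypotheses (H_stationary : stationary H)
  (Z_gaussian : forall m i, standard_complex_gaussian (Z m i))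
  (Z_independent : forall m, mutually_independent (Z m))
  (HZ_independent : forall m, independent_processes H (Z m))
  (H_weak : {ae P, forall t, uniformly_weak (H 0%N t)}).

Notation M := ('M[R[i]]_2).
Notation mu := (distribution P (H 0%N)).

Definition sum_rates : bool -> M -> ('I_2 -> R) -> R :=
  rates (gain 0 0) (gain 0 1) (gain 1 1) (gain 1 0).

Let weak i : {ae P, forall t, uniformly_weak (H i t)}.
Proof. exact: (stationary_ae _ _ H_stationary i _ (measurable_uniformly_weak R)). Qed.

Let weak01 i : {ae P, forall t, gain 0 1 (H i t) < gain 1 1 (H i t)}.
Proof. by apply: filterS (weak i) => t /uniformly_weakE[]. Qed.

Let weak10 i : {ae P, forall t, gain 1 0 (H i t) < gain 0 0 (H i t)}.
Proof. by apply: filterS (weak i) => t /uniformly_weakE[]. Qed.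

Context {n : nat} {B : 'I_2 -> nat} (c : Defs.code R n B).
Hypotheses (n_gt0 : (0 < n)%N) (c_power : power_constraint Pbar c).

Let q k i t := symbol_spread c k i (states P H n t).

Let mq k (i : 'I_n) : measurable_fun setT (q k i).
Proof.
apply: (measurableT_comp (measurable_symbol_spread c k i)).
exact: measurable_states.
Qed.

Let q0 k i t : 0 <= q k i t. Proof. exact: symbol_spread_ge0. Qed.

Let sum_q k t : \sum_i q k i t <= n%:R * Pbar k.
Proof. exact: sum_symbol_spread. Qed.

Let int_q k i : (\int[P]_t (q k i t)%:E < +oo)%E.
Proof.
apply: (@le_lt_trans _ _ (\int[P]_t (n%:R * Pbar k)%:E)%E); last first.
  by rewrite integral_cst_probability ltry.
apply: ge0_le_integral => //.
- by move=> t _; rewrite lee_fin.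
- exact/measurable_EFinP.
- move=> t _; rewrite lee_fin; apply: le_trans (sum_q k t).
  by rewrite (bigD1 i)//= lerDl sumr_ge0.
Qed.

Let nR_gt0 : 0 < n%:R :> R. Proof. by rewrite ltr0n. Qed.

(** Conditioning on the state at time [i] gives a function of that state for each [i]. All states
    have the law [mu] by stationarity, so the functions can be averaged over [i] into one policy. *)
Let averaged_policy : exists p : 'I_2 -> M -> R, policy mu Pbar p /\
  forall k (g : M -> \bar R), measurable_fun setT g -> (forall s, 0 <= g s)%E ->
    (\sum_(i < n) \int[P]_t (g (H i t) * (q k i t)%:E) =
     \sum_(i < n) \int[P]_t (g (H i t) * (p k (H i t))%:E))%E.
Proof.
have /choice[p pP] (ki : 'I_2 * 'I_n) :=
  conditional_expectation P (H ki.2) (q ki.1 ki.2) (mq ki.1 ki.2)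
    (q0 ki.1 ki.2) (int_q ki.1 ki.2).
pose pn k s := n%:R^-1 * \sum_i p (k, i) s.
have p0 ki s : 0 <= p ki s by have [_ ] := pP ki.
have mp ki : measurable_fun setT (p ki) by have [] := pP ki.
have pn0 k s : 0 <= pn k s by rewrite mulr_ge0 ?invr_ge0 ?sumr_ge0// ltW.
have mpn k : measurable_fun setT (pn k).
  by apply: measurable_funM => //; apply: measurable_sum => i.
have E k (g : M -> \bar R) : measurable_fun setT g -> (forall s, 0 <= g s)%E ->
    (\sum_(i < n) \int[P]_t (g (H i t) * (q k i t)%:E) =
     n%:R%:E * \int[mu]_s (g s * (pn k s)%:E))%E.
  move=> mg g0.
  have gE (f : M -> R) : measurable_fun setT f ->
      measurable_fun setT (fun s => g s * (f s)%:E)%E.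
    by move=> mf; apply: emeasurable_funM => //; exact/measurable_EFinP.
  have gf0 (f : M -> R) s : 0 <= f s -> (0 <= g s * (f s)%:E)%E.
    by move=> f0; rewrite mule_ge0// lee_fin.
  rewrite -ge0_integralZl//; last 2 first.
  - exact: gE.
  - by move=> s _; exact: gf0.
  transitivity (\int[mu]_s \sum_(i < n) (g s * (p (k, i) s)%:E))%E.
    rewrite ge0_integral_sum//; last 2 first.
    - by move=> i; exact: gE.
    - by move=> i s _; exact: gf0.
    apply: eq_bigr => i _; have [_ _ ->//] := pP (k, i).
    apply: (stationary_integral _ _ H_stationary i (fun s => g s * (p (k, i) s)%:E)%E).
      exact: gE.
    by move=> s; exact: gf0.
  apply: eq_integral => s _; rewrite muleCA -EFinM /pn mulVKf ?lt0r_neq0//.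
  by rewrite -sumEFin ge0_sume_distrr// => i _; rewrite lee_fin.
exists pn; split => [k|k g mg g0]; last first.
  rewrite E//; transitivity (\sum_(i < n) \int[mu]_s (g s * (pn k s)%:E))%E.
    by rewrite sumr_const card_ord mule_natl.
  apply: eq_bigr => i _; symmetry.
  apply: (stationary_integral _ _ H_stationary i (fun s => g s * (pn k s)%:E)%E).
    by apply: emeasurable_funM => //; exact/measurable_EFinP.
  by move=> s; rewrite mule_ge0// lee_fin.
(* The test function 1 turns the block power constraint into the mean power constraint. *)
split => //; have := E k (cst 1%E) (measurable_cst _) (fun=> lee01).
under eq_bigr do under eq_integral do rewrite /= mul1e.
under [X in (_ = _ * X)%E]eq_integral do rewrite /= mul1e.
rewrite -ge0_integral_EFin_sum// => sum_int.
have : (n%:R%:E * \int[mu]_s (pn k s)%:E <= n%:R%:E * (Pbar k)%:E)%E.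
  rewrite -sum_int -EFinM -(integral_cst_probability _ _ _ P (n%:R * Pbar k)%:E).
  apply: ge0_le_integral => //.
  - by move=> t _; rewrite lee_fin sumr_ge0.
  - by apply/measurable_EFinP; apply: measurable_sum.
  - by move=> t _; rewrite lee_fin.
by rewrite lee_pmul2l.
Qed.

(** The policy is chosen before [j]: the same one serves both sum rates, so the bound involves the
    minimum for a single policy. *)
Lemma policy_of_code : exists p, policy mu Pbar p /\ forall j,
  (((1 - fine (avg_error H Z c)) * ((B 0)%:R + (B 1)%:R) - 2 / ln 2)%:E <=
   n%:R%:E * payoff mu bool sum_rates j p)%E.
Proof.
have [p [pp pE]] := averaged_policy; exists p; split => // j.
have [mp0 p00 _] := pp 0; have [mp1 p10 _] := pp 1.
have sumE u v : measurable_fun setT (p u) -> measurable_fun setT (p v) ->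
    (forall s, 0 <= p u s) -> (forall s, 0 <= p v s) ->
    (\sum_(i < n) \int[P]_t (rate (gain u u (H i t)) (gain u v (H i t))
      (gain v v (H i t)) (p u (H i t)) (p v (H i t)))%:E =
    n%:R%:E * \int[mu]_s (rate (gain u u s) (gain u v s) (gain v v s) (p u s) (p v s))%:E)%E.
  move=> mu_ mv pu0 pv0.
  transitivity (\sum_(i < n) \int[mu]_s
      (rate (gain u u s) (gain u v s) (gain v v s) (p u s) (p v s))%:E)%E.
    apply: eq_bigr => i _.
    apply: (stationary_integral _ _ H_stationary i (fun s =>
      (rate (gain u u s) (gain u v s) (gain v v s) (p u s) (p v s))%:E)).
      apply/measurable_EFinP; apply: measurable_rate => //;
        by [exact: measurable_gain|move=> s; exact: gain_ge0].
    by move=> s; rewrite lee_fin rate_ge0// gain_ge0.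
  by rewrite sumr_const card_ord mule_natl.
have mg := measurable_gain R.
have g0 m k : forall s : M, 0 <= gain m k s by move=> s; exact: gain_ge0.
case: j; rewrite /payoff /sum_rates /rates.
- rewrite -sumE//.
  apply: le_trans (code_converse _ _ _ Z_gaussian Z_independent HZ_independent _ _ c
    0 1 isT weak01) _.
  apply: (rate_jensen P _ _ _ (mg 0 0) (mg 0 1) (mg 1 1) (g0 0 0) (g0 0 1) (g0 1 1) n
    (fun i : 'I_n => H i) (q 0) (q 1) (p 0) (p 1)) => //.
  + by move=> i; apply: filterS (weak01 i) => t /ltW.
  + exact: pE.
  + exact: pE.
- rewrite -sumE// [(B 0)%:R + _]addrC.
  apply: le_trans (code_converse _ _ _ Z_gaussian Z_independent HZ_independent _ _ c
    1 0 isT weak10) _.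
  apply: (rate_jensen P _ _ _ (mg 1 1) (mg 1 0) (mg 0 0) (g0 1 1) (g0 1 0) (g0 0 0) n
    (fun i : 'I_n => H i) (q 1) (q 0) (p 1) (p 0)) => //.
  + by move=> i; apply: filterS (weak10 i) => t /ltW.
  + exact: pE.
  + exact: pE.
Qed.

End policy_of_code.

(** * Sum-capacity *)

Section sum_capacity.
Context {R : realType} {d : measure_display} {T : measurableType d}.
Variables (P : probability T R) (H : nat -> {RV P >-> 'M[R[i]]_2})
  (Z : 'I_2 -> nat -> {RV P >-> R[i]}) (Pbar : 'I_2 -> R).
Hypotheses (H_stationary : stationary H)
  (Z_gaussian : forall m i, standard_complex_gaussian (Z m i))
  (Z_independent : forall m, mutually_independent (Z m))
  (HZ_independent : forall m, independent_processes H (Z m))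
  (H_weak : {ae P, forall t, uniformly_weak (H 0%N t)}).

Notation mu := (distribution P (H 0%N)).
Notation value p := (Order.min (payoff mu bool sum_rates true p)
  (payoff mu bool sum_rates false p)).

Lemma power_policyE (p : 'I_2 -> 'M[R[i]]_2 -> R) :
  power_policy H Pbar p <-> policy mu Pbar p.
Proof.
have E k : measurable_fun setT (p k) -> (forall h, 0 <= p k h) ->
    ('E_P[p k \o H 0%N] = \int[mu]_h (p k h)%:E)%E.
  move=> mp p0; rewrite unlock ge0_integral_distribution//.
  exact/measurable_EFinP.
by split=> pp k; have [mp p0 pP] := pp k; split=> //; move: pP; rewrite E.
Qed.

Lemma S_w_payoff (p : 'I_2 -> 'M[R[i]]_2 -> R) : policy mu Pbar p ->
  S_w1 H p = payoff mu bool sum_rates true p /\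
  S_w2 H p = payoff mu bool sum_rates false p.
Proof.
move=> pp; have [mp0 p00 _] := pp 0; have [mp1 p10 _] := pp 1.
have mg := measurable_gain R; have g0 := gain_ge0 R.
split; rewrite /payoff ge0_integral_distribution.
- by rewrite /S_w1 unlock; under eq_integral do rewrite /= !normc_sqr.
- by apply/measurable_EFinP; apply: measurable_rate.
- by move=> h; rewrite lee_fin rate_ge0.
- by rewrite /S_w2 unlock; under eq_integral do rewrite /= !normc_sqr.
- by apply/measurable_EFinP; apply: measurable_rate.
- by move=> h; rewrite lee_fin rate_ge0.
Qed.

Lemma achievable_le (m : R) (r : R * R) :
  (forall p, policy mu Pbar p -> (value p <= m%:E)%E) ->
  achievable H Z Pbar r -> r.1 + r.2 <= m.
Proof.
move=> vm [B [c [Pc r1 r2 err]]].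
(* The left side of [policy_of_code] divided by the block length. *)
pose u n : R := (1 - fine (avg_error H Z (c n))) *
  ((B n 0)%:R / n%:R + (B n 1)%:R / n%:R) - 2 / ln 2 * n%:R^-1.
have ucvg : u n @[n --> \oo] --> r.1 + r.2.
  rewrite (_ : r.1 + r.2 = (1 - 0) * (r.1 + r.2) - 2 / ln 2 * 0); last by ring.
  apply: cvgB; last first.
    apply: cvgMl_tmp; apply/gtr0_cvgV0; last exact: cvgr_idn.
    by near=> n; rewrite ltr0n; near: n; exact: nbhs_infty_gt.
  apply: cvgM; last exact: cvgD.
  by apply: cvgB; [exact: cvg_cst|exact: fine_cvg].
rewrite -(cvg_lim _ ucvg)//; apply: limr_le; first exact: cvgP ucvg.
near=> n; have n0 : (0 < n)%N by near: n; exact: nbhs_infty_gt.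
have nR : 0 < n%:R :> R by rewrite ltr0n.
have [p [pp pj]] := policy_of_code P H Z Pbar H_stationary Z_gaussian Z_independent
  HZ_independent H_weak (c n) n0 (Pc n).
rewrite -(ler_pM2l nR) -lee_fin EFinM.
apply: (@le_trans _ _ (n%:R%:E * value p)%E); last first.
  by rewrite EFinM; apply: lee_wpmul2l; [rewrite lee_fin ltW|exact: vm].
rewrite [leLHS](_ : _ = ((1 - fine (avg_error H Z (c n))) *
  ((B n 0)%:R + (B n 1)%:R) - 2 / ln 2)%:E); last first.
  by rewrite -EFinM; congr _%:E; rewrite /u; field; rewrite !lt0r_neq0 ?ln_gt0 ?ltr1n.
by rewrite minEle; case: ifP.
Unshelve. all: by end_near. Qed.

(** The half-plane below a finite [m] is closed, so the bound passes from the achievable pairs to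
    their closure. *)
Lemma sum_capacity_le (m : \bar R) : (0 <= m)%E ->
  (forall p, policy mu Pbar p -> (value p <= m)%E) ->
  (sum_capacity H Z Pbar <= m)%E.
Proof.
case: m => [m||] // _ vm; last by rewrite leey.
apply: ge_ereal_sup => _ [r rC <-]; rewrite lee_fin.
have closed_m : closed [set x : R * R | x.1 + x.2 <= m].
  have := @preimage_closed _ _ (fun x : R * R => x.1 + x.2) [set x | x <= m].
  apply; last exact: closed_le.
  by move=> x _; apply: cvgD; [exact: cvg_fst|exact: cvg_snd].
suff : [set x : R * R | x.1 + x.2 <= m] r by [].
by apply: closed_m; apply: closureS rC => x; exact: achievable_le.
Qed.

End sum_capacity.

Theorem theorem6 (R : realType) (d : measure_display) (T : measurableType d)
    (P : probability T R)
    (H : nat -> {RV P >-> 'M[R[i]]_2})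
    (Z : 'I_2 -> nat -> {RV P >-> R[i]})
    (Pbar : 'I_2 -> R)
    (Pbar_ge0 : forall k, 0 <= Pbar k)
    (H_stationary : stationary H)
    (H_ergodic : ergodic H)
    (Z_gaussian : forall m i, standard_complex_gaussian (Z m i))
    (Z_independent : forall m, mutually_independent (Z m))
    (HZ_independent : forall m, independent_processes H (Z m))
    (H_weak : {ae P, forall t, uniformly_weak (H 0%N t)}) :
  exists pmax : 'I_2 -> 'M[R[i]]_2 -> R,
    [/\ power_policy H Pbar pmax,
        forall p, power_policy H Pbar p ->
          (Order.min (S_w1 H p) (S_w2 H p) <=
           Order.min (S_w1 H pmax) (S_w2 H pmax))%E &
        (sum_capacity H Z Pbar <=
         Order.min (S_w1 H pmax) (S_w2 H pmax))%E].
Proof.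
have mg := measurable_gain R; have g0 := gain_ge0 R.
have h_weak := distribution_ae P (H 0%N) _ (measurable_uniformly_weak R) H_weak.
have bc : {ae distribution P (H 0%N), forall h, gain 0 1 h <= gain 1 1 h}.
  by apply: filterS h_weak => h /uniformly_weakE[_ /ltW].
have ea : {ae distribution P (H 0%N), forall h, gain 1 0 h <= gain 0 0 h}.
  by apply: filterS h_weak => h /uniformly_weakE[/ltW].
have [pmax pp pmaxP] := optimal_rates (distribution P (H 0%N)) Pbar
  (gain 0 0) (gain 0 1) (gain 1 1) (gain 1 0) (mg 0 0) (mg 0 1) (mg 1 1) (mg 1 0)
  (g0 0 0) (g0 0 1) (g0 1 1) (g0 1 0) bc ea Pbar_ge0.
exists pmax; have [-> ->] := S_w_payoff P H Pbar pmax pp; split.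
- exact/power_policyE.
- by move=> p /power_policyE qp; have [-> ->] := S_w_payoff P H Pbar p qp; exact: pmaxP.
- apply: sum_capacity_le => //; rewrite le_min; apply/andP.
  have [_ p00 _] := pp 0; have [_ p10 _] := pp 1.
  by split; apply: integral_ge0 => h _; rewrite lee_fin rate_ge0.
Qed.
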